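(* Let $\mathbb{Q}$ be a bounded signed measure and $\mathbf{P}$ a probability measure with $\mathbb{Q}\ll\mathbf{P}$, let $D$ be the density process of $\mathbb{Q}$ with respect to $\mathbf{P}$, and $H=\{t: D_t=0\}$. Let $M=m+v$ be a continuous $\mathbf{P}$-semimartingale such that $\{t\geq0: M_{t}=0\}\subset H$. Then the following are equivalent: 1. $M$ is a $(\mathbb{Q},\mathbf{P})$-local martingale. 2. $|M|$ is a $(\mathbb{Q},\mathbf{P})$-local martingale.
   Context: Setting: $(\Omega,\mathcal{F}_\infty,\mathbb{Q})$ is a measure space with $\mathbb{Q}$ a bounded signed measure; $\mathbf{P}$ is a probability measure on $\mathcal{F}_\infty$ with $\mathbb{Q}\ll\mathbf{P}$; $(\mathcal{F}_t)_{t\ge0}$ is a right-continuous filtration completed with respect to $\mathbf{P}$ with $\mathcal{F}_\infty=\bigvee_t\mathcal{F}_t$. $D_t=\frac{d\mathbb{Q}}{d\mathbf{P}}\big|_{\mathcal{F}_t}$, a uniformly integrable $\mathbf{P}$-martingale with limit $D_\infty$; $H=\{t: D_t=0\}$ (a random set). Standing assumptions: $D$ is continuous and $\mathbf{P}(D_\infty=0)=0$. An $(\mathcal{F}_t)$-adapted process $M$ is a $(\mathbb{Q},\mathbf{P})$-martingale (resp. local martingale) if $M$ is a $\mathbf{P}$-semimartingale and $MD$ is a $\mathbf{P}$-martingale (resp. $\mathbf{P}$-local martingale). In $M=m+v$, $m$ is the $\mathbf{P}$-local martingale part and $v$ the finite variation part. *)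

(* Defs.v *)
(* Time is [0, +oo): a process is a family X : R -> T -> R
   of which only the values at times t >= 0 matter.  All path properties are
   required almost surely. *)
From HB Require Import structures.
From mathcomp Require Import all_boot all_order all_algebra.
From mathcomp Require Import all_classical all_reals all_analysis.
Import Order.TTheory GRing.Theory Num.Theory.
Import numFieldNormedType.Exports.

Set Implicit Arguments.
Unset Strict Implicit.
Unset Printing Implicit Defensive.

Local Open Scope classical_set_scope.
Local Open Scope ring_scope.

Section Processes.
Context {R : realType} {d : measure_display} {T : measurableType d}.
Variables (P : probability T R) (F : R -> set (set T)).
Implicit Types (X Y D m v : R -> T -> R) (tau : T -> \bar R).

(* The measurable sets of T play the role of F_oo.  Completeness is with
   respect to all subsets of P-null sets of F_oo, and it is enough to ask for it
   at time 0. *)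
Record usual_filtration : Prop := UsualFiltration {
  filtration_sigma : forall t : R, 0 <= t -> sigma_algebra [set: T] (F t) ;
  filtration_sub : forall t : R, 0 <= t -> F t `<=` measurable ;
  filtration_mono : forall s t : R, 0 <= s -> s <= t -> F s `<=` F t ;
  filtration_rcont : forall t : R, 0 <= t ->
    F t = \bigcap_(s in [set s | t < s]) F s ;
  filtration_complete : forall N, P.-negligible N -> F 0 N ;
  filtration_gen :
    (measurable : set (set T)) = <<s \bigcup_(t in [set t | 0 <= t]) F t >> }.

Definition measurable_wrt (G : set (set T)) (f : T -> R) : Prop :=
  forall B : set R, measurable B -> G (f @^-1` B).

Definition adapted X : Prop := forall t : R, 0 <= t -> measurable_wrt (F t) (X t).

(* g is a version of E[f | G] *)
Definition is_cond_exp (G : set (set T)) (f g : T -> R) : Prop :=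
  [/\ measurable_wrt G g, P.-integrable [set: T] (EFin \o g) &
      forall A, G A ->
        (\int[P]_(w in A) (g w)%:E = \int[P]_(w in A) (f w)%:E)%E].

Definition martingale X : Prop :=
  [/\ adapted X,
      forall t : R, 0 <= t -> P.-integrable [set: T] (EFin \o X t) &
      forall s t : R, 0 <= s -> s <= t -> is_cond_exp (F s) (X t) (X s)].

Definition continuous_process X : Prop :=
  {ae P, forall w, {within [set t | 0 <= t], continuous (X ^~ w)}}.

Definition cadlag_process X : Prop :=
  {ae P, forall w,
    (forall t : R, 0 <= t -> X s w @[s --> t^'+] --> X t w) /\
    (forall t : R, 0 < t -> cvg (X s w @[s --> t^'-]))}.

Definition stopping_time tau : Prop :=
  (forall w, (0 <= tau w)%E) /\
  (forall t : R, 0 <= t -> F t [set w | (tau w <= t%:E)%E]).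

(* X^tau 1_{tau > 0}; the indicator is there so that no integrability of X_0 is
   imposed in the definition of a local martingale. *)
Definition stopped X tau : R -> T -> R := fun t w =>
  if (0 < tau w)%E then X (fine (Order.min t%:E (tau w))) w else 0.

Definition local_martingale X : Prop :=
  [/\ adapted X, cadlag_process X &
      exists tau : nat -> T -> \bar R,
        [/\ forall n, stopping_time (tau n),
            {ae P, forall w, nondecreasing_seq (tau ^~ w) /\
                             tau n w @[n --> \oo] --> +oo%E} &
            forall n, martingale (stopped X (tau n))]].

Definition finite_variation_process X : Prop :=
  [/\ adapted X, cadlag_process X &
      {ae P, forall w, forall t : R, 0 <= t -> bounded_variation 0 t (X ^~ w)}].

Definition decomposes X m v : Prop :=
  [/\ local_martingale m, finite_variation_process v &
      {ae P, forall w, forall t : R, 0 <= t -> X t w = m t w + v t w}].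

Definition semimartingale X : Prop :=
  [/\ adapted X, cadlag_process X & exists m v, decomposes X m v].

(* X is a continuous semimartingale with canonical decomposition X = m + v:
   both parts are continuous. *)
Definition continuous_semimartingale X m v : Prop :=
  [/\ adapted X, continuous_process X, decomposes X m v,
      continuous_process m & continuous_process v].

Definition density_process (Q : set T -> \bar R) D : Prop :=
  [/\ adapted D,
      forall t : R, 0 <= t -> P.-integrable [set: T] (EFin \o D t) &
      forall (t : R) A, 0 <= t -> F t A -> (Q A = \int[P]_(w in A) (D t w)%:E)%E].

(* (Q, P)-local martingales; Q enters only through its density process D. *)
Definition QP_local_martingale D X : Prop :=
  [/\ adapted X, semimartingale X &
      local_martingale (fun t w => X t w * D t w)].

Definition zero_set X (w : T) : set R := [set t | 0 <= t /\ X t w = 0].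

End Processes.

(* Main.v *)
(* Changing the sign.  Fix eps > 0 and follow M D while M is in an excursion that
   has reached eps (until M comes back to 0), and eps D the rest of the time.
   M D and eps D agree where M = eps, and both vanish where M = 0 since D does, so
   this strategy is, up to errors that vanish along refining grids, a martingale
   transform of M D (or |M| D, which agrees with M D where M > 0) and D; and it
   stays within eps |D| of M^+ D.  Letting eps go to 0, M^+ D and, by symmetry,
   M^- D are local martingales as soon as one of M D and |M| D is; these two are
   the difference and the sum of M^+ D and M^- D.

   |M| is a semimartingale.  This replaces Tanaka's formula: after localization
   the sums of sg(M_(t_i)) (m_(t_(i+1)) - m_(t_i)) are martingales X, bounded in
   L^2, such that |M| - X + Var(v) increases along the grid, because
   |M_(t_(i+1))| - |M_(t_i)| >= sg(M_(t_i)) (M_(t_(i+1)) - M_(t_i)).  For each grid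
   these martingales form a convex set, and the sets shrink along refinements, so
   elements of nearly minimal norm are Cauchy in L^2; by the maximal inequality and
   Borel-Cantelli a subsequence converges locally uniformly to a local martingale
   m', and |M| - m' + Var(v) is nondecreasing. *)
Require Import Defs.
From HB Require Import structures.
From mathcomp Require Import all_boot all_order all_algebra.
From mathcomp Require Import all_classical all_reals all_analysis.
From mathcomp Require Import measurable_realfun ring lra.
Import Order.TTheory GRing.Theory Num.Theory.
Import numFieldNormedType.Exports.

Local Open Scope classical_set_scope.
Local Open Scope ring_scope.

Set Implicit Arguments.
Unset Strict Implicit.
Unset Printing Implicit Defensive.

(** * Expectations and measurability *)

(** With the sign of M itself as integrand, the number of switches along a grid would have no bound,
    since M may cross 0 infinitely often. The gap between the levels 0 and eps forces M to travel
    eps between two switches, so uniform continuity of the path bounds their number, while the cost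
    of one switch tends to 0 with the mesh. This convergence is only pathwise; it becomes
    convergence in L^1 because orthogonality of martingale increments bounds the errors in L^2
    uniformly in the grid. Localization makes D and M D (or |M| D) bounded, but not M, which may be
    large where D is small. Optional stopping is therefore wanted only for continuous martingales
    whose stopped version is bounded, and it too is obtained from finite sums along grids. In the
    construction for |M|, the L^2 precision at stage j is 4^-j: half of the exponent pays for the
    level 2^-j in the maximal inequality, the other half for the summable probability 2^-j. *)

Section Expectation.
Context {R : realType} {d : measure_display} {T : measurableType d}.
Variable P : probability T R.
Implicit Types (f g h : T -> R) (A B : set T).
Local Notation E := (Rintegral P [set: T]).
Local Notation L1 f := (P.-integrable [set: T] (EFin \o f)).

Lemma L1_measurable f : L1 f -> measurable_fun [set: T] f.
Proof. by move=> /integrableP[/measurable_EFinP]. Qed.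

Lemma L1_le f g : measurable_fun [set: T] f -> L1 g ->
  (forall w, `|f w| <= g w) -> L1 f.
Proof.
move=> mf ig fg; apply: (le_integrable _ _ _ ig) => //.
  exact/measurable_EFinP.
by move=> w _ /=; rewrite lee_fin (le_trans (fg w)) // ler_norm.
Qed.

Lemma L1_cst (c : R) : L1 (fun=> c).
Proof. exact: finite_measure_integrable_cst. Qed.

Lemma L1_bounded f c : measurable_fun [set: T] f -> (forall w, `|f w| <= c) -> L1 f.
Proof. by move=> mf fc; apply: (L1_le mf (L1_cst c)). Qed.

Lemma L1D f g : L1 f -> L1 g -> L1 (fun w => f w + g w).
Proof. by move=> If Ig; apply: (integrableD _ If Ig). Qed.

Lemma L1N f : L1 f -> L1 (fun w => - f w).
Proof. by move=> If; apply: (integrableN If). Qed.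

Lemma L1B f g : L1 f -> L1 g -> L1 (fun w => f w - g w).
Proof. by move=> If Ig; apply: L1D => //; exact: L1N. Qed.

Lemma L1Z c f : L1 f -> L1 (fun w => c * f w).
Proof. by move=> If; apply: (integrableZl _ _ If). Qed.

Lemma L1_norm f : L1 f -> L1 (fun w => `|f w|).
Proof. by move=> If; apply: (integrable_norm If). Qed.

Lemma L1_sum n (f : nat -> T -> R) : (forall i, (i < n)%N -> L1 (f i)) ->
  L1 (fun w => \sum_(i < n) f i w).
Proof.
elim: n => [|n IH] If.
  by under eq_fun do rewrite big_ord0; exact: L1_cst.
under eq_fun do rewrite big_ord_recr /=.
by apply: L1D; [apply: IH => i /ltnW|]; exact: If.
Qed.

Lemma L1_mul_bounded f g c : L1 f -> measurable_fun [set: T] g ->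
  (forall w, `|g w| <= c) -> L1 (fun w => g w * f w).
Proof.
move=> If mg gc; apply: (@L1_le _ (fun w => c * `|f w|)).
- by apply: measurable_funM => //; exact: L1_measurable.
- exact/L1Z/L1_norm.
- by move=> w; rewrite normrM ler_wpM2r.
Qed.

Lemma L1_indic A f : measurable A -> L1 f -> L1 (fun w => \1_A w * f w).
Proof.
move=> mA If; apply: (@L1_mul_bounded _ _ 1) => //.
by move=> w; rewrite indicE; case: (w \in A); rewrite ?normr1 ?normr0.
Qed.

Lemma E_ext f g : (forall w, f w = g w) -> E f = E g.
Proof. by move=> fg; apply: eq_Rintegral => w _. Qed.

Lemma E_D f g : L1 f -> L1 g -> E (fun w => f w + g w) = E f + E g.
Proof. exact: RintegralD. Qed.

Lemma E_B f g : L1 f -> L1 g -> E (fun w => f w - g w) = E f - E g.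
Proof. exact: RintegralB. Qed.

Lemma E_Z c f : L1 f -> E (fun w => c * f w) = c * E f.
Proof. exact: RintegralZl. Qed.

Lemma E_cst c : E (fun=> c) = c.
Proof.
rewrite Rintegral_cst //.
by rewrite [X in fine X](@probability_setT _ _ _ P) mulr1.
Qed.

Lemma E_sum n (f : nat -> T -> R) : (forall i, (i < n)%N -> L1 (f i)) ->
  E (fun w => \sum_(i < n) f i w) = \sum_(i < n) E (f i).
Proof.
elim: n => [|n IH] If.
  by rewrite big_ord0 -[RHS](E_cst 0); apply: E_ext => w; rewrite big_ord0.
rewrite big_ord_recr -IH /=; last by move=> i /ltnW; exact: If.
rewrite -E_D; [|by apply: L1_sum => i /ltnW; exact: If|exact: If].
by apply: E_ext => w; rewrite big_ord_recr.
Qed.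

Lemma E_le f g : L1 f -> L1 g -> (forall w, f w <= g w) -> E f <= E g.
Proof. by move=> If Ig fg; apply: le_Rintegral. Qed.

Lemma E_ge0 f : (forall w, 0 <= f w) -> 0 <= E f.
Proof. by move=> f0; apply: Rintegral_ge0. Qed.

Lemma E_abs f : L1 f -> `|E f| <= E (fun w => `|f w|).
Proof. exact: le_normr_Rintegral. Qed.

Lemma EFin_E f : L1 f -> (E f)%:E = (\int[P]_w (f w)%:E)%E.
Proof. by move=> If; rewrite fineK //; exact: integrable_fin_num. Qed.

Lemma E_ae_eq f g : L1 f -> measurable_fun [set: T] g ->
  {ae P, forall w, f w = g w} -> L1 g /\ E f = E g.
Proof.
move=> If mg fg; have mf := L1_measurable If.
have fg' : ae_eq P [set: T] (EFin \o f) (EFin \o g).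
  by apply: filterS fg => w fgw _ /=; rewrite fgw.
split; last by congr fine; apply: ae_eq_integral => //; exact/measurable_EFinP.
apply/integrableP; split; first exact/measurable_EFinP.
have /integrableP[_] := If; congr (_ < _)%E.
apply: ae_eq_integral => //.
- by apply: measurableT_comp => //; exact/measurable_EFinP.
- by apply: measurableT_comp => //; exact/measurable_EFinP.
- by apply: filterS fg => w fgw _ /=; rewrite fgw.
Qed.

Lemma E_indic A f : measurable A ->
  (\int[P]_(w in A) (f w)%:E = \int[P]_w (\1_A w * f w)%:E)%E.
Proof.
move=> mA; rewrite integral_mkcond; apply: eq_integral => w _.
by rewrite patchE indicE; case: (w \in A); rewrite ?mul1r ?mul0r.
Qed.

Lemma E_dct (f_ : nat -> T -> R) f g :
  (forall n, measurable_fun [set: T] (f_ n)) -> measurable_fun [set: T] f -> L1 g ->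
  (forall n w, `|f_ n w| <= g w) ->
  {ae P, forall w, f_ n w @[n --> \oo] --> f w} ->
  L1 f /\ E (f_ n) @[n --> \oo] --> E f.
Proof.
move=> mf_ mf Ig fg cf.
have [] := @dominated_convergence _ _ _ P _ measurableT (fun n => EFin \o f_ n)
  (EFin \o f) (EFin \o g).
- by move=> n; exact/measurable_EFinP.
- exact/measurable_EFinP.
- by apply: filterS cf => w h _; apply: cvg_EFin => //; exact: nearW.
- by [].
- by apply: aeW => w n _ /=; rewrite lee_fin.
move=> If _ h; split=> //.
apply: fine_cvg; rewrite /Rintegral fineK; last exact: integrable_fin_num.
exact: h.
Qed.

End Expectation.

(** * Measurability with respect to a sub-sigma-algebra *)

Section MeasurableWrt.
Context {R : realType} {d : measure_display} {T : measurableType d}.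
Variable G : set (set T).
Hypothesis sG : sigma_algebra [set: T] G.
Implicit Types (f g h : T -> R) (A B : set T).
Local Notation TG := (g_sigma_algebraType G).

Lemma sigmaE : (measurable : set (set TG)) = G.
Proof. exact: sigma_algebra_id. Qed.

(** Transfer to [TG], the set [T] with [G] as its measurable sets: closure properties of measurable
    functions for [G] are then instances of the general ones. *)
Lemma measurable_wrtE f : measurable_wrt G f <-> measurable_fun [set: TG] (f : TG -> R).
Proof.
rewrite /measurable_fun sigmaE; split=> mf; first by move=> _ B mB; rewrite setTI; exact: mf.
by move=> B mB; rewrite -[_ @^-1` _]setTI; apply: mf => //; rewrite -sigmaE.
Qed.

Lemma wrt_cst (c : R) : measurable_wrt G (fun=> c).
Proof. by apply/measurable_wrtE. Qed.

Lemma wrtD f g : measurable_wrt G f -> measurable_wrt G g ->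
  measurable_wrt G (fun w => f w + g w).
Proof. by rewrite !measurable_wrtE => mf mg; exact: measurable_funD. Qed.

Lemma wrtM f g : measurable_wrt G f -> measurable_wrt G g ->
  measurable_wrt G (fun w => f w * g w).
Proof. by rewrite !measurable_wrtE => mf mg; exact: measurable_funM. Qed.

Lemma wrtN f : measurable_wrt G f -> measurable_wrt G (fun w => - f w).
Proof. by rewrite !measurable_wrtE => mf; exact: measurable_funN. Qed.

Lemma wrtB f g : measurable_wrt G f -> measurable_wrt G g ->
  measurable_wrt G (fun w => f w - g w).
Proof. by move=> mf mg; apply: wrtD => //; exact: wrtN. Qed.

Lemma wrt_norm f : measurable_wrt G f -> measurable_wrt G (fun w => `|f w|).
Proof. by rewrite !measurable_wrtE => mf; apply: measurableT_comp. Qed.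

Lemma wrt_max f g : measurable_wrt G f -> measurable_wrt G g ->
  measurable_wrt G (fun w => Num.max (f w) (g w)).
Proof. by rewrite !measurable_wrtE => mf mg; exact: measurable_maxr. Qed.

Lemma wrt_sum n (f : nat -> T -> R) :
  (forall i, (i < n)%N -> measurable_wrt G (f i)) ->
  measurable_wrt G (fun w => \sum_(i < n) f i w).
Proof.
elim: n => [|n IH] mf; first by under eq_fun do rewrite big_ord0; exact: wrt_cst.
under eq_fun do rewrite big_ord_recr /=.
by apply: wrtD; [apply: IH => i /ltnW|]; exact: mf.
Qed.

Lemma wrt_cvg (f_ : nat -> T -> R) f : (forall n, measurable_wrt G (f_ n)) ->
  (forall w, f_ n w @[n --> \oo] --> f w) -> measurable_wrt G f.
Proof.
move=> mf cf; apply/measurable_wrtE.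
by apply: (@measurable_fun_cvg _ TG _ _ f_) => [n|w _]; [apply/measurable_wrtE|exact: cf].
Qed.

Lemma wrt_indic A : G A -> measurable_wrt G (\1_A : T -> R).
Proof.
move=> GA; apply/measurable_wrtE.
by apply: (@measurable_indic _ TG R setT A); rewrite sigmaE.
Qed.

Lemma wrtT : G [set: T].
Proof. by rewrite -sigmaE; exact: (@measurableT _ TG). Qed.

Lemma wrt0 : G set0.
Proof. by case: sG. Qed.

Lemma wrtC A : G A -> G (~` A).
Proof. by rewrite -sigmaE => mA; exact: (@measurableC _ TG). Qed.

Lemma wrtI A B : G A -> G B -> G (A `&` B).
Proof. by rewrite -sigmaE => mA mB; exact: (@measurableI _ TG). Qed.

Lemma wrtU A B : G A -> G B -> G (A `|` B).
Proof. by rewrite -sigmaE => mA mB; exact: (@measurableU _ TG). Qed.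

Lemma wrt_bigcup (A : nat -> set T) : (forall n, G (A n)) -> G (\bigcup_n A n).
Proof. by rewrite -sigmaE => mA; exact: (@bigcup_measurable _ TG). Qed.

Lemma wrt_bigcap (A : nat -> set T) : (forall n, G (A n)) -> G (\bigcap_n A n).
Proof. by rewrite -sigmaE => mA; exact: (@bigcap_measurable _ TG). Qed.

Lemma wrt_lt f g : measurable_wrt G f -> measurable_wrt G g ->
  G [set w | f w < g w].
Proof.
rewrite !measurable_wrtE => mf mg.
have := measurable_fun_ltr mf mg (measurableT) (Y := [set true]) I.
by rewrite setTI sigmaE => h; exact: h.
Qed.

Lemma wrt_le f g : measurable_wrt G f -> measurable_wrt G g ->
  G [set w | f w <= g w].
Proof.
rewrite !measurable_wrtE => mf mg.
have := measurable_fun_ler mf mg (measurableT) (Y := [set true]) I.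
by rewrite setTI sigmaE => h; exact: h.
Qed.

Lemma wrt_sub f : (G `<=` measurable) -> measurable_wrt G f -> measurable_fun [set: T] f.
Proof. by move=> GM mf _ B mB; rewrite setTI; exact/GM/mf. Qed.

Lemma wrt_if A f g : G A -> measurable_wrt G f -> measurable_wrt G g ->
  measurable_wrt G (fun w => if w \in A then f w else g w).
Proof.
move=> GA mf mg.
suff -> : (fun w => if w \in A then f w else g w) =
   (fun w => \1_A w * f w + \1_(~` A) w * g w).
  by apply: wrtD; apply: wrtM => //; apply: wrt_indic => //; exact: wrtC.
apply/funext => w; rewrite !indicE in_setC.
by case: (w \in A); rewrite /= ?mul1r ?mul0r ?addr0 ?add0r.
Qed.

End MeasurableWrt.
(** * Discrete martingale tools *)

(** The sum is [dl] times the number of thresholds dl, 2 dl, ..., n dl that are at most [y], that is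
    [y] rounded down to a multiple of [dl] and capped at n dl. The first clause drives the induction
    for the second. *)
Lemma staircase_approx {R : realType} (y dl : R) n : 0 <= y -> 0 < dl ->
  (n%:R * dl <= y -> \sum_(k < n) dl * (k.+1%:R * dl <= y)%R%:R = n%:R * dl) /\
  (y < n%:R * dl -> `|y - \sum_(k < n) dl * (k.+1%:R * dl <= y)%R%:R| <= dl).
Proof.
move=> y0 dl0; elim: n => [|n [IH1 IH2]].
  by rewrite big_ord0 mul0r; split=> //; rewrite ltNge y0.
rewrite !big_ord_recr /= -natr1 mulrDl mul1r; split=> [ge_y|lt_y].
  by rewrite ge_y mulr1 IH1 //; lra.
have -> : (n%:R * dl + dl <= y) = false by apply/negbTE; rewrite -ltNge.
rewrite mulr0 addr0; case: (lerP (n%:R * dl) y) => h; last exact: IH2.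
by rewrite IH1 // ger0_norm; lra.
Qed.

Section Martingale.
Context {R : realType} {d : measure_display} {T : measurableType d}.
Variables (P : probability T R) (F : R -> set (set T)).
Hypothesis FP : usual_filtration P F.
Implicit Types (s t u c lm : R) (f g h : T -> R) (A B : set T) (X Y : R -> T -> R).
Local Notation E := (Rintegral P [set: T]).
Local Notation L1 f := (P.-integrable [set: T] (EFin \o f)).

Lemma filt_measurable t A : 0 <= t -> F t A -> measurable A.
Proof. by move=> t0; exact: (filtration_sub FP t0). Qed.

Lemma wrt_measurable t f : 0 <= t -> measurable_wrt (F t) f -> measurable_fun [set: T] f.
Proof. by move=> t0; apply: wrt_sub; exact: (filtration_sub FP t0). Qed.

Lemma wrt_mono s t f : 0 <= s -> s <= t -> measurable_wrt (F s) f -> measurable_wrt (F t) f.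
Proof. by move=> s0 st mf B mB; apply: (filtration_mono FP s0 st); exact: mf. Qed.

(** Passes from extended integrals over [A] to real expectations with an indicator weight, the form
    that combines with linearity of [E]. *)
Lemma martingaleP X : martingale P F X <->
  [/\ adapted F X, forall t, 0 <= t -> L1 (X t) &
    forall s t A, 0 <= s -> s <= t -> F s A ->
      E (fun w => \1_A w * X t w) = E (fun w => \1_A w * X s w)].
Proof.
split=> [[aX IX mX]|[aX IX mX]]; split=> // s t.
  move=> A s0 st FA; have [_ _ /(_ A FA)] := mX _ _ s0 st.
  have mA := filt_measurable s0 FA.
  by rewrite (E_indic _ (X s) mA) (E_indic _ (X t) mA) => /(congr1 fine).
move=> s0 st; split=> [||A FA]; [exact: aX|exact: IX|].
have mA := filt_measurable s0 FA.
rewrite (E_indic _ (X s) mA) (E_indic _ (X t) mA).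
have I1 r : 0 <= r -> L1 (fun w => \1_A w * X r w) by move=> r0; exact/L1_indic/IX.
by rewrite -(EFin_E (I1 s s0)) -(EFin_E (I1 t (le_trans s0 st))) (mX s t).
Qed.

(** The martingale property is the case of indicators. A nonnegative bounded weight is a uniform
    limit of combinations of indicators of its level sets, which lie in [F s]; a general one is a
    difference of two nonnegative ones. *)
Lemma mart_weight X s t h c : martingale P F X -> 0 <= s -> s <= t ->
  measurable_wrt (F s) h -> (forall w, `|h w| <= c) ->
  E (fun w => h w * X t w) = E (fun w => h w * X s w).
Proof.
move=> /martingaleP[aX IX mX] s0 st mh hc.
have t0 := le_trans s0 st; have sF := filtration_sigma FP s0.
pose f w := X t w - X s w.
have If : L1 f by apply: L1B; apply: IX.
have f0 A : F s A -> E (fun w => \1_A w * f w) = 0.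
  move=> FA; have mA := filt_measurable s0 FA.
  transitivity (E (fun w => \1_A w * X t w) - E (fun w => \1_A w * X s w)).
    have I1 r : 0 <= r -> L1 (fun w => \1_A w * X r w) by move=> r0; exact/L1_indic/IX.
    by rewrite -(E_B (I1 t t0) (I1 s s0)); apply: E_ext => w; rewrite mulrBr.
  by rewrite (mX s t) // subrr.
have pos g b : measurable_wrt (F s) g -> (forall w, 0 <= g w <= b) ->
    E (fun w => g w * f w) = 0.
  move=> mg gb; have mgT := wrt_measurable s0 mg.
  have Igf : L1 (fun w => g w * f w).
    apply: (L1_mul_bounded If mgT (c := b)) => w.
    by have /andP[? ?] := gb w; rewrite ger0_norm.
  suff small dl : 0 < dl -> `|E (fun w => g w * f w)| <= dl * E (fun w => `|f w|).
    apply/eqP; rewrite -normr_le0; apply/ler_addgt0Pr => e e0; rewrite add0r.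
    have Ef0 : 0 <= E (fun w => `|f w|) by apply: E_ge0.
    have k0 : 0 < E (fun w => `|f w|) + 1 by lra.
    apply: (le_trans (small (e / (E (fun w => `|f w|) + 1)) _)); first by rewrite divr_gt0.
    by rewrite mulrAC ler_pdivrMr // ler_pM2l //; lra.
  (* Enough thresholds of width [dl] to exceed the bound [b] of [g]. *)
  move=> dl0; pose n := (Num.truncn (b / dl)).+1.
  have bn : b < n%:R * dl by rewrite -ltr_pdivrMr // truncnS_gt.
  pose A k := [set w | k.+1%:R * dl <= g w].
  have FA k : F s (A k) by apply: wrt_le => //; exact: wrt_cst.
  have mA k := filt_measurable s0 (FA k).
  pose gn w := \sum_(k < n) dl * (\1_(A k) w : R).
  have mgn : measurable_wrt (F s) gn.
    apply: (@wrt_sum _ _ _ _ sF n (fun k w => dl * \1_(A k) w)) => k _.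
    by apply: wrtM => //; [exact: wrt_cst|exact: wrt_indic].
  have gnE w : `|g w - gn w| <= dl.
    have /andP[g0 gbw] := gb w.
    have [_ /(_ (le_lt_trans gbw bn))] := staircase_approx n g0 dl0.
    suff -> : gn w = \sum_(k < n) dl * (k.+1%:R * dl <= g w)%R%:R by [].
    by apply: eq_bigr => k _; rewrite indicE mem_setE.
  have Ign k : L1 (fun w => dl * (\1_(A k) w * f w)) by apply/L1Z/L1_indic.
  have gnf : E (fun w => gn w * f w) = 0.
    transitivity (E (fun w => \sum_(k < n) dl * (\1_(A k) w * f w))).
      by apply: E_ext => w; rewrite mulr_suml; apply: eq_bigr => k _; rewrite mulrA.
    rewrite (@E_sum _ _ _ _ n (fun k w => dl * (\1_(A k) w * f w))) //.
    by apply: big1 => k _; rewrite E_Z ?f0 ?mulr0 //; exact: L1_indic.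
  have Ignf : L1 (fun w => gn w * f w).
    have h1 := @L1_sum _ _ _ P n (fun k w => dl * (\1_(A k) w * f w)) (fun k _ => Ign k).
    apply: (L1_le _ (L1_norm h1)).
      by apply: measurable_funM; [exact: (wrt_measurable s0)|exact: L1_measurable If].
    move=> w /=; rewrite mulr_suml le_eqVlt; apply/orP; left; apply/eqP; congr (`| _ |).
    by apply: eq_bigr => k _; rewrite mulrA.
  rewrite -[E _]subr0 -gnf -E_B // -E_Z; last exact: L1_norm.
  apply: (le_trans (E_abs (L1B Igf Ignf))); apply: E_le.
  - exact/L1_norm/L1B.
  - exact/L1Z/L1_norm.
  - by move=> w; rewrite -mulrBl normrM ler_wpM2r.
have mhT := wrt_measurable s0 mh.
have Ih r : 0 <= r -> L1 (fun w => h w * X r w).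
  by move=> r0; apply: (L1_mul_bounded (IX _ r0) mhT hc).
have Ihf : L1 (fun w => h w * f w) by apply: (L1_mul_bounded If mhT hc).
(* Adding [c] makes the weight nonnegative and bounded by c + c; the constant is removed again
   through [h2]. *)
have h1 : E (fun w => (h w + c) * f w) = 0.
  apply: (pos _ (c + c)); first by apply: wrtD => //; exact: wrt_cst.
  by move=> w; have := hc w; rewrite ler_norml => /andP[]; lra.
have h2 : E f = 0.
  rewrite -(f0 _ (wrtT sF)); apply: E_ext => w; by rewrite indicT mul1r.
apply/eqP; rewrite -subr_eq0 -E_B ?Ih //; apply/eqP.
transitivity (E (fun w => (h w + c) * f w) - c * E f); last by rewrite h1 h2 mulr0 subr0.
rewrite -E_Z // -E_B //; last exact: L1Z.
  by apply: E_ext => w; rewrite /f; ring.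
apply: (L1_le (g := fun w => `|h w * f w| + `|c * f w|)).
- apply: measurable_funM; last exact: L1_measurable If.
  by apply: measurable_funD.
- by apply: L1D; apply: L1_norm => //; exact: L1Z.
- by move=> w; rewrite mulrDl ler_normD.
Qed.

End Martingale.

Lemma ler_or_gtr {R : realType} (x y : R) : (x <= y) \/ (y < x).
Proof. by case: (leP x y); [left|right]. Qed.

Lemma indicb {R : realType} {T : Type} (b : T -> bool) (w : T) :
  \1_[set x | b x] w = (b w)%:R :> R.
Proof. by rewrite indicE mem_setE. Qed.

Lemma wrt_sg {R : realType} {d : measure_display} {T : measurableType d}
    (G : set (set T)) (f : T -> R) : sigma_algebra [set: T] G ->
  measurable_wrt G f -> measurable_wrt G (fun w => Num.sg (f w)).
Proof.
move=> sG mf.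
have -> : (fun w => Num.sg (f w)) =
    (fun w => \1_[set w | 0 < f w] w - \1_[set w | f w < 0] w).
  apply/funext => w; rewrite !indicb.
  by case: sgrP => h; rewrite /= ?subr0 ?sub0r ?subrr.
by apply: wrtB => //; apply: wrt_indic => //; apply: wrt_lt => //; exact: wrt_cst.
Qed.

Lemma norm_sg_le1 {R : realType} (x : R) : `|Num.sg x| <= 1.
Proof. by rewrite normr_sg; case: (x != 0). Qed.

Lemma norm_indic_le1 {R : realType} {T : Type} (A : set T) (w : T) : `|\1_A w : R| <= 1.
Proof. by rewrite indicE; case: (w \in A); rewrite ?normr1 ?normr0. Qed.

Section MartingaleTransforms.
Context {R : realType} {d : measure_display} {T : measurableType d}.
Variables (P : probability T R) (F : R -> set (set T)).
Hypothesis FP : usual_filtration P F.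
Implicit Types (s t u c lm : R) (f g h : T -> R) (A B : set T) (X Y : R -> T -> R).
Local Notation E := (Rintegral P [set: T]).
Local Notation L1 f := (P.-integrable [set: T] (EFin \o f)).

Lemma martD X Y : martingale P F X -> martingale P F Y ->
  martingale P F (fun t w => X t w + Y t w).
Proof.
move=> /(martingaleP FP)[aX IX mX] /(martingaleP FP)[aY IY mY].
apply/(martingaleP FP); split=> [t t0|t t0|s t A s0 st FA].
- by apply: (wrtD (filtration_sigma FP t0)); [exact: aX|exact: aY].
- by apply: L1D; [exact: IX|exact: IY].
- have mA := filt_measurable FP s0 FA; have t0 := le_trans s0 st.
  have split_E r : 0 <= r -> E (fun w => \1_A w * (X r w + Y r w)) =
      E (fun w => \1_A w * X r w) + E (fun w => \1_A w * Y r w).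
    move=> r0; rewrite -E_D; [|exact/L1_indic/IX|exact/L1_indic/IY] => //.
    by apply: E_ext => w; rewrite mulrDr.
  by rewrite !split_E // (mX s) // (mY s).
Qed.

Lemma martZ c X : martingale P F X -> martingale P F (fun t w => c * X t w).
Proof.
move=> /(martingaleP FP)[aX IX mX].
apply/(martingaleP FP); split=> [t t0|t t0|s t A s0 st FA].
- apply: (wrtM (filtration_sigma FP t0)); last exact: aX.
  exact: (wrt_cst (filtration_sigma FP t0)).
- by apply: L1Z; exact: IX.
- have mA := filt_measurable FP s0 FA; have t0 := le_trans s0 st.
  have split_E r : 0 <= r -> E (fun w => \1_A w * (c * X r w)) =
      c * E (fun w => \1_A w * X r w).
    move=> r0; rewrite -E_Z; last exact/L1_indic/IX.
    by apply: E_ext => w; rewrite mulrCA.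
  by rewrite !split_E // (mX s).
Qed.

Lemma mart_cst0 : martingale P F (fun _ _ => 0).
Proof.
apply/(martingaleP FP); split=> [t t0|t t0|//].
- exact: (wrt_cst (filtration_sigma FP t0)).
- exact: L1_cst.
Qed.

Lemma mart_sum n (X : nat -> R -> T -> R) :
  (forall i, (i < n)%N -> martingale P F (X i)) ->
  martingale P F (fun t w => \sum_(i < n) X i t w).
Proof.
elim: n => [|n IH] mX.
  by under eq_fun do under eq_fun do rewrite big_ord0; exact: mart_cst0.
under eq_fun do under eq_fun do rewrite big_ord_recr /=.
by apply: martD; [apply: IH => i /ltnW|]; exact: mX.
Qed.

(** Since |X_s| = sg(X_s) X_s and the sign of X_s is an [F s]-measurable weight, X_s may be replaced
    by X_t under the expectation, and sg(X_s) X_t is at most |X_t|. *)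
Lemma mart_contract X s t A : martingale P F X -> 0 <= s -> s <= t -> F s A ->
  E (fun w => \1_A w * `|X s w|) <= E (fun w => \1_A w * `|X t w|).
Proof.
move=> mX s0 st FA; have t0 := le_trans s0 st.
have /(martingaleP FP)[aX IX _] := mX; have mA := filt_measurable FP s0 FA.
have sF := filtration_sigma FP s0.
pose h w : R := \1_A w * Num.sg (X s w).
have h1 w : `|h w| <= 1.
  by rewrite /h normrM mulr_ile1 // ?norm_indic_le1 ?norm_sg_le1.
have mh : measurable_wrt (F s) h.
  by apply: wrtM => //; [exact: wrt_indic|apply: wrt_sg => //; exact: aX].
have -> : E (fun w => \1_A w * `|X s w|) = E (fun w => h w * X s w).
  by apply: E_ext => w; rewrite /h -mulrA -normrEsg.
rewrite -(mart_weight FP mX s0 st mh h1); apply: E_le.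
- exact: (L1_mul_bounded (IX _ t0) (wrt_measurable FP s0 mh) h1).
- by apply: L1_indic => //; apply: L1_norm; exact: IX.
- move=> w; rewrite /h -mulrA ler_wpM2l //.
  by rewrite (le_trans (ler_norm _)) // normrM ler_piMl // norm_sg_le1.
Qed.

(** Doob's maximal inequality. The union is split according to the first index at which the level is
    reached ([BS]); on each piece, which belongs to the filtration at that index, the elementary
    bound [base] is carried to time [u] by [mart_contract]. *)
Lemma mart_maximal X (t : nat -> R) n u lm : martingale P F X ->
  {homo t : i j / (i <= j)%N >-> i <= j} -> 0 <= t 0%N -> t n <= u -> 0 <= lm ->
  lm * E (\1_(\bigcup_(i < n.+1) [set w | lm <= `|X (t i) w|])) <=
  E (fun w => \1_(\bigcup_(i < n.+1) [set w | lm <= `|X (t i) w|]) w * `|X u w|).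
Proof.
move=> mX tmono t0 tnu lm0; have /(martingaleP FP)[aX IX _] := mX.
have tge0 i : 0 <= t i by apply: (le_trans t0); exact: tmono.
pose C i := [set w | lm <= `|X (t i) w|].
have FC i j : (i <= j)%N -> F (t j) (C i).
  move=> ij; have sF := filtration_sigma FP (tge0 j).
  apply: wrt_le => //; first exact: wrt_cst.
  apply: wrt_norm => //.
  by apply: (wrt_mono FP (tge0 i) (tmono _ _ ij)); exact: aX.
pose B n := \bigcup_(i < n.+1) C i.
have BS k : B k.+1 = B k `|` (C k.+1 `\` B k).
  rewrite eqEsubset; split=> [w [i /= ik Ci]|w [[i /= ik Ci]|[Ck _]]].
  - have [Bw|nBw] := pselect (B k w); [by left|right; split=> //].
    move: ik; rewrite ltnS leq_eqVlt => /predU1P[<- //|ik].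
    by exfalso; apply: nBw; exists i.
  - by exists i => //=; rewrite ltnS ltnW.
  - by exists k.+1 => //=.
have FB k : F (t k) (B k).
  elim: k => [|k IH].
    suff -> : B 0%N = C 0%N by exact: FC.
    rewrite eqEsubset; split=> [w [i /= ]|w C0]; last by exists 0%N.
    by rewrite ltnS leqn0 => /eqP ->.
  have FBk := filtration_mono FP (tge0 k) (tmono _ _ (leqnSn k)) IH.
  have sF := filtration_sigma FP (tge0 k.+1).
  rewrite BS; apply: wrtU => //; rewrite setDE; apply: wrtI => //; first exact: FC.
  exact: wrtC.
have mB k : measurable (B k) by exact: (filt_measurable FP (tge0 k)).
have IX' A r : measurable A -> 0 <= r -> L1 (fun w => \1_A w * `|X r w|).
  by move=> mA r0; apply: L1_indic => //; apply: L1_norm; exact: IX.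
have I1 A : measurable A -> L1 (\1_A : T -> R).
  by move=> mA; apply: (@L1_bounded _ _ _ P _ 1) => // w; exact: norm_indic_le1.
have base k A : F (t k) A -> A `<=` C k ->
    lm * E (\1_A) <= E (fun w => \1_A w * `|X (t k) w|).
  move=> FA AC; have mA := filt_measurable FP (tge0 k) FA.
  rewrite -E_Z ?I1 //; apply: E_le; [exact/L1Z/I1|exact: IX'|move=> w].
  rewrite indicE; case: (asboolP (A w)) => [/[dup] Aw /AC Cw|nAw].
    by rewrite mem_set // mulr1 mul1r.
  by rewrite memNset // mulr0 mul0r.
rewrite -/(B n); elim: n u tnu => [|n IH] u tnu.
  have B0 : B 0%N `<=` C 0%N by move=> w [i /=]; rewrite ltnS leqn0 => /eqP ->.
  apply: (le_trans (base 0%N _ (FB 0%N) B0)).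
  exact: mart_contract (FB 0%N).
have u0 : 0 <= u := le_trans (tge0 _) tnu.
have FBk := filtration_mono FP (tge0 n) (tmono _ _ (leqnSn n)) (FB n).
have FD : F (t n.+1) (C n.+1 `\` B n).
  have sF := filtration_sigma FP (tge0 n.+1).
  by rewrite setDE; apply: wrtI => //; [exact: FC|exact: wrtC].
have mD := filt_measurable FP (tge0 _) FD.
have indU w : \1_(B n.+1) w = \1_(B n) w + \1_(C n.+1 `\` B n) w :> R.
  rewrite BS !indicE; case: (asboolP (B n w)) => [Bw|nBw].
    have U : (B n `|` (C n.+1 `\` B n)) w by left.
    have N : ~ (C n.+1 `\` B n) w by case.
    by rewrite (mem_set Bw) (mem_set U) (memNset N) addr0.
  have [Dw|nDw] := pselect ((C n.+1 `\` B n) w).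
    have U : (B n `|` (C n.+1 `\` B n)) w by right.
    by rewrite (memNset nBw) (mem_set U) (mem_set Dw) add0r.
  have N : ~ (B n `|` (C n.+1 `\` B n)) w by case.
  by rewrite (memNset nBw) (memNset N) (memNset nDw) add0r.
rewrite (@E_ext _ _ _ P (\1_(B n.+1)) (fun w => \1_(B n) w + \1_(C n.+1 `\` B n) w)) //.
rewrite (E_D (I1 _ (mB n)) (I1 _ mD)) mulrDr.
have -> : E (fun w => \1_(B n.+1) w * `|X u w|) =
    E (fun w => \1_(B n) w * `|X u w|) + E (fun w => \1_(C n.+1 `\` B n) w * `|X u w|).
  by rewrite -E_D ?IX' //; apply: E_ext => w; rewrite indU mulrDl.
apply: lerD; first by apply: IH; apply: le_trans tnu; exact: tmono.
by apply: (le_trans (base _ _ FD _)); [move=> w []|exact: mart_contract].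
Qed.

Lemma mart_incr_weight X s t h c : martingale P F X -> 0 <= s -> s <= t ->
  measurable_wrt (F s) h -> (forall w, `|h w| <= c) ->
  L1 (fun w => h w * (X t w - X s w)) /\ E (fun w => h w * (X t w - X s w)) = 0.
Proof.
move=> mX s0 st mh hc; have t0 := le_trans s0 st.
have /(martingaleP FP)[aX IX _] := mX; have mhT := wrt_measurable FP s0 mh.
have Ih r : 0 <= r -> L1 (fun w => h w * X r w).
  by move=> r0; apply: (L1_mul_bounded (IX _ r0) mhT hc).
have eq1 w : h w * (X t w - X s w) = h w * X t w - h w * X s w by rewrite mulrBr.
rewrite (funext eq1); split; first by apply: L1B; exact: Ih.
by rewrite E_B ?Ih // (mart_weight FP mX s0 st mh hc) subrr.
Qed.

Lemma elementary_wrt X a b h t : adapted F X -> 0 <= a -> a <= b -> 0 <= t ->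
  measurable_wrt (F a) h ->
  measurable_wrt (F t) (fun w => h w * (X (Num.min t b) w - X (Num.min t a) w)).
Proof.
move=> aX a0 ab t0 mh; have b0 := le_trans a0 ab; have sF := filtration_sigma FP t0.
have [ta|ta] := ler_or_gtr t a.
  rewrite [X in measurable_wrt _ X](_ : _ = (fun=> 0)); first exact: wrt_cst.
  by apply/funext => w; rewrite (min_idPl ta) (min_idPl (le_trans ta ab)) subrr mulr0.
apply: (wrtM sF); first exact: (wrt_mono FP a0 (ltW ta)).
have min0 c : 0 <= c -> 0 <= Num.min t c by move=> c0; rewrite le_min t0.
have mt c : 0 <= c -> measurable_wrt (F t) (X (Num.min t c)).
  move=> c0; apply: (wrt_mono FP (min0 _ c0)); last by apply: aX; exact: min0.
  by rewrite ge_min lexx.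
by apply: (wrtB sF); exact: mt.
Qed.

(** This is the stochastic integral of [h] held on ]a, b]. If t <= a both values vanish; if s <= a <
    t the value at [s] vanishes and \1_A h is a weight known at [a]; if a < s that weight is known
    at [s]. *)
Lemma mart_elementary X a b h c : martingale P F X -> 0 <= a -> a <= b ->
  measurable_wrt (F a) h -> (forall w, `|h w| <= c) ->
  martingale P F (fun t w => h w * (X (Num.min t b) w - X (Num.min t a) w)).
Proof.
move=> mX a0 ab mh hc; have /(martingaleP FP)[aX IX _] := mX.
have b0 := le_trans a0 ab.
have minab t : 0 <= t -> 0 <= Num.min t a /\ 0 <= Num.min t b.
  by move=> t0; rewrite !le_min t0 a0 b0.
have zero t w : t <= a -> h w * (X (Num.min t b) w - X (Num.min t a) w) = 0.
  move=> ta; have tb := le_trans ta ab.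
  by rewrite (min_idPl ta) (min_idPl tb) subrr mulr0.
apply/(martingaleP FP); split=> [t t0|t t0|s t A s0 st FA].
- exact: elementary_wrt.
- have [a1 b1] := minab _ t0; apply: (@L1_mul_bounded _ _ _ P _ h c) => //.
    by apply: L1B; exact: IX.
  exact: (wrt_measurable FP a0).
- have t0 := le_trans s0 st; have [ta|ta] := ler_or_gtr t a.
    by apply: E_ext => w; rewrite !zero // (le_trans st ta).
  have mA := filt_measurable FP s0 FA.
  have h1 (A' : set T) w : `|\1_A' w * h w| <= c.
    by rewrite normrM (le_trans _ (hc w)) // ler_piMl // norm_indic_le1.
  have tb : a <= Num.min t b by rewrite le_min ab ltW.
  have [sa|sa] := ler_or_gtr s a.
    transitivity (0 : R); last first.
      rewrite -[LHS](E_cst P 0); apply: E_ext => w; by rewrite zero // mulr0.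
    have mAh : measurable_wrt (F a) (fun w => \1_A w * h w).
      have sF := filtration_sigma FP a0.
      apply: wrtM => //; apply: wrt_indic => //.
      exact: (filtration_mono FP s0 sa).
    rewrite -[RHS](proj2 (mart_incr_weight mX a0 tb mAh (h1 A))).
    by apply: E_ext => w; rewrite mulrA (min_idPr (ltW ta)).
  have mAh : measurable_wrt (F s) (fun w => \1_A w * h w).
    have sF := filtration_sigma FP s0.
    apply: wrtM => //; first exact: wrt_indic.
    exact: (wrt_mono FP a0 (ltW sa)).
  have key : E (fun w => \1_A w * h w * X (Num.min t b) w) =
             E (fun w => \1_A w * h w * X (Num.min s b) w).
    have [bs|bs] := ler_or_gtr b s.
      by rewrite (min_idPr bs) (min_idPr (le_trans bs st)).
    rewrite (min_idPl (ltW bs)); apply: (mart_weight FP mX s0 _ mAh (h1 A)).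
    by rewrite le_min st ltW.
  rewrite (min_idPr (ltW ta)) (min_idPr (ltW sa)).
  have I1 r : 0 <= r -> L1 (fun w => \1_A w * h w * X r w).
    by move=> r0; apply: (L1_mul_bounded (IX _ r0) (wrt_measurable FP s0 mAh) (h1 A)).
  have spl r : 0 <= r -> E (fun w => \1_A w * (h w * (X r w - X a w))) =
      E (fun w => \1_A w * h w * X r w) - E (fun w => \1_A w * h w * X a w).
    by move=> r0; rewrite -E_B ?I1 //; apply: E_ext => w; ring.
  by rewrite !spl ?key // le_min ?s0 ?t0.
Qed.

End MartingaleTransforms.
(** * Paths, grids and optional stopping *)

Section Paths.
Context {R : realType}.
Implicit Types (x y : R -> R) (s t r b e : R).
Local Notation cpath x := ({within [set t : R | 0 <= t], continuous (x : R -> R)}).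

Lemma cpathP x : cpath x <-> forall t, 0 <= t -> forall e, 0 < e ->
  exists2 dl, 0 < dl & forall s, 0 <= s -> `|t - s| < dl -> `|x t - x s| < e.
Proof.
rewrite subspace_continuousP; split=> cx t t0.
  move=> e e0; have /cvgrPdist_lt /(_ e e0) := cx t t0.
  rewrite near_withinE => /nbhs_ballP[dl /= dl0 h]; exists dl => // s s0 ts.
  by apply: h.
apply/cvgrPdist_lt => e e0; rewrite near_withinE.
have [dl dl0 h] := cx t t0 e e0.
by apply/nbhs_ballP; exists dl => //= s ts s0; exact: h.
Qed.

Lemma cpath_lip x (phi : R -> R) : cpath x -> (forall t, 0 <= t -> 0 <= phi t) ->
  (forall s t, 0 <= s -> 0 <= t -> `|phi s - phi t| <= `|s - t|) ->
  cpath (fun t => x (phi t)).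
Proof.
rewrite !cpathP => cx phi0 lip t t0 e e0.
have [dl dl0 h] := cx _ (phi0 _ t0) e e0; exists dl => // s s0 ts.
by apply: h; [exact: phi0|apply: le_lt_trans ts; exact: lip].
Qed.

Lemma cpath_min x r : 0 <= r -> cpath x -> cpath (fun t => x (Num.min t r)).
Proof.
move=> r0 cx; apply: cpath_lip => // [t t0|s t s0 t0]; first by rewrite le_min t0.
case: (lerP s r) => sr; case: (lerP t r) => tr //; rewrite ?subrr ?normr0 //.
  by rewrite !ler0_norm; lra.
by rewrite !ger0_norm; lra.
Qed.

Lemma cpath_cst c : cpath (fun=> c).
Proof. by apply: continuous_subspaceT => ?; exact: cvg_cst. Qed.

Lemma cpathD x y : cpath x -> cpath y -> cpath (fun t => x t + y t).
Proof.
by rewrite !subspace_continuousP => cx cy t t0; apply: cvgD; [exact: cx|exact: cy].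
Qed.

Lemma cpathM x y : cpath x -> cpath y -> cpath (fun t => x t * y t).
Proof.
by rewrite !subspace_continuousP => cx cy t t0; apply: cvgM; [exact: cx|exact: cy].
Qed.

Lemma cpathN x : cpath x -> cpath (fun t => - x t).
Proof. by rewrite !subspace_continuousP => cx t t0; apply: cvgN; exact: cx. Qed.

Lemma cpathB x y : cpath x -> cpath y -> cpath (fun t => x t - y t).
Proof. by move=> cx cy; apply: cpathD => //; exact: cpathN. Qed.

Lemma cpath_norm x : cpath x -> cpath (fun t => `|x t|).
Proof. by rewrite !subspace_continuousP => cx t t0; apply: cvg_norm; exact: cx. Qed.

Lemma cpath_sum n (x : nat -> R -> R) : (forall i, (i < n)%N -> cpath (x i)) ->
  cpath (fun t => \sum_(i < n) x i t).
Proof.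
elim: n => [|n IH] cx.
  rewrite (_ : (fun t => _) = (fun=> 0)); first exact: cpath_cst.
  by apply/funext => t; rewrite big_ord0.
rewrite (_ : (fun t => _) = (fun t => \sum_(i < n) x i t + x n t)); last first.
  by apply/funext => t; rewrite big_ord_recr.
by apply: cpathD; [apply: IH => i /ltnW|]; exact: cx.
Qed.

Lemma cpath_unif x b e : cpath x -> 0 < e -> exists2 dl, 0 < dl &
  forall s t, 0 <= s -> s <= b -> 0 <= t -> t <= b -> `|s - t| < dl -> `|x s - x t| < e.
Proof.
move=> /cpathP cx e0.
pose Q dl s := 0 <= s -> forall t, 0 <= t -> `|s - t| < dl -> `|x s - x t| < e.
have cov : \forall dl \near (0 : R)^'+, [set` `[0, b]] `<=` Q dl.
  have /compact_near_coveringP := @segment_compact R 0 b; apply => u /=.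
  rewrite in_itv /= => /andP[u0 _]; have [dl dl0 h] := cx _ u0 _ (divr_gt0 e0 (ltr0n R 2)).
  have dl2 : 0 < dl / 2 by rewrite divr_gt0.
  exists (ball u (dl / 2), [set r | 0 < r < dl / 2]) => /=; first split.
  - exact: nbhsx_ballx.
  - by near=> r; apply/andP; split; near: r; [exact: nbhs_right_gt|exact: nbhs_right_lt].
  case=> s r /= [] us1 /andP[r0 rdl] s0 t t0 st.
  have us2 : `|u - s| < dl / 2 by [].
  have ut : `|u - t| < dl.
    by rewrite -(subrK s u) -addrA (le_lt_trans (ler_normD _ _)) //; lra.
  have us : `|u - s| < dl by lra.
  have h1 := h s s0 us; have h2 := h t t0 ut.
  rewrite -(subrK (x u) (x s)) -addrA (le_lt_trans (ler_normD _ _)) //.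
  by rewrite distrC; have := h1; lra.
have [dl [dl0 h]] : exists dl, 0 < dl /\ [set` `[0, b]] `<=` Q dl.
  near (0 : R)^'+ => dl; exists dl; split; first by [].
  by near: dl.
exists dl => // s t s0 sb t0 tb st; apply: h => //.
by rewrite /= in_itv /= s0.
Unshelve. all: by end_near.
Qed.

(** The increments that start before [r] form an initial segment of the grid, so they telescope up
    to the first grid point not before [r], or to the last one if there is none. *)
Lemma stopped_index (t : nat -> R) r x n : {homo t : i j / (i <= j)%N >-> i <= j} ->
  exists k, [/\ (k <= n)%N,
    x (t 0%N) + \sum_(i < n) (t i < r)%R%:R * (x (t i.+1) - x (t i)) = x (t k),
    (forall i, (i < k)%N -> t i < r) & k = n \/ r <= t k].
Proof.
move=> tmono; elim: n => [|n [k [kn sk tk ek]]].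
  by exists 0%N; split=> //; [rewrite big_ord0 addr0|left].
rewrite big_ord_recr addrA sk /=; have [tnr|tnr] := ler_or_gtr r (t n).
  exists k; split=> //; first exact: leqW.
    by rewrite ltNge tnr /= mul0r addr0.
  by right; case: ek => [->|].
have kE : k = n.
  case: ek => // rtk; apply/eqP; rewrite eqn_leq kn leqNgt; apply/negP => kltn.
  by have := le_trans rtk (tmono _ _ kn); rewrite leNgt tnr.
exists n.+1; split=> //; last by left.
  by rewrite tnr mul1r kE addrCA subrr addr0.
by move=> i; rewrite ltnS leq_eqVlt => /predU1P[->//|]; rewrite -kE; exact: tk.
Qed.

(** There are [n.+1] steps, so that the mesh is defined for every [n] and tends to 0; the endpoint
    [t] has index [n.+1]. *)
Definition grid (s t : R) n (i : nat) : R := s + (t - s) * i%:R / n.+1%:R.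

Lemma grid0 s t n : grid s t n 0 = s.
Proof. by rewrite /grid mulr0 mul0r addr0. Qed.

Lemma gridn s t n : grid s t n n.+1 = t.
Proof. by rewrite /grid mulfK ?pnatr_eq0 // addrC subrK. Qed.

Lemma grid_step s t n i : grid s t n i.+1 = grid s t n i + (t - s) / n.+1%:R.
Proof. by rewrite /grid -natr1 mulrDr mulr1 mulrDl addrA. Qed.

Lemma grid_mono s t n : s <= t -> {homo grid s t n : i j / (i <= j)%N >-> i <= j}.
Proof.
move=> st i j ij; rewrite /grid lerD2l ler_wpM2r ?invr_ge0 ?ler0n //.
by rewrite ler_wpM2l ?subr_ge0 // ler_nat.
Qed.

Lemma grid_mesh s t e : 0 < e -> \forall n \near \oo, (t - s) / n.+1%:R < e.
Proof.
move=> e0; near=> n; rewrite ltr_pdivrMr // mulrC -ltr_pdivrMr //.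
near: n; exists (Num.truncn ((t - s) / e)) => // n /= h.
by rewrite (lt_le_trans (truncnS_gt _)) // ler_nat ltnS.
Unshelve. all: by end_near.
Qed.

(** By telescoping, the left side is the value of [x] at the first grid point not before [r]; its
    predecessor is before [r], so it lies within one mesh of [r]. *)
Lemma cvg_stopped_grid x s t r : cpath x -> 0 <= s -> s <= r -> r <= t ->
  x s + \sum_(i < n.+1) (grid s t n i < r)%R%:R * (x (grid s t n i.+1) - x (grid s t n i))
    @[n --> \oo] --> x r.
Proof.
move=> /cpathP cx s0 sr rt; have r0 := le_trans s0 sr; have st := le_trans sr rt.
apply/cvgrPdist_lt => e e0; have [dl dl0 h] := cx _ r0 e e0.
have := grid_mesh s t dl0; apply: filterS => n mesh.
have [k [kn]] := @stopped_index (grid s t n) r x n.+1 (@grid_mono s t n st).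
rewrite grid0 => -> lk ek; have gk : r <= grid s t n k.
  by case: ek => [->|//]; rewrite gridn.
apply: h; first exact: le_trans gk.
case: k kn lk ek gk => [|k] kn lk ek gk.
  rewrite grid0 in gk *; have rs : r = s by lra.
  by rewrite rs subrr normr0.
move: gk (lk k (ltnSn _)) mesh; rewrite grid_step.
move: (grid s t n k) ((t - s) / _) => g mm h1 h2 h3.
by rewrite ler0_norm ?subr_le0 // opprB; lra.
Qed.

End Paths.

Lemma lt_fine_min {R : realType} (g t : R) (y : \bar R) : (0 <= y)%E ->
  (g < fine (Order.min t%:E y)) = (g < t) && (g%:E < y)%E.
Proof.
case: y => [y| |] //= y0; last by rewrite minEle leey /= ltry andbT.
by rewrite -EFin_min /= lt_min lte_fin.
Qed.

(** * Discrete martingale transforms and their L^2 bound *)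

Section Transforms.
Context {R : realType} {d : measure_display} {T : measurableType d}.
Variables (P : probability T R) (F : R -> set (set T)).
Hypothesis FP : usual_filtration P F.
Implicit Types (s u c lm : R) (f g : T -> R) (A B : set T) (X Y : R -> T -> R).
Local Notation E := (Rintegral P [set: T]).
Local Notation L1 f := (P.-integrable [set: T] (EFin \o f)).
Local Notation cpath x := ({within [set t : R | 0 <= t], continuous (x : R -> R)}).

Definition transform (h : nat -> T -> R) X (t : nat -> R) n w : R :=
  \sum_(i < n) h i w * (X (t i.+1) w - X (t i) w).

Lemma transformS h X t n w :
  transform h X t n.+1 w = transform h X t n w + h n w * (X (t n.+1) w - X (t n) w).
Proof. by rewrite /transform big_ord_recr. Qed.

Lemma transform_wrt X (t : nat -> R) (h : nat -> T -> R) n : adapted F X ->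
  {homo t : i j / (i <= j)%N >-> i <= j} -> 0 <= t 0%N ->
  (forall i, measurable_wrt (F (t i)) (h i)) ->
  measurable_wrt (F (t n)) (transform h X t n).
Proof.
move=> aX tmono t0 mh; have tge0 i : 0 <= t i by apply: (le_trans t0); exact: tmono.
have sF := filtration_sigma FP (tge0 n).
apply: (wrt_sum sF (f := fun i w => h i w * (X (t i.+1) w - X (t i) w))) => i ni.
apply: (wrtM sF); first exact: (wrt_mono FP (tge0 i) (tmono _ _ (ltnW ni))).
apply: (wrtB sF); [apply: (wrt_mono FP (tge0 _) (tmono _ _ ni))|
  apply: (wrt_mono FP (tge0 _) (tmono _ _ (ltnW ni)))]; exact: aX.
Qed.

Section Fixed.
Variables (X : R -> T -> R) (t : nat -> R) (h : nat -> T -> R).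
Hypothesis mX : martingale P F X.
Hypothesis tmono : {homo t : i j / (i <= j)%N >-> i <= j}.
Hypothesis t0 : 0 <= t 0%N.
Hypothesis mh : forall i, measurable_wrt (F (t i)) (h i).
Hypothesis h1 : forall i w, `|h i w| <= 1.

Let tge0 i : 0 <= t i. Proof. by apply: (le_trans t0); exact: tmono. Qed.
Let tS i : t i <= t i.+1. Proof. exact: tmono. Qed.

Let aX : adapted F X. Proof. by have [] := mX. Qed.

Lemma transform_L1 n : L1 (transform h X t n).
Proof.
apply: (L1_sum (f := fun i w => h i w * (X (t i.+1) w - X (t i) w))) => i _.
exact: (proj1 (mart_incr_weight FP mX (tge0 i) (tS i) (mh i) (h1 i))).
Qed.

Lemma transform_mean A n : F (t 0%N) A ->
  E (fun w => \1_A w * transform h X t n w) = 0.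
Proof.
move=> FA; have mA := filt_measurable FP (tge0 0) FA.
have key i : L1 (fun w => \1_A w * h i w * (X (t i.+1) w - X (t i) w)) /\
    E (fun w => \1_A w * h i w * (X (t i.+1) w - X (t i) w)) = 0.
  apply: (mart_incr_weight FP mX (tge0 i) (tS i) (c := 1)).
    have sF := filtration_sigma FP (tge0 i); apply: (wrtM sF); last exact: mh.
    by apply: (wrt_indic sF); apply: (filtration_mono FP t0) FA; exact: tmono.
  by move=> w; rewrite normrM mulr_ile1 // norm_indic_le1.
transitivity (E (fun w => \sum_(i < n) \1_A w * h i w * (X (t i.+1) w - X (t i) w))).
  by apply: E_ext => w; rewrite mulr_sumr; apply: eq_bigr => i _; rewrite mulrA.
rewrite (E_sum (f := fun i w => \1_A w * h i w * (X (t i.+1) w - X (t i) w))).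
  by apply: big1 => i _; exact: (key i).2.
by move=> i _; exact: (key i).1.
Qed.

Section L2.
Variable K : R.
Hypothesis XK : forall r w, 0 <= r -> `|X r w| <= K.

Lemma transform_bounded n w : `|transform h X t n w| <= n%:R * (K + K).
Proof.
elim: n => [|n IH]; first by rewrite /transform big_ord0 normr0 mul0r.
rewrite transformS -natr1 mulrDl mul1r (le_trans (ler_normD _ _)) // lerD //.
rewrite normrM -[leRHS]mul1r ler_pM // (le_trans (ler_normB _ _)) //.
by apply: lerD; exact: XK.
Qed.

(** Orthogonality of increments: in the square of the sum the cross term has a bounded weight known
    at [t n], hence mean 0, and the new square is at most that of the increment of [X]. The same
    computation for [X] itself shows that these squares add up to the right side. *)
Lemma transform_L2 n :
  E (fun w => transform h X t n w ^+ 2) <= E (fun w => X (t n) w ^+ 2) - E (fun w => X (t 0%N) w ^+ 2).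
Proof.
have mXt r : 0 <= r -> measurable_fun [set: T] (X r).
  by move=> r0; exact: (wrt_measurable FP r0 (@aX _ r0)).
have mTr m := wrt_measurable FP (tge0 m) (transform_wrt m aX tmono t0 mh).
have LL (f g : T -> R) a b : measurable_fun [set: T] f -> measurable_fun [set: T] g ->
    (forall w, `|f w| <= a) -> (forall w, `|g w| <= b) -> L1 (fun w => f w * g w).
  move=> mf mg fa gb; apply: (@L1_mul_bounded _ _ _ P g f a) => //.
  exact: (L1_bounded P mg gb).
have XX r q : 0 <= r -> 0 <= q -> L1 (fun w => X r w * X q w).
  by move=> r0 q0; apply: (LL _ _ K K); [exact: mXt|exact: mXt|move=> w; exact: XK|move=> w; exact: XK].
elim: n => [|n IH].
  rewrite subrr -[leRHS](E_cst P 0) le_eqVlt; apply/orP; left; apply/eqP.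
  by apply: E_ext => w; rewrite /transform big_ord0 expr0n.
pose S := transform h X t n; pose D w := X (t n.+1) w - X (t n) w.
have mD : measurable_fun [set: T] D by apply: measurable_funB; exact: mXt.
have DK w : `|D w| <= K + K.
  by rewrite (le_trans (ler_normB _ _)) //; apply: lerD; exact: XK.
have mhn := wrt_measurable FP (tge0 n) (mh n).
have cross : E (fun w => S w * h n w * D w) = 0.
  apply: (proj2 (mart_incr_weight FP mX (tge0 n) (tS n) (c := n%:R * (K + K)) _ _)).
    by apply: (wrtM (filtration_sigma FP (tge0 n))); [exact: transform_wrt|].
  move=> w; rewrite normrM -[leRHS]mulr1 ler_pM //.
  exact: transform_bounded.
have L_SS : L1 (fun w => S w * S w) by apply: (LL _ _ _ _ (mTr n) (mTr n)); exact: transform_bounded.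
have L_DD : L1 (fun w => D w * D w) by apply: (LL _ _ _ _ mD mD).
have mhD : measurable_fun [set: T] (fun w => h n w * D w) by exact: measurable_funM.
have hDK w : `|h n w * D w| <= K + K.
  by rewrite normrM (le_trans _ (DK w)) // ler_piMl.
have L_hD : L1 (fun w => h n w * D w * (h n w * D w)) by apply: (LL _ _ _ _ mhD mhD).
have L_ShD : L1 (fun w => S w * h n w * D w).
  have := LL _ _ _ _ (mTr n) mhD (transform_bounded n) hDK.
  by congr (is_true (integrable _ _ _)); apply/funext => w /=; rewrite mulrA.
have crossX : E (fun w => X (t n) w * D w) = 0.
  exact: (proj2 (mart_incr_weight FP mX (tge0 n) (tS n) (@aX _ (tge0 n)) (fun w => XK w (tge0 n)))).
have L_XD : L1 (fun w => X (t n) w * D w).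
  exact: (proj1 (mart_incr_weight FP mX (tge0 n) (tS n) (@aX _ (tge0 n)) (fun w => XK w (tge0 n)))).
have -> : E (fun w => transform h X t n.+1 w ^+ 2) =
    E (fun w => S w * S w) + E (fun w => h n w * D w * (h n w * D w)).
  transitivity (E (fun w => S w * S w + h n w * D w * (h n w * D w) + 2 * (S w * h n w * D w))).
    by apply: E_ext => w; rewrite transformS /S /D; ring.
  by rewrite (E_D (L1D L_SS L_hD) (L1Z 2 L_ShD)) (E_D L_SS L_hD) (E_Z 2 L_ShD) cross mulr0 addr0.
have -> : E (fun w => X (t n.+1) w ^+ 2) = E (fun w => X (t n) w ^+ 2) + E (fun w => D w * D w).
  transitivity (E (fun w => X (t n) w * X (t n) w + D w * D w + 2 * (X (t n) w * D w))).
    by apply: E_ext => w; rewrite /D; ring.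
  have L_XX := XX _ _ (tge0 n) (tge0 n).
  rewrite (E_D (L1D L_XX L_DD) (L1Z 2 L_XD)) (E_D L_XX L_DD) (E_Z 2 L_XD) crossX mulr0 addr0.
  by congr (_ + _); apply: E_ext => w; rewrite expr2.
have : E (fun w => S w * S w) <= E (fun w => X (t n) w ^+ 2) - E (fun w => X (t 0%N) w ^+ 2).
  by rewrite (_ : E _ = E (fun w => S w ^+ 2)) //; apply: E_ext => w; rewrite expr2.
have : E (fun w => h n w * D w * (h n w * D w)) <= E (fun w => D w * D w).
  apply: E_le => // w; rewrite -!expr2 exprMn ler_piMl ?sqr_ge0 //.
  by rewrite -[_ ^+ 2]ger0_norm ?sqr_ge0 // normrX expr_le1.
lra.
Qed.

End L2.
End Fixed.

End Transforms.

Lemma le_fine_min {R : realType} (s t : R) (y : \bar R) : (0 <= y)%E ->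
  (s <= fine (Order.min t%:E y)) = (s <= t) && (s%:E <= y)%E.
Proof.
case: y => [y| |] //= y0; last by rewrite minEle leey /= leey andbT.
by rewrite -EFin_min /= le_min lee_fin.
Qed.

(** * Optional stopping along grids *)

Section Stopping.
Context {R : realType} {d : measure_display} {T : measurableType d}.
Variables (P : probability T R) (F : R -> set (set T)).
Hypothesis FP : usual_filtration P F.
Implicit Types (s t u c lm K : R) (f g : T -> R) (A B : set T) (X Y : R -> T -> R)
  (tau : T -> \bar R).
Local Notation E := (Rintegral P [set: T]).
Local Notation L1 f := (P.-integrable [set: T] (EFin \o f)).
Local Notation cpath x := ({within [set t : R | 0 <= t], continuous (x : R -> R)}).

(** When [k i w] is nonincreasing in [i], this is [X] stopped at the first grid index where [k]
    fails, or at [m]. *)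
Definition frozen_at X (t : nat -> R) (k : nat -> T -> bool) m w : R :=
  X (t 0%N) w + transform (fun i w => (k i w)%:R) X t m w.

(* On {k i w = false} the stopped value is frozen from time t i on, so that
   the sign of the stopped value times the remaining increments integrates to 0. *)
Lemma stopped_tail X (t : nat -> R) (k : nat -> T -> bool) n B lm :
  martingale P F X -> {homo t : i j / (i <= j)%N >-> i <= j} -> 0 <= t 0%N ->
  (forall i, F (t i) [set w | k i w]) ->
  (forall i j w, (i <= j)%N -> k j w -> k i w) -> F (t 0%N) B ->
  E (fun w => \1_B w * (\1_[set w | lm < `|frozen_at X t k n w|] w * `|frozen_at X t k n w|)) <=
  E (fun w => \1_B w * (\1_[set w | lm < `|frozen_at X t k n w|] w * `|X (t n) w|)).
Proof.
move=> mX tmono t0 Fk kmono FB; pose Y := frozen_at X t k.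
have tge0 i : 0 <= t i by apply: (le_trans t0); exact: tmono.
have tS i : t i <= t i.+1 by exact: tmono.
have /(martingaleP FP)[aX IX _] := mX.
have k1 i w : `|(k i w)%:R : R| <= 1 by case: (k i w); rewrite ?normr1 ?normr0.
have mk i : measurable_wrt (F (t i)) (fun w => (k i w)%:R).
  rewrite (_ : (fun w => _) = \1_[set w | k i w]).
    by apply: wrt_indic => //; exact: (filtration_sigma FP (tge0 i)).
  by apply/funext => w; rewrite indicb.
have mY m : measurable_wrt (F (t m)) (Y m).
  apply: (wrtD (filtration_sigma FP (tge0 m))); last by apply: (transform_wrt FP).
  by apply: (wrt_mono FP t0 (tmono _ _ (leq0n m))); exact: aX.
have LY m : L1 (Y m) by apply: L1D; [exact: IX|apply: (transform_L1 FP mX)].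
pose g m w : R := \1_B w * (\1_[set w | lm < `|Y m w|] w * Num.sg (Y m w)).
have mg m : measurable_wrt (F (t m)) (g m).
  have sF := filtration_sigma FP (tge0 m).
  apply: (wrtM sF); first apply: (wrt_indic sF).
    exact: (filtration_mono FP t0 (tmono _ _ (leq0n m))).
  apply: (wrtM sF); last exact: wrt_sg.
  by apply: (wrt_indic sF); apply: (wrt_lt sF); [exact: wrt_cst|exact: wrt_norm].
have g1 m w : `|g m w| <= 1.
  by rewrite /g !normrM mulr_ile1 ?mulr_ge0 ?mulr_ile1 ?norm_indic_le1 ?norm_sg_le1.
have frozen i m w : (i <= m)%N -> ~~ k i w -> Y m w = Y i w.
  elim: m => [|m IH]; first by rewrite leqn0 => /eqP ->.
  rewrite leq_eqVlt => /predU1P[->//|im nk]; rewrite -IH // /Y /frozen_at transformS.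
  have -> : k m w = false by apply: contraNF nk; exact: kmono.
  by rewrite mul0r addr0.
have key : E (fun w => g n w * X (t n) w) = E (fun w => g n w * Y n w).
  have Lg f : L1 f -> L1 (fun w => g n w * f w).
    by move=> If; apply: (L1_mul_bounded If (wrt_measurable FP (tge0 n) (mg n)) (g1 n)).
  apply/eqP; rewrite -subr_eq0 -E_B ?Lg //; last exact: IX.
  have tail (i : nat) : (i < n)%N ->
      L1 (fun w => g n w * (~~ k i w)%:R * (X (t i.+1) w - X (t i) w)) /\
      E (fun w => g n w * (~~ k i w)%:R * (X (t i.+1) w - X (t i) w)) = 0.
    move=> ni.
    (* Where [k i w] fails the value no longer changes after index [i], so the weight [g n], known
       only at the end, may be replaced by [g i], known at [t i]. *)
    have eq1 : (fun w => g n w * (~~ k i w)%:R * (X (t i.+1) w - X (t i) w)) =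
        (fun w => g i w * (1 - (k i w)%:R) * (X (t i.+1) w - X (t i) w)).
      apply/funext => w; congr (_ * _); case: (boolP (k i w)) => ki.
        by rewrite subrr !mulr0.
      by rewrite subr0 /g !indicb (frozen i n) // ltnW.
    rewrite eq1; apply: (mart_incr_weight FP mX (tge0 i) (tS i) (c := 1)).
      have sF := filtration_sigma FP (tge0 i).
      apply: (wrtM sF) => //; apply: (wrtB sF) => //; exact: wrt_cst.
    move=> w; rewrite normrM mulr_ile1 //.
    by case: (k i w); rewrite ?subrr ?subr0 ?normr0 ?normr1.
  rewrite (@E_ext _ _ _ P _ (fun w => \sum_(i < n) g n w * (~~ k i w)%:R * (X (t i.+1) w - X (t i) w))).
    by rewrite (E_sum (fun i ni => (tail i ni).1)) big1 // => i _; exact: (tail i _).2.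
  move=> w; under eq_bigr do rewrite -mulrA; rewrite -mulr_sumr -mulrBr; congr (_ * _).
  have tele m : X (t m) w = X (t 0%N) w + \sum_(i < m) (X (t i.+1) w - X (t i) w).
    elim: m => [|m IH]; first by rewrite big_ord0 addr0.
    by rewrite big_ord_recr /= addrA -IH addrCA subrr addr0.
  rewrite /Y /frozen_at /transform tele opprD addrACA subrr add0r -sumrB.
  by apply: eq_bigr => i _; case: (k i w); rewrite /= ?mul1r ?mul0r ?subrr ?subr0.
rewrite (@E_ext _ _ _ P _ (fun w => g n w * Y n w)).
  rewrite -key; apply: E_le.
  - by apply: (L1_mul_bounded (IX _ (tge0 n)) (wrt_measurable FP (tge0 n) (mg n)) (g1 n)).
  - have mB := filt_measurable FP t0 FB.
    apply: L1_indic => //; apply: L1_indic; last by apply: L1_norm; exact: IX.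
    apply: (filt_measurable FP (tge0 n)); have sF := filtration_sigma FP (tge0 n).
    by apply: (wrt_lt sF); [exact: wrt_cst|exact: wrt_norm].
  - move=> w; rewrite /g -!mulrA ler_wpM2l // ?ler_wpM2l ?indicE //.
    by rewrite (le_trans (ler_norm _)) // normrM ler_piMl // norm_sg_le1.
by move=> w; rewrite /g -!mulrA -normrEsg.
Qed.

Section StoppedGrid.
Variables (X : R -> T -> R) (tau : T -> \bar R).
Hypothesis aX : adapted F X.
Hypothesis cX : forall w, cpath (X ^~ w).
Hypothesis tau_st : stopping_time F tau.

Let tau0 w : (0 <= tau w)%E. Proof. exact: tau_st.1. Qed.

Let F_lt t : 0 <= t -> F t [set w | (t%:E < tau w)%E].
Proof.
move=> t0; rewrite (_ : [set w | _] = ~` [set w | (tau w <= t%:E)%E]).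
  by apply: wrtC; [exact: (filtration_sigma FP t0)|exact: tau_st.2].
by apply/seteqP; split=> w /=; [rewrite ltNge => /negP|move/negP; rewrite -ltNge].
Qed.

Let r t w := fine (Order.min t%:E (tau w)).

Let r_bnd t w : 0 <= t -> 0 <= r t w <= t.
Proof.
move=> t0; rewrite /r; case: (tau w) (tau0 w) => [y| |] //= y0.
  by rewrite -EFin_min /= le_min t0 ge_min lexx /= andbT -lee_fin.
by rewrite minEle leey /= t0 lexx.
Qed.

Let F_ltr q t : 0 <= q -> F q [set w | q < r t w].
Proof.
move=> q0; have sF := filtration_sigma FP q0; case: (boolP (q < t)) => qt.
  suff -> : [set w | q < r t w] = [set w | (q%:E < tau w)%E] by exact: F_lt.
  by apply/funext => w; rewrite /= /r lt_fine_min // qt.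
suff -> : [set w | q < r t w] = set0 by exact: wrt0.
by apply/seteqP; split=> w //=; rewrite /r lt_fine_min // (negbTE qt).
Qed.

Let Y s t n := frozen_at X (grid s t n) (fun i w => (grid s t n i < r t w)%R) n.+1.

Let grid_ge0 s t n i : 0 <= s -> s <= t -> 0 <= grid s t n i.
Proof. by move=> s0 st; rewrite (le_trans s0) // -{1}(grid0 s t n) grid_mono. Qed.

Let mind q t : 0 <= q -> measurable_wrt (F q) (fun w => (q < r t w)%R%:R : R).
Proof.
move=> q0; have sF := filtration_sigma FP q0.
rewrite (_ : (fun w => _) = \1_[set w | q < r t w]); first by apply: (wrt_indic sF); exact: F_ltr.
by apply/funext => w; rewrite indicb.
Qed.

Let mY s t n : 0 <= s -> s <= t -> measurable_wrt (F t) (Y s t n).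
Proof.
move=> s0 st; have t0 := le_trans s0 st.
apply: (wrtD (filtration_sigma FP t0)).
  by rewrite grid0; apply: (wrt_mono FP s0 st); exact: aX.
rewrite -{1}(gridn s t n); apply: (transform_wrt FP).
- exact: aX.
- exact: grid_mono.
- by rewrite grid0.
- by move=> i; apply: mind; exact: grid_ge0.
Qed.

Let cY s t w : 0 <= s -> s <= t -> Y s t n w @[n --> \oo] --> X (Num.max s (r t w)) w.
Proof.
move=> s0 st; have /andP[r0 rt] := r_bnd w (le_trans s0 st).
have := @cvg_stopped_grid _ (X ^~ w) s t (Num.max s (r t w)) (@cX w) s0.
rewrite le_max lexx ge_max st rt => /(_ isT isT).
suff -> : (fun n => Y s t n w) = (fun n => X s w +
   \sum_(i < n.+1) (grid s t n i < Num.max s (r t w))%R%:R *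
     (X (grid s t n i.+1) w - X (grid s t n i) w)) by [].
apply/funext => n; rewrite /Y /frozen_at grid0 /transform; congr (_ + _).
apply: eq_bigr => i _; congr (_%:R * _); congr nat_of_bool.
by rewrite lt_max [X in X || _]ltNge -{2}(grid0 s t n) grid_mono.
Qed.

Let stE t w : stopped X tau t w = if (0 < tau w)%E then X (r t w) w else 0.
Proof. by []. Qed.

(** The stopped variable is a pointwise limit of sums frozen along grids of [0, t], each of which is
    visibly [F t]-measurable. *)
Lemma stopped_adapted : adapted F (stopped X tau).
Proof.
move=> t t0; have sF := filtration_sigma FP t0.
have := @wrt_if _ _ _ _ sF [set w | (0 < tau w)%E] (fun w => X (r t w) w) (fun=> 0).
rewrite (_ : (fun w => if _ then _ else _) = stopped X tau t); last first.
  by apply/funext => w; rewrite stE mem_setE.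
apply; last exact: wrt_cst.
  by apply: (filtration_mono FP (lexx 0) t0); exact: F_lt.
apply: (wrt_cvg sF (f_ := fun n => Y 0 t n)) => [n|w]; first exact: mY.
have /andP[r0 _] := r_bnd w t0.
by have := @cY 0 t w (lexx 0) t0; rewrite (max_idPr r0).
Qed.

Lemma mart_stop K : martingale P F X ->
  (forall t w, 0 <= t -> `|stopped X tau t w| <= K) -> martingale P F (stopped X tau).
Proof.
move=> mX stK; have /(martingaleP FP)[_ IX _] := mX.
have aS := stopped_adapted.
have bnd1 (b : bool) : `|b%:R : R| <= 1 by case: b; rewrite ?normr1 ?normr0.
have IS t : 0 <= t -> L1 (stopped X tau t).
  move=> t0; apply: (L1_bounded P (wrt_measurable FP t0 (aS _ t0)) (c := K)).
  by move=> w; exact: stK.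
apply/(martingaleP FP).
split=> // s t A s0 st FA; have t0 := le_trans s0 st.
have sF := filtration_sigma FP s0.
(* On [A] outside [B] stopping has occurred by time [s], so the two stopped values coincide and only
   [B] contributes. *)
pose B := A `&` [set w | (s%:E < tau w)%E].
have FB : F s B by apply: (wrtI sF) => //; exact: F_lt.
have mB := filt_measurable FP s0 FB; have mA := filt_measurable FP s0 FA.
have BK w : B w -> [/\ stopped X tau s w = X s w,
     stopped X tau t w = X (r t w) w & s <= r t w].
  move=> [_ /= stau]; rewrite !stE.
  have -> : (0 < tau w)%E by rewrite (le_lt_trans _ stau).
  by rewrite {1}/r (min_idPl (ltW stau)) /= /r le_fine_min // st ltW.
pose rho w := Num.max s (r t w).
have diff w : \1_A w * stopped X tau t w - \1_A w * stopped X tau s w =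
    \1_B w * X (rho w) w - \1_B w * X s w.
  have [Bw|nBw] := pselect (B w).
    have [-> -> sr] := BK w Bw; have [Aw _] := Bw.
    by rewrite !indicE (mem_set Aw) (mem_set Bw) /rho (max_idPr sr).
  rewrite ![\1_B _]indicE (memNset nBw) !mul0r subrr.
  have [Aw|nAw] := pselect (A w); last by rewrite !indicE (memNset nAw) !mul0r subrr.
  have taus : (tau w <= s%:E)%E.
    by rewrite leNgt; apply/negP => h; apply: nBw.
  rewrite !stE; case: ifP => _; last by rewrite !mulr0 subrr.
  have taut : (tau w <= t%:E)%E by rewrite (le_trans taus) // lee_fin.
  by rewrite /r (min_idPr taus) (min_idPr taut) subrr.
(* The margin 1 above [K] ensures that on [B] the convergence of [Y s t n w] eventually leads out of
   [C n]. *)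
pose C n := [set w | K + 1 < `|Y s t n w|].
have mC n : measurable (C n).
  apply: (filt_measurable FP t0); have sFt := filtration_sigma FP t0.
  apply: (wrt_lt sFt); first exact: wrt_cst.
  by apply: (wrt_norm sFt); exact: mY.
have LY n : L1 (Y s t n).
  apply: L1D; first by rewrite grid0; exact: IX.
  apply: (transform_L1 FP mX) => //.
  - exact: grid_mono.
  - by rewrite grid0.
  - by move=> i; apply: mind; exact: grid_ge0.
have EY n : E (fun w => \1_B w * Y s t n w) = E (fun w => \1_B w * X s w).
  pose tr := transform (fun i w => (grid s t n i < r t w)%R%:R) X (grid s t n) n.+1.
  have trL : L1 tr.
    apply: (transform_L1 FP mX) => //.
    - exact: grid_mono.
    - by rewrite grid0.
    - by move=> i; apply: mind; exact: grid_ge0.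
  have tr0 : E (fun w => \1_B w * tr w) = 0.
    apply: (transform_mean FP mX) => //.
    - exact: grid_mono.
    - by rewrite grid0.
    - by move=> i; apply: mind; exact: grid_ge0.
    - by rewrite grid0.
  rewrite -[RHS]addr0 -tr0 -E_D; [|exact/L1_indic/IX|exact: L1_indic] => //.
  by apply: E_ext => w; rewrite -mulrDr /Y /frozen_at grid0.
pose U n w := \1_B w * ((1 - \1_(C n) w) * Y s t n w).
pose V n w := \1_B w * (\1_(C n) w * `|X t w|).
have near_C w : B w -> \forall n \near \oo, \1_(C n) w = 0 :> R.
  move=> Bw; have /cvgrPdist_lt /(_ 1 ltr01) := @cY s t w s0 st.
  apply: filterS => n hn; rewrite indicb; have [_ h2 sr] := BK w Bw.
  have := stK t w t0; rewrite h2 -(max_idPr sr) -/(rho w) => h3.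
  rewrite ltNge -[leLHS](_ : `|Y s t n w - X (rho w) w + X (rho w) w| = _); last by rewrite subrK.
  by rewrite (le_trans (ler_normD _ _)) // addrC lerD // distrC ltW.
have [LBr cU] : L1 (fun w => \1_B w * X (rho w) w) /\
    E (U n) @[n --> \oo] --> E (fun w => \1_B w * X (rho w) w).
  apply: (@E_dct _ _ _ P U _ (fun=> K + 1)).
  - move=> n; apply: measurable_funM; first exact: measurable_indic.
    apply: measurable_funM; last exact: L1_measurable (LY n).
    by apply: measurable_funB => //; exact: measurable_indic.
  - apply: measurable_funM; first exact: measurable_indic.
    apply: (wrt_measurable FP t0); apply: (wrt_cvg (filtration_sigma FP t0) (f_ := Y s t)).
      by move=> n; exact: mY.
    by move=> w; exact: cY.
  - exact: L1_cst.
  - move=> n w; rewrite /U [\1_(C n) w]indicb indicE; case: (w \in B); last first.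
      by rewrite mul0r normr0 (le_trans (normr_ge0 _) (le_trans (stK t w t0) _)) // lerDl.
    rewrite mul1r; case: ltP => h /=; last by rewrite subr0 mul1r.
    rewrite subrr mul0r.
    by rewrite normr0 (le_trans (normr_ge0 _) (le_trans (stK t w t0) _)) // lerDl.
  - apply: aeW => w; have [Bw|nBw] := pselect (B w); last first.
      by rewrite /U indicE (memNset nBw) mul0r; apply: cvg_near_cst; apply: nearW => n; rewrite mul0r.
    apply: cvgM; first exact: cvg_cst.
    rewrite -[X in _ --> X]mul1r; apply: cvgM; last exact: cY.
    by apply: cvg_near_cst; apply: filterS (near_C w Bw) => n ->; rewrite subr0.
have cV : E (V n) @[n --> \oo] --> 0.
  rewrite -[X in _ --> X](E_cst P 0).
  have [] := @E_dct _ _ _ P V (fun=> 0) (fun w => `|X t w|).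
  - move=> n; apply: measurable_funM; first exact: measurable_indic.
    apply: measurable_funM; first exact: measurable_indic.
    exact: L1_measurable (L1_norm (IX _ t0)).
  - exact: measurable_cst.
  - exact: L1_norm (IX _ t0).
  - move=> n w; rewrite /V normrM normrM normr_id.
    apply: (@le_trans _ _ (`|\1_(C n) w| * `|X t w|)).
      by rewrite ler_piMl ?mulr_ge0 ?norm_indic_le1.
    by rewrite ler_piMl ?norm_indic_le1.
  - apply: aeW => w; have [Bw|nBw] := pselect (B w); last first.
      by rewrite /V indicE (memNset nBw); apply: cvg_near_cst; apply: nearW => n; rewrite mul0r.
    by apply: cvg_near_cst; apply: filterS (near_C w Bw) => n h; rewrite /V h mul0r mulr0.
  - by [].
have UV n : `|E (fun w => \1_B w * X s w) - E (U n)| <= E (V n).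
  have LCY : L1 (fun w => \1_B w * (\1_(C n) w * Y s t n w)) by do 2 apply: L1_indic => //.
  have LU : L1 (U n).
    have := L1B (L1_indic mB (LY n)) LCY.
    by congr (is_true (integrable _ _ _)); apply/funext => w; rewrite /U /=; congr (_%:E); ring.
  rewrite -(EY n) -E_B //; last exact: L1_indic.
  have -> : E (fun w => \1_B w * Y s t n w - U n w) = E (fun w => \1_B w * (\1_(C n) w * Y s t n w)).
    by apply: E_ext => w; rewrite /U; ring.
  apply: (le_trans (E_abs LCY)).
  have := @stopped_tail X (grid s t n) (fun i w => (grid s t n i < r t w)%R) n.+1 B (K + 1) mX.
  rewrite gridn grid0 => h; apply: le_trans (h _ s0 _ _ FB).
  - rewrite le_eqVlt; apply/orP; left; apply/eqP; apply: E_ext => w.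
    by rewrite !normrM ![`|\1__ _|]ger0_norm // indicE.
  - exact: grid_mono.
  - by move=> i; apply: F_ltr; exact: grid_ge0.
  - by move=> i j w ij; apply: le_lt_trans; exact: grid_mono.
have EE : E (fun w => \1_B w * X s w) = E (fun w => \1_B w * X (rho w) w).
  have c1 : E (U n) @[n --> \oo] --> E (fun w => \1_B w * X s w).
    apply/cvgrPdist_le => e e0; have /cvgrPdist_le /(_ e e0) := cV.
    apply: filterS => n; rewrite sub0r normrN => h.
    by rewrite (le_trans (UV n)) // (le_trans (ler_norm _)).
  by rewrite -(cvg_lim _ c1) // (cvg_lim _ cU).
apply/eqP; rewrite -subr_eq0 -E_B; [|exact/L1_indic/IS|exact/L1_indic/IS] => //.
rewrite (@E_ext _ _ _ P _ _ diff) E_B ?EE ?subrr //.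
by apply: L1_indic => //; exact: IX.
Qed.

End StoppedGrid.
End Stopping.
(** * Null sets and localization *)

Section StoppingTimes.
Context {R : realType} {d : measure_display} {T : measurableType d}.
Variables (P : probability T R) (F : R -> set (set T)).
Hypothesis FP : usual_filtration P F.
Implicit Types (s t u c lm K : R) (f g : T -> R) (A B : set T) (X Y : R -> T -> R)
  (tau sigma : T -> \bar R).
Local Notation E := (Rintegral P [set: T]).
Local Notation cpath x := ({within [set t : R | 0 <= t], continuous (x : R -> R)}).

Lemma stopping_min tau sigma : stopping_time F tau -> stopping_time F sigma ->
  stopping_time F (fun w => Order.min (tau w) (sigma w)).
Proof.
move=> [t0 Ft] [s0 Fs]; split=> [w|t t0']; first by rewrite le_min t0 s0.
have sF := filtration_sigma FP t0'.
rewrite (_ : [set w | _] = [set w | (tau w <= t%:E)%E] `|` [set w | (sigma w <= t%:E)%E]).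
  by apply: wrtU => //; [exact: Ft|exact: Fs].
by apply/seteqP; split=> w /=; rewrite ge_min => /orP.
Qed.

Lemma stopping_cst c : 0 <= c -> stopping_time F (fun=> c%:E).
Proof.
move=> c0; split=> // t t0; have sF := filtration_sigma FP t0.
rewrite lee_fin; case: (c <= t).
  by rewrite (_ : [set _ | _] = setT); [exact: wrtT|apply/seteqP; split].
by rewrite (_ : [set _ | _] = set0); [exact: wrt0|apply/seteqP; split].
Qed.

Lemma fine_minE t (y : \bar R) : 0 <= t -> (0 <= y)%E ->
  (fine (Order.min t%:E y))%:E = Order.min t%:E y.
Proof. by case: y => [y| |] //= t0 y0; rewrite ?minEle ?leey //; case: ifP. Qed.

Lemma fine_min_ge0 t (y : \bar R) : 0 <= t -> (0 <= y)%E -> 0 <= fine (Order.min t%:E y).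
Proof. by move=> t0 y0; rewrite -lee_fin fine_minE // le_min y0 lee_fin t0. Qed.

Lemma stopped_stopped X tau sigma : (forall w, (0 <= tau w)%E) -> (forall w, (0 <= sigma w)%E) ->
  forall t w, 0 <= t -> stopped (stopped X sigma) tau t w =
    stopped X (fun w => Order.min (sigma w) (tau w)) t w.
Proof.
move=> tau0 sigma0 t w t0; rewrite /stopped lt_min andbC.
case: (0 < tau w)%E => //=; case: (0 < sigma w)%E => //.
by rewrite fine_minE // -minA [Order.min (tau w) _]minC.
Qed.

Lemma stopped_cpath X tau w : (forall w, (0 <= tau w)%E) -> cpath (X ^~ w) ->
  cpath (stopped X tau ^~ w).
Proof.
move=> tau0 cX; rewrite /stopped; case: (0 < tau w)%E; last exact: cpath_cst.
case: (tau w) (tau0 w) => [y| |] // y0.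
  rewrite (_ : (fun t => _) = (fun t => X (Num.min t y) w)); first by apply: (cpath_min (x := X ^~ w)); rewrite -?lee_fin.
  by apply/funext => t; rewrite -EFin_min.
rewrite (_ : (fun t => _) = X ^~ w) //.
by apply/funext => t; rewrite minEle leey.
Qed.

Lemma mart_ext X Y : (forall t w, 0 <= t -> X t w = Y t w) ->
  martingale P F X -> martingale P F Y.
Proof.
move=> XY /(martingaleP FP)[aX IX mX].
have XYt t : 0 <= t -> X t = Y t by move=> t0; apply/funext => w; exact: XY.
apply/(martingaleP FP); split=> [t t0|t t0|s t A s0 st FA].
- by rewrite -XYt //; exact: aX.
- by rewrite -XYt //; exact: IX.
- by rewrite -!XYt ?(le_trans s0) //; exact: mX.
Qed.

Lemma null_filt t A : 0 <= t -> P.-negligible A -> F t A.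
Proof.
by move=> t0 nA; apply: (filtration_mono FP (lexx 0) t0); exact: (filtration_complete FP).
Qed.

(** By completeness the null set where [f] and [g] differ, and each of its subsets, belongs to
    [F t]; off it the preimages agree. *)
Lemma wrt_ae t f g : 0 <= t -> {ae P, forall w, f w = g w} ->
  measurable_wrt (F t) f -> measurable_wrt (F t) g.
Proof.
move=> t0 fg mf B mB; have sF := filtration_sigma FP t0.
pose N := ~` [set w | f w = g w].
have nN : P.-negligible N by [].
have -> : g @^-1` B = (f @^-1` B `&` ~` N) `|` (g @^-1` B `&` N).
  apply/seteqP; split=> w /=.
    have [e|e] := pselect (f w = g w); last by right; split=> //.
    by move=> Bg; left; split; [rewrite e|exact].
  by move=> [[Bf /contrapT e]|[]//]; rewrite -e.
apply: (wrtU sF).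
  by apply: (wrtI sF); [exact: mf|apply: (wrtC sF); exact: null_filt].
by apply: null_filt => //; apply: negligibleS nN => w [].
Qed.

Lemma mart_ae X Y : (forall t, 0 <= t -> {ae P, forall w, X t w = Y t w}) ->
  martingale P F X -> martingale P F Y.
Proof.
move=> XY /(martingaleP FP)[aX IX mX].
have aY : adapted F Y by move=> t t0; apply: wrt_ae (XY _ t0) (aX _ t0).
have mY t (t0 : 0 <= t) := wrt_measurable FP t0 (aY t t0).
have key t A : 0 <= t -> measurable A ->
    E (fun w => \1_A w * X t w) = E (fun w => \1_A w * Y t w).
  move=> t0 mA; apply: (proj2 (E_ae_eq _ _ _)).
  - by apply: L1_indic => //; exact: IX.
  - by apply: measurable_funM; [exact: measurable_indic|exact: mY].
  - by apply: filterS (XY _ t0) => w ->.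
apply/(martingaleP FP); split=> // [t t0|s t A s0 st FA].
  exact: (proj1 (E_ae_eq (IX _ t0) (mY _ t0) (XY _ t0))).
have mA := filt_measurable FP s0 FA.
by rewrite -!key ?(le_trans s0) //; exact: mX.
Qed.

Lemma cpath_cadlag X w : cpath (X ^~ w) ->
  (forall t, 0 <= t -> X s w @[s --> t^'+] --> X t w) /\
  (forall t, 0 < t -> cvg (X s w @[s --> t^'-])).
Proof.
move=> /cpathP cX; split=> [t t0|t t0].
  apply/cvgrPdist_lt => e e0; have [dl dl0 h] := cX t t0 e e0.
  near=> s; apply: h; first by apply: (le_trans t0); apply: ltW; near: s; exact: nbhs_right_gt.
  rewrite distrC ger0_norm ?subr_ge0; last by apply: ltW; near: s; exact: nbhs_right_gt.
  by rewrite ltrBlDl; near: s; apply: nbhs_right_lt; rewrite ltrDl.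
apply/cvg_ex; exists (X t w); apply/cvgrPdist_lt => e e0.
have [dl dl0 h] := cX t (ltW t0) e e0.
near=> s; apply: h; first by apply: ltW; near: s; exact: nbhs_left_gt.
rewrite ger0_norm ?subr_ge0; last by apply: ltW; near: s; exact: nbhs_left_lt.
by rewrite ltrBlDr -ltrBlDl; near: s; apply: nbhs_left_gt; rewrite ltrBlDr ltrDl.
Unshelve. all: by end_near.
Qed.

Lemma cadlag_ae X Y : {ae P, forall w, forall t, 0 <= t -> X t w = Y t w} ->
  cadlag_process P X -> cadlag_process P Y.
Proof.
move=> XY; apply: filterS2 XY => w XY [rX lX]; split=> [t t0|t t0].
  rewrite -XY //; apply: cvg_trans (rX _ t0).
  apply: near_eq_cvg; near=> s; apply: XY.
  by apply: (le_trans t0); apply: ltW; near: s; exact: nbhs_right_gt.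
have /cvg_ex[l Xl] := lX _ t0; apply/cvg_ex; exists l; apply: cvg_trans Xl.
apply: near_eq_cvg; near=> s; apply: XY.
by apply: ltW; near: s; exact: nbhs_left_gt.
Unshelve. all: by end_near.
Qed.

Lemma adapted_ae X Y : {ae P, forall w, forall t, 0 <= t -> X t w = Y t w} ->
  adapted F X -> adapted F Y.
Proof.
move=> XY aX t t0; apply: wrt_ae (aX t t0) => //.
by apply: filterS XY => w; exact.
Qed.

Lemma local_martingale_ae X Y : {ae P, forall w, forall t, 0 <= t -> X t w = Y t w} ->
  local_martingale P F X -> local_martingale P F Y.
Proof.
move=> XY [aX cX [tau [st lt mt]]]; split.
- exact: adapted_ae XY aX.
- exact: cadlag_ae XY cX.
- exists tau; split=> // n; apply: mart_ae (mt n) => t t0.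
  apply: filterS XY => w XY; rewrite /stopped; case: ifP => // _.
  by apply: XY; apply: fine_min_ge0 => //; exact: (st n).1.
Qed.

End StoppingTimes.

(** * Hitting times of continuous paths *)

Section HittingPaths.
Context {R : realType}.
Implicit Types (x : R -> R) (s t a b e : R).
Local Notation cpath x := ({within [set t : R | 0 <= t], continuous (x : R -> R)}).

Definition hit x a : \bar R := ereal_inf [set t%:E | t in [set t | 0 <= t /\ a <= `|x t|]].

Lemma hit_ge0 x a : (0 <= hit x a)%E.
Proof. by apply: le_ereal_inf_tmp => _ [t [t0 _] <-]; rewrite lee_fin. Qed.

Lemma cpath_max x b : 0 <= b -> cpath x -> exists2 c, 0 <= c <= b &
  forall t, 0 <= t <= b -> `|x t| <= `|x c|.
Proof.
move=> b0 cx.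
have cn : {within [set` `[0, b]], continuous (fun t => `|x t|)}.
  apply: continuous_subspaceW (cpath_norm cx) => t /=.
  by rewrite in_itv /= => /andP[].
have [c] := EVT_max b0 cn; rewrite in_itv /= => cb h; exists c => //.
Qed.

(** The infimum is attained: if the maximum of |x| over [0, t] is below [a], continuity at [t] keeps
    |x| below [a] a little beyond [t], which puts the hitting time strictly after [t]. *)
Lemma hit_leP x a t : cpath x -> 0 <= t ->
  (hit x a <= t%:E)%E <-> exists s, [/\ 0 <= s, s <= t & a <= `|x s|].
Proof.
move=> cx t0; split=> [hat|[s [s0 st xs]]]; last first.
  apply: (@le_trans _ _ s%:E); last by rewrite lee_fin.
  by apply: ereal_inf_lbound; exists s.
have [c /andP[c0 ct] cmax] := cpath_max t0 cx.
have [h|h] := ler_or_gtr a `|x c|; first by exists c.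
have d0 : 0 < a - `|x c| by rewrite subr_gt0.
have [dl dl0 hd] := (cpathP x).1 cx t t0 _ d0.
have : ((t + dl)%:E <= hit x a)%E; last first.
  by move=> /le_trans/(_ hat); rewrite lee_fin; lra.
apply: le_ereal_inf_tmp => _ [u [u0 xu] <-]; rewrite lee_fin leNgt; apply/negP => utd.
have [ut|tu] := ler_or_gtr u t.
  by have := cmax u; rewrite u0 ut => /(_ isT); lra.
have := hd u u0; rewrite distrC ger0_norm; last by lra.
move=> /(_ _)/lt_trans; have := cmax t; rewrite t0 lexx => /(_ isT) xt.
have h1 : `|x t - x u| < a - `|x c| by apply: hd => //; rewrite ler0_norm; lra.
by have := lerB_dist (x u) (x t); rewrite distrC => ? _; lra.
Qed.

(** Before the hitting time |x| is below [a], and at that time the bound persists by continuity from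
    the left. Positivity of the hitting time excludes the paths that start above [a]. *)
Lemma hit_bound x a t : cpath x -> 0 <= t -> (t%:E <= hit x a)%E -> (0 < hit x a)%E ->
  `|x t| <= a.
Proof.
move=> cx t0 th h0; have lt_hit u : 0 <= u -> (u%:E < hit x a)%E -> `|x u| < a.
  move=> u0 uh; rewrite ltNge; apply/negP => ax.
  have : (hit x a <= u%:E)%E by apply/hit_leP => //; exists u.
  by rewrite leNgt uh.
rewrite leNgt; apply/negP => ax.
have d0 : 0 < `|x t| - a by rewrite subr_gt0.
have [dl dl0 hd] := (cpathP x).1 cx t t0 _ d0.
pose u := Num.max 0 (t - dl / 2).
have u0 : 0 <= u by rewrite le_max lexx.
have [tE|tn0] := eqVneq t 0.
  by have := lt_hit t t0; rewrite tE => /(_ h0); rewrite -tE; lra.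
have tgt0 : 0 < t by rewrite lt_neqAle eq_sym tn0.
have ut : u < t by rewrite gt_max tgt0 /=; lra.
have xu : `|x u| < a by apply: lt_hit => //; apply: lt_le_trans th; rewrite lte_fin.
have : `|t - u| < dl.
  rewrite ger0_norm; last by lra.
  have : t - dl / 2 <= u by rewrite le_max lexx orbT.
  lra.
move=> /(hd u u0); have := lerB_dist (x t) (x u); lra.
Qed.

Lemma hit_mono x a b : a <= b -> (hit x a <= hit x b)%E.
Proof.
move=> ab; apply: ereal_inf_le_tmp => _ [t [t0 xt] <-]; exists t => //.
by split=> //; exact: le_trans xt.
Qed.

Lemma hit_large x b : cpath x -> 0 <= b -> exists a0, forall a, a0 < a -> (b%:E <= hit x a)%E.
Proof.
move=> cx b0; have [c _ cmax] := cpath_max b0 cx; exists `|x c| => a xa.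
rewrite leNgt; apply/negP => /ltW/(hit_leP _ cx b0)[s [s0 sb xs]].
by have := cmax s; rewrite s0 sb => /(_ isT); lra.
Qed.

Lemma grid_near t m s : 0 <= s -> s <= t -> exists2 i, (i <= m.+1)%N &
  `|s - grid 0 t m i| <= t / m.+1%:R.
Proof.
move=> s0 st; have t0 := le_trans s0 st.
have [k [km _ lk ek]] := @stopped_index _ (grid 0 t m) s id m.+1 (@grid_mono _ 0 t m t0).
exists k => //; have gk : s <= grid 0 t m k by case: ek => [->|//]; rewrite gridn.
have h0 : 0 <= t / m.+1%:R by rewrite divr_ge0.
case: k km lk ek gk => [|k] km lk ek gk.
  rewrite grid0 in gk *; have s00 : s = 0 by apply: le_anti; rewrite s0 gk.
  by rewrite s00 subrr normr0.
move: gk (lk k (ltnSn _)); rewrite grid_step subr0.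
move: (grid 0 t m k) (t / _) h0 => g mm h0 h1 h2.
by rewrite ler0_norm ?subr_le0 // opprB; lra.
Qed.

(** Countably many values decide the event, whence its measurability. A grid may miss the instant at
    which [a] is reached, so a slack 1/(k+1) is allowed; conversely the maximum over [0, t] beats
    every a - 1/(k+1). *)
Lemma hit_gridP x a t : cpath x -> 0 <= t ->
  (hit x a <= t%:E)%E <->
  forall k : nat, exists m i, (i <= m.+1)%N /\ a - k.+1%:R^-1 < `|x (grid 0 t m i)|.
Proof.
move=> cx t0; rewrite hit_leP //; split=> [[s [s0 st xs]] k|h].
  have k0 : 0 < k.+1%:R^-1 :> R by rewrite invr_gt0.
  have [dl dl0 hd] := (cpathP x).1 cx s s0 _ k0.
  have [m /= mesh] : exists m : nat, (t - 0) / m.+1%:R < dl.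
    by have [m _ /(_ m (leqnn m))] := grid_mesh 0 t dl0; exists m.
  have [i im hi] := grid_near m s0 st; exists m, i; split=> //.
  have g0 : 0 <= grid 0 t m i by rewrite -{1}(grid0 0 t m) grid_mono.
  have := hd _ g0 (le_lt_trans hi _); rewrite subr0 in mesh.
  move=> /(_ mesh); have := lerB_dist (x s) (x (grid 0 t m i)).
  by move: k.+1%:R^-1 => ik h1 h2; lra.
have [c /andP[c0 ct] cmax] := cpath_max t0 cx; exists c; split=> //.
apply/ler_addgt0Pr => e e0.
have [k ke] : exists k : nat, k.+1%:R^-1 < e.
  by have [k _ /(_ k (leqnn k))] := grid_mesh 0 1 e0; rewrite subr0 div1r => ?; exists k.
have [m [i [im hi]]] := h k.
have gi : 0 <= grid 0 t m i <= t.
  apply/andP; split; first by rewrite -{1}(grid0 0 t m) grid_mono.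
  by rewrite -{2}(gridn 0 t m) grid_mono.
have := cmax _ gi; move: k.+1%:R^-1 ke hi => ik h1 h2 h3; lra.
Qed.

End HittingPaths.

(** * Localizing sequences *)

Section Localization.
Context {R : realType} {d : measure_display} {T : measurableType d}.
Variables (P : probability T R) (F : R -> set (set T)).
Hypothesis FP : usual_filtration P F.
Implicit Types (s t u c lm K : R) (f g : T -> R) (A B : set T) (X Y : R -> T -> R)
  (tau sigma : T -> \bar R).
Local Notation cpath x := ({within [set t : R | 0 <= t], continuous (x : R -> R)}).

Lemma hit_stopping X a : adapted F X -> (forall w, cpath (X ^~ w)) ->
  stopping_time F (fun w => hit (X ^~ w) a).
Proof.
move=> aX cX; split=> [w|t t0]; first exact: hit_ge0.
have sF := filtration_sigma FP t0.
have -> : [set w | (hit (X ^~ w) a <= t%:E)%E] =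
   \bigcap_k \bigcup_m \bigcup_i (if (i <= m.+1)%N then
     [set w | a - k.+1%:R^-1 < `|X (grid 0 t m i) w|] else set0).
  apply/seteqP; split=> w /=.
    move=> /(hit_gridP _ (cX w) t0) h k _; have [m [i [im hi]]] := h k.
    by exists m => //; exists i => //; rewrite im.
  move=> h; apply/(hit_gridP _ (cX w) t0) => k; have [m _ [i _]] := h k I.
  by case: ifP => // im hi; exists m, i.
apply: (wrt_bigcap sF) => k; apply: (wrt_bigcup sF) => m; apply: (wrt_bigcup sF) => i.
case: ifP => im; last exact: (wrt0 sF).
have g0 : 0 <= grid 0 t m i by rewrite -{1}(grid0 0 t m) grid_mono.
apply: (wrt_lt sF); first exact: wrt_cst.
apply: (wrt_norm sF); apply: (wrt_mono FP g0); last exact: aX.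
by rewrite -{2}(gridn 0 t m) grid_mono.
Qed.

(** The hitting time bounds the stopped process by [n]; the constant [n] makes it constant after
    time [n], so that its value at time [n] controls all later ones. *)
Definition loc (rho : nat -> T -> \bar R) X (n : nat) (w : T) : \bar R :=
  Order.min (rho n w) (Order.min (hit (X ^~ w) n%:R) n%:R%:E).

Section Loc.
Variables (rho : nat -> T -> \bar R) (X : R -> T -> R).
Hypothesis rho_st : forall n, stopping_time F (rho n).
Hypothesis aX : adapted F X.
Hypothesis cX : forall w, cpath (X ^~ w).

Lemma loc_stopping n : stopping_time F (loc rho X n).
Proof.
apply: (stopping_min FP) => //; apply: (stopping_min FP); first exact: hit_stopping.
by apply: (stopping_cst FP).
Qed.

Lemma loc_mono w : nondecreasing_seq (rho ^~ w) -> nondecreasing_seq (loc rho X ^~ w).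
Proof.
move=> rm m n mn; rewrite /loc !le_min !ge_min rm //= lee_fin ler_nat mn !orbT andbT.
by rewrite hit_mono ?orbT // ler_nat.
Qed.

Lemma loc_cvg w : rho n w @[n --> \oo] --> +oo%E -> loc rho X n w @[n --> \oo] --> +oo%E.
Proof.
move=> /cvgeyPge rc; apply/cvgeyPge => b; pose b' := Num.max b 0.
have b0 : 0 <= b' by rewrite le_max lexx orbT.
have bb : (b%:E <= b'%:E)%E by rewrite lee_fin le_max lexx.
have [a0 ha] := hit_large (@cX w) b0.
near=> n; apply: (le_trans bb); rewrite /loc !le_min; apply/and3P; split.
- by near: n; exact: rc.
- apply: ha; near: n; exists (Num.truncn a0).+1 => // n /= hn.
  by rewrite (lt_le_trans (truncnS_gt _)) // ler_nat.
- rewrite lee_fin; near: n; exists (Num.truncn b').+1 => // n /= hn.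
  by rewrite ltW // (lt_le_trans (truncnS_gt _)) // ler_nat.
Unshelve. all: by end_near.
Qed.

Lemma loc_bound n t w : 0 <= t -> (0 < loc rho X n w)%E ->
  `|X (fine (Order.min t%:E (loc rho X n w))) w| <= n%:R.
Proof.
move=> t0 l0; have l0' := ltW l0; apply: (hit_bound (@cX w)).
- exact: fine_min_ge0.
- by rewrite fine_minE // /loc !ge_min lexx !orbT.
- by rewrite (lt_le_trans l0) // /loc !ge_min lexx !orbT.
Qed.

Lemma loc_le n w : (loc rho X n w <= n%:R%:E)%E.
Proof. by rewrite /loc !ge_min lexx !orbT. Qed.

End Loc.
End Localization.
(** * Sign changes *)

(* Hysteresis between the levels 0 and eps. *)
Fixpoint above {R : realType} (eps : R) (mu : nat -> R) (i : nat) : bool :=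
  if i is j.+1 then (eps <= mu i) || above eps mu j && (0 < mu i) else eps <= mu 0%N.

Section Crossings.
Context {R : realType}.
Implicit Types (M D Z : R -> R) (s t e K eps : R) (mu : nat -> R).
Local Notation cpath x := ({within [set t : R | 0 <= t], continuous (x : R -> R)}).

Lemma above_gt0 eps mu i : 0 < eps -> above eps mu i -> 0 < mu i.
Proof.
by move=> e0; case: i => [|i] /=; [|case/orP => [|/andP[]//]]; exact: lt_le_trans.
Qed.

Lemma above_lt eps mu i : ~~ above eps mu i -> mu i < eps.
Proof. by case: i => [|i] /=; rewrite ?negb_or -ltNge // => /andP[]. Qed.

(* The jumps of the strategy that holds Z while [above] and eps * D otherwise:
   they are small because Z = M D is close to eps * D when M crosses eps, and D
   (hence Z) is close to 0 when M crosses 0. *)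
Definition crossing_err M D Z s t eps n : R :=
  let g := grid s t n in let u i := above eps (fun j => M (g j)) i in
  \sum_(i < n.+1) ((u i.+1)%:R - (u i)%:R) * (Z (g i.+1) - eps * D (g i.+1)).

(** The number of switches is bounded by a constant of the path, and each costs at most et (K + 2
    eps), where [et] can be taken arbitrarily small once the mesh is fine. *)
Lemma crossing_err_cvg M D Z s t eps K : cpath M -> cpath D ->
  0 <= s -> s <= t -> 0 < eps ->
  (forall r, 0 <= r -> `|D r| <= K) ->
  (forall r, 0 <= r -> `|Z r| = `|M r * D r|) ->
  (forall r, 0 <= r -> 0 < M r -> Z r = M r * D r) ->
  (forall r, 0 <= r -> M r = 0 -> D r = 0) ->
  crossing_err M D Z s t eps n @[n --> \oo] --> 0.
Proof.
move=> cM cD s0 st e0 DK ZMD Zpos MD0.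
have K0 : 0 <= K by rewrite (le_trans _ (DK s s0)).
have [d1 d10 hd1] := cpath_unif t cM e0.
(* Bound for the number of switches: one, plus the number of gaps of length [d1] that fit into
   [s, t]. *)
pose N0 := 1 + (t - s) / d1.
have N00 : 0 < N0 by rewrite ltr_wpDr // divr_ge0 ?subr_ge0 // ltW.
apply/cvgrPdist_le => e egt0.
have C0 : 0 < N0 * (K + 2 * eps) + 1.
  by rewrite ltr_wpDl // mulr_ge0 ?ltW //; lra.
pose et := e / (N0 * (K + 2 * eps) + 1).
have et0 : 0 < et by rewrite divr_gt0.
have [d2 d20 hd2] := cpath_unif t cM et0.
have [d3 d30 hd3] := cpath_unif t cD et0.
near=> n; have m1 : (t - s) / n.+1%:R < d1 by near: n; exact: grid_mesh.
have m2 : (t - s) / n.+1%:R < d2 by near: n; exact: grid_mesh.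
have m3 : (t - s) / n.+1%:R < d3 by near: n; exact: grid_mesh.
rewrite sub0r normrN.
pose g := grid s t n; pose mu j := M (g j); pose u i := above eps mu i.
have gmono := @grid_mono _ s t n st.
have sg i : s <= g i by rewrite -{1}(grid0 s t n) gmono.
have g0 i : 0 <= g i by exact: le_trans (sg i).
have gt i : (i <= n.+1)%N -> g i <= t by move=> h; rewrite -(gridn s t n) gmono.
have gS i : `|g i - g i.+1| = (t - s) / n.+1%:R.
  rewrite /g grid_step opprD addrA subrr sub0r normrN ger0_norm //.
  by rewrite divr_ge0 // subr_ge0.
pose c i : R := \sum_(j < i) `|(u j.+1)%:R - (u j)%:R|.
(* Two consecutive changes of state are at least d1 apart. *)
have count i : (i <= n.+1)%N -> c i = 0 \/ exists k, [/\ (k <= i)%N,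
     c i <= 1 + (g k - s) / d1 & if u i then eps <= mu k else mu k <= 0].
  elim: i => [|i IH] i_n; first by left; rewrite /c big_ord0.
  have cS : c i.+1 = c i + `|(u i.+1)%:R - (u i)%:R| by rewrite /c big_ord_recr.
  have [uE|uN] := eqVneq (u i.+1) (u i).
    have cE : c i.+1 = c i by rewrite cS uE subrr normr0 addr0.
    rewrite cE uE; case: (IH (ltnW i_n)) => [->|[k [ki ck mk]]]; first by left.
    by right; exists k; split=> //; exact: leqW.
  have c1 : c i.+1 = c i + 1.
    by rewrite cS; case: (u i.+1) uN; case: (u i) => //= _; rewrite ?subr0 ?sub0r ?normrN normr1.
  have mk : if u i.+1 then eps <= mu i.+1 else mu i.+1 <= 0.
    move: uN; rewrite /u /=; case: (leP eps (mu i.+1)) => //= _.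
    by case: (above eps mu i) => //=; case: (ltP 0 (mu i.+1)).
  right; exists i.+1; split=> //; rewrite c1.
  case: (IH (ltnW i_n)) => [->|[k [ki ck mk']]].
    by rewrite add0r lerDl divr_ge0 ?subr_ge0 // ltW.
  have gap : d1 <= g i.+1 - g k.
    rewrite leNgt; apply/negP => h.
    have h1 : `|mu i.+1 - mu k| < eps.
      apply: hd1 => //; [exact: gt|by apply: gt; rewrite (leq_trans ki) // ltnW|].
      by rewrite ger0_norm // subr_ge0 gmono // leqW.
    have := ler_norm (mu i.+1 - mu k); have := ler_norm (mu k - mu i.+1).
    rewrite distrC; move: uN mk mk'; case: (u i.+1); case: (u i) => //= _; lra.
  have : 1 <= (g i.+1 - g k) / d1 by rewrite ler_pdivlMr ?mul1r.
  by move: ck; rewrite !mulrBl; lra.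
have cN : c n.+1 <= N0.
  case: (count n.+1 (leqnn _)) => [->|[k [kn ck _]]]; first exact: ltW.
  apply: (le_trans ck); rewrite lerD2l ler_wpM2r ?invr_ge0 ?(ltW d10) //.
  by rewrite lerD2r gt.
have step i : (i < n.+1)%N ->
    `|((u i.+1)%:R - (u i)%:R) * (Z (g i.+1) - eps * D (g i.+1))| <=
    `|(u i.+1)%:R - (u i)%:R| * (et * (K + 2 * eps)).
  move=> i_n; rewrite normrM.
  have dM : `|mu i - mu i.+1| < et.
    by apply: hd2 => //; [apply: gt; exact: ltnW|exact: gt|rewrite gS].
  have dM1 : `|mu i - mu i.+1| < eps.
    by apply: hd1 => //; [apply: gt; exact: ltnW|exact: gt|rewrite gS].
  have [uE|uN] := eqVneq (u i.+1) (u i); first by rewrite uE subrr normr0 !mul0r.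
  apply: ler_wpM2l => //; case: (boolP (u i.+1)) uN => ui1 uN.
    have ui : ~~ u i by case: (u i) uN.
    have mui := above_lt ui; have mu1 := above_gt0 e0 ui1.
    have mu1e : eps <= mu i.+1.
      by move: ui1; rewrite /u /=; move: ui; rewrite /u; case: (above eps mu i) => //=; rewrite orbF.
    (* Switching up: Z - eps D = (M - eps) D, and M has just passed eps by less than [et]. *)
    rewrite Zpos // -mulrBl normrM ler_pM //.
      rewrite ger0_norm ?subr_ge0 //; have := ler_norm (mu i.+1 - mu i).
      by rewrite distrC /mu in mui dM *; lra.
    by rewrite (le_trans (DK _ _)) //; lra.
  have ui : u i by case: (u i) uN.
  have mui := above_gt0 e0 ui.
  have mu1 : mu i.+1 <= 0.
    by move: ui1; rewrite /u /=; move: ui; rewrite /u => -> /=; rewrite negb_or => /andP[_]; rewrite -leNgt.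
  (* Switching down: M vanishes somewhere in the step, hence so does D, and D is smaller than [et]
     at the end of the step, where |M| < eps. Thus |Z| + eps |D| is at most 2 eps et. *)
  have cM' : {within [set` `[g i, g i.+1]], continuous M}.
    apply: continuous_subspaceW cM => r /=; rewrite in_itv /= => /andP[gr _].
    exact: le_trans gr.
  have [|r] := @IVT _ M (g i) (g i.+1) 0 (gmono _ _ (leqnSn i)) cM'.
    by rewrite ge_min le_max mu1 (ltW mui) orbT.
  rewrite in_itv /= => /andP[gr rg] Mr.
  have r0 : 0 <= r by exact: le_trans gr.
  have Dr := MD0 r r0 Mr.
  have dD : `|D (g i.+1)| < et.
    have := hd3 (g i.+1) r (g0 _) (gt _ i_n) r0 (le_trans rg (gt _ i_n)).
    rewrite Dr subr0; apply; rewrite ger0_norm ?subr_ge0 //.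
    have := gS i; rewrite ler0_norm ?subr_le0 ?gmono // => h.
    by apply: le_lt_trans m3; rewrite -h; lra.
  rewrite (le_trans (ler_normB _ _)) // ZMD // !normrM -mulrDl mulrC.
  apply: ler_pM => //; [exact: ltW|].
  rewrite (ger0_norm (ltW e0)).
  have -> : `|M (g i.+1)| = - mu i.+1 by exact: ler0_norm.
  by have hm := ler_norm (mu i - mu i.+1); lra.
rewrite /crossing_err -/g -/mu.
apply: (le_trans (ler_norm_sum _ _ _)).
apply: (@le_trans _ _ (c n.+1 * (et * (K + 2 * eps)))).
  by rewrite mulr_suml; apply: ler_sum => i _; exact: step.
apply: (@le_trans _ _ (N0 * (et * (K + 2 * eps)))).
  by rewrite ler_wpM2r // mulr_ge0 ?ltW //; lra.
rewrite mulrCA /et mulrAC ler_pdivrMr // ler_pM2l //; lra.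
Unshelve. all: by end_near.
Qed.

End Crossings.

(** * The martingale M^+ D *)

Section PositivePart.
Context {R : realType} {d : measure_display} {T : measurableType d}.
Variables (P : probability T R) (F : R -> set (set T)).
Hypothesis FP : usual_filtration P F.
Implicit Types (s t u c lm K eps : R) (f g : T -> R) (A B : set T).
Local Notation E := (Rintegral P [set: T]).
Local Notation L1 f := (P.-integrable [set: T] (EFin \o f)).
Local Notation cpath x := ({within [set t : R | 0 <= t], continuous (x : R -> R)}).

(** From |f| <= min(|f|, L) + f^2 / L: the first term is handled by dominated convergence, the
    second contributes at most C / L, which the choice of [L] keeps below e / 2. *)
Lemma cvg_E_norm_L2 (f_ : nat -> T -> R) C :
  (forall n, measurable_fun [set: T] (f_ n)) -> (forall n, L1 (f_ n)) ->
  (forall n, L1 (fun w => f_ n w ^+ 2)) -> (forall n, E (fun w => f_ n w ^+ 2) <= C) ->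
  (forall w, f_ n w @[n --> \oo] --> 0) ->
  E (fun w => `|f_ n w|) @[n --> \oo] --> 0.
Proof.
move=> mf If If2 fC cf.
have C0 : 0 <= C by apply: le_trans (fC 0%N); apply: E_ge0 => w; exact: sqr_ge0.
apply/cvgrPdist_le => e e0; pose L := 2 * (C + 1) / e.
have L0 : 0 < L by rewrite divr_gt0 // mulr_gt0 //; lra.
have mm n : measurable_fun [set: T] (fun w => Num.min `|f_ n w| L).
  by apply: measurable_minr => //; apply: measurableT_comp.
have [_ cm] : L1 (fun=> 0 : R) /\ E (fun w => Num.min `|f_ n w| L) @[n --> \oo] --> E (fun=> 0).
  apply: (@E_dct _ _ _ P _ _ (fun=> L)) => //.
  - exact: L1_cst.
  - by move=> n w; rewrite ger0_norm ?ge_min ?lexx ?orbT // le_min normr_ge0 ltW.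
  - apply: aeW => w; apply/cvgrPdist_lt => k k0; have /cvgrPdist_lt /(_ k k0) := cf w.
    apply: filterS => n; rewrite !sub0r !normrN => h.
    by rewrite ger0_norm ?gt_min ?h // le_min normr_ge0 ltW.
rewrite E_cst in cm.
have e2 : 0 < e / 2 by lra.
move/cvgrPdist_lt: cm => /(_ _ e2); apply: filterS => n; rewrite !sub0r !normrN => h.
rewrite ger0_norm; last exact: E_ge0.
have Im : L1 (fun w => Num.min `|f_ n w| L).
  apply: (@L1_bounded _ _ _ P _ L) => // w.
  by rewrite ger0_norm ?ge_min ?lexx ?orbT // le_min normr_ge0 ltW.
have : E (fun w => `|f_ n w|) <= E (fun w => Num.min `|f_ n w| L + L^-1 * f_ n w ^+ 2).
  apply: E_le; [exact: L1_norm|by apply: L1D => //; exact: L1Z|move=> w].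
  have [h1|h1] := ler_or_gtr `|f_ n w| L.
    by rewrite (min_idPl h1) lerDl mulr_ge0 ?sqr_ge0 // invr_ge0 ltW.
  rewrite (min_idPr (ltW h1)) -[f_ n w ^+ 2]ger0_norm ?sqr_ge0 // normrX.
  have : `|f_ n w| <= L^-1 * `|f_ n w| ^+ 2.
    by rewrite expr2 mulrA ler_peMl // mulrC ler_pdivlMr // mul1r ltW.
  by move: L0; lra.
rewrite E_D ?E_Z //; last exact: L1Z.
have : L^-1 * E (fun w => f_ n w ^+ 2) <= e / 2.
  rewrite mulrC ler_pdivrMr // /L.
  have -> : e / 2 * (2 * (C + 1) / e) = C + 1 by field; lra.
  by have := fC n; lra.
have := ler_norm (E (fun w => Num.min `|f_ n w| L)); lra.
Qed.

Section Fixed.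
Variables (M D Z : R -> T -> R) (K : R).
Hypothesis K0 : 0 <= K.
Hypothesis aM : adapted F M.
Hypothesis cM : forall w, cpath (M ^~ w).
Hypothesis cD : forall w, cpath (D ^~ w).
Hypothesis mD : martingale P F D.
Hypothesis mZ : martingale P F Z.
Hypothesis DK : forall t w, 0 <= t -> `|D t w| <= K.
Hypothesis ZK : forall t w, 0 <= t -> `|Z t w| <= K.
Hypothesis ZMD : forall t w, 0 <= t -> `|Z t w| = `|M t w * D t w|.
Hypothesis Zpos : forall t w, 0 <= t -> 0 < M t w -> Z t w = M t w * D t w.
Hypothesis MD0 : forall t w, 0 <= t -> M t w = 0 -> D t w = 0.

Let Y t w := Num.max (M t w) 0 * D t w.

(** [M] has no bound of its own, but [Y] is [Z] wherever M > 0 and 0 elsewhere. *)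
Let normY t w : 0 <= t -> `|Y t w| <= K.
Proof.
move=> t0; rewrite /Y; have [h|h] := ler_or_gtr (M t w) 0.
  by rewrite (max_idPr h) mul0r normr0 (le_trans _ (DK w t0)).
by rewrite (max_idPl (ltW h)) -Zpos // ZK.
Qed.

Let aY : adapted F Y.
Proof.
have [aD _ _] := mD; move=> t t0; have sF := filtration_sigma FP t0.
by apply: (wrtM sF); [apply: (wrt_max sF); [exact: aM|exact: wrt_cst]|exact: aD].
Qed.

Section Approx.
Variables (s t eps : R) (n : nat).
Hypothesis s0 : 0 <= s.
Hypothesis st : s <= t.
Hypothesis e0 : 0 < eps.

Let g := grid s t n.
Let u i w := above eps (fun j => M (g j) w) i.
Let gmono : {homo g : i j / (i <= j)%N >-> i <= j}. Proof. exact: grid_mono. Qed.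
Let g00 : 0 <= g 0%N. Proof. by rewrite /g grid0. Qed.
Let g0 i : 0 <= g i. Proof. by apply: (le_trans g00); exact: gmono. Qed.

Let Fu i : F (g i) [set w | u i w].
Proof.
have sF j := filtration_sigma FP (g0 j).
elim: i => [|i IH] /=.
  by apply: (wrt_le (sF 0%N)); [exact: wrt_cst|exact: aM].
have -> : [set w | u i.+1 w] = [set w | eps <= M (g i.+1) w] `|`
    ([set w | u i w] `&` [set w | 0 < M (g i.+1) w]).
  apply/seteqP; split=> w; rewrite /u /=.
    by move=> /orP[h|/andP[h1 h2]]; [left|right].
  by move=> [h|[h1 h2]]; apply/orP; [left|right; apply/andP].
apply: (wrtU (sF _)); first by apply: (wrt_le (sF _)); [exact: wrt_cst|exact: aM].
apply: (wrtI (sF _)); first exact: (filtration_mono FP (g0 i) (gmono (leqnSn i))).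
by apply: (wrt_lt (sF _)); [exact: wrt_cst|exact: aM].
Qed.

Let mu i : measurable_wrt (F (g i)) (fun w => (u i w)%:R : R).
Proof.
have sF := filtration_sigma FP (g0 i).
rewrite (_ : (fun w => _) = \1_[set w | u i w]); first exact: wrt_indic.
by apply/funext => w; rewrite indicb.
Qed.

Let mu' i : measurable_wrt (F (g i)) (fun w => 1 - (u i w)%:R : R).
Proof.
have sF := filtration_sigma FP (g0 i).
by apply: (wrtB sF) => //; exact: wrt_cst.
Qed.

Let u1 i w : `|(u i w)%:R : R| <= 1.
Proof. by case: (u i w); rewrite ?normr0 ?normr1. Qed.

Let u1' i w : `|1 - (u i w)%:R : R| <= 1.
Proof. by case: (u i w); rewrite ?subrr ?subr0 ?normr0 ?normr1. Qed.

Let Phi i w := (u i w)%:R * Z (g i) w + (1 - (u i w)%:R) * (eps * D (g i) w).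
Let G1 := transform (fun i w => (u i w)%:R) Z g.
Let G2 := transform (fun i w => 1 - (u i w)%:R) D g.
Let Err w := crossing_err (M ^~ w) (D ^~ w) (Z ^~ w) s t eps n.

(** Summation by parts: the change of [Phi] in one step is the gain of the position held at its
    start plus the jump caused by changing position at its end. *)
Let Phi_decomp w : Phi n.+1 w - Phi 0%N w = G1 n.+1 w + eps * G2 n.+1 w + Err w.
Proof.
rewrite /Err /crossing_err -/g /G1 /G2.
elim: n.+1 => [|m IH]; first by rewrite /transform !big_ord0 subrr mulr0 !addr0.
rewrite !transformS big_ord_recr /=.
transitivity (Phi m.+1 w - Phi m w + (Phi m w - Phi 0%N w)); first by ring.
by rewrite IH /Phi /u; ring.
Qed.

(** While the position is on, M > 0 and [Phi] is exactly [Y]; otherwise M < eps, so that eps and M^+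
    differ by at most eps. *)
Let PhiY i w : `|Phi i w - Y (g i) w| <= eps * K.
Proof.
rewrite /Phi /Y; case: (boolP (u i w)) => ui.
  have h := above_gt0 e0 ui; rewrite subrr mul0r addr0 mul1r Zpos //.
  rewrite (max_idPl (ltW h)) subrr normr0 mulr_ge0 // ltW //.
have h := above_lt ui; rewrite subr0 mul0r add0r mul1r -mulrBl normrM.
apply: ler_pM => //; last exact: DK.
rewrite ger0_norm ?lerBlDr ?lerDl ?le_max ?lexx ?orbT // subr_ge0 ge_max (ltW e0) andbT.
exact: ltW.
Qed.

Let PhiK i w : `|Phi i w| <= K + eps * K.
Proof.
rewrite -(subrK (Y (g i) w) (Phi i w)) (le_trans (ler_normD _ _)) // addrC.
by apply: lerD; [exact: normY|exact: PhiY].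
Qed.

Let mPhi i : measurable_wrt (F (g i)) (Phi i).
Proof.
have [aD _ _] := mD; have [aZ _ _] := mZ; have sF := filtration_sigma FP (g0 i).
apply: (wrtD sF); apply: (wrtM sF) => //; first exact: aZ.
by apply: (wrtM sF); [exact: wrt_cst|exact: aD].
Qed.

Let mErr : measurable_fun [set: T] Err.
Proof.
rewrite (_ : Err = fun w => Phi n.+1 w - Phi 0%N w - (G1 n.+1 w + eps * G2 n.+1 w)); last first.
  by apply/funext => w; rewrite Phi_decomp; ring.
have [aD _ _] := mD; have [aZ _ _] := mZ.
have mG1 := wrt_measurable FP (g0 n.+1) (transform_wrt FP n.+1 aZ gmono g00 mu).
have mG2 := wrt_measurable FP (g0 n.+1) (transform_wrt FP n.+1 aD gmono g00 mu').
apply: measurable_funB.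
  by apply: measurable_funB; exact: (wrt_measurable FP (g0 _) (mPhi _)).
by apply: measurable_funD => //; apply: measurable_funM.
Qed.

(** This bound grows with [n] and gives integrability only; the control uniform in [n] is
    [crossing_err_L2]. *)
Let ErrB w : `|Err w| <= 2 * (K + eps * K) + n.+1%:R * (K + K) + eps * (n.+1%:R * (K + K)).
Proof.
have -> : Err w = Phi n.+1 w - Phi 0%N w - (G1 n.+1 w + eps * G2 n.+1 w).
  by rewrite Phi_decomp; ring.
have h1 := PhiK n.+1 w; have h2 := PhiK 0%N w.
have h3 : `|G1 n.+1 w| <= n.+1%:R * (K + K).
  by apply: (transform_bounded gmono g00) => // r w'; exact: ZK.
have h4 : `|G2 n.+1 w| <= n.+1%:R * (K + K).
  by apply: (transform_bounded gmono g00) => // r w'; exact: DK.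
have h5 : `|eps * G2 n.+1 w| <= eps * (n.+1%:R * (K + K)).
  by rewrite normrM (ger0_norm (ltW e0)) ler_wpM2l // ltW.
move: h1 h2 h3 h5; move: (n.+1%:R * (K + K)) (eps * _) => p q.
rewrite !ler_norml => /andP[? ?] /andP[? ?] /andP[? ?] /andP[? ?]; apply/andP; split; lra.
Qed.

Lemma crossing_err_L1 : L1 Err.
Proof. exact: (L1_bounded P mErr ErrB). Qed.

Lemma crossing_err_L1_sqr : L1 (fun w => Err w ^+ 2).
Proof.
have := L1_mul_bounded crossing_err_L1 mErr ErrB.
by congr (is_true (integrable _ _ _)); apply/funext => w /=; rewrite expr2.
Qed.

Lemma crossing_err_meas : measurable_fun [set: T] Err.
Proof. exact: mErr. Qed.

(** [Err] is a combination of four terms: two values of [Phi], bounded by K + eps K, and two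
    transforms, whose second moments are at most K^2 by [transform_L2]. No term sees the number of
    steps. *)
Lemma crossing_err_L2 :
  E (fun w => Err w ^+ 2) <= 4 * (2 * (K + eps * K) ^+ 2 + K ^+ 2 + eps ^+ 2 * K ^+ 2).
Proof.
have sqrB x b : `|x| <= b -> x ^+ 2 <= b ^+ 2 :> R.
  by move=> h; rewrite -[x ^+ 2]ger0_norm ?sqr_ge0 // normrX ler_pXn2r // nnegrE (le_trans _ h).
have trB (X : R -> T -> R) (h : nat -> T -> R) : martingale P F X ->
    (forall r w, 0 <= r -> `|X r w| <= K) ->
    (forall i, measurable_wrt (F (g i)) (h i)) -> (forall i w, `|h i w| <= 1) ->
    L1 (fun w => transform h X g n.+1 w ^+ 2) /\ E (fun w => transform h X g n.+1 w ^+ 2) <= K ^+ 2.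
  move=> mX XK mh h1; have [aX _ _] := mX.
  have bT := transform_bounded gmono g00 h1 XK n.+1.
  have mT := wrt_measurable FP (g0 n.+1) (transform_wrt FP n.+1 aX gmono g00 mh).
  split.
    have := L1_mul_bounded (L1_bounded P mT bT) mT bT.
    by congr (is_true (integrable _ _ _)); apply/funext => w /=; rewrite expr2.
  apply: (le_trans (transform_L2 FP mX gmono g00 mh h1 XK n.+1)).
  have h2 : 0 <= E (fun w => X (g 0%N) w ^+ 2) by apply: E_ge0 => w; exact: sqr_ge0.
  have h3 : E (fun w => X (g n.+1) w ^+ 2) <= K ^+ 2.
    rewrite -[leRHS](E_cst P); apply: E_le; last by move=> w; apply: sqrB; exact: XK.
      have mXg := wrt_measurable FP (g0 n.+1) (aX _ (g0 _)).
      have XKg w := XK _ w (g0 n.+1).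
      have := L1_mul_bounded (L1_bounded P mXg XKg) mXg XKg.
      by congr (is_true (integrable _ _ _)); apply/funext => w /=; rewrite expr2.
    exact: L1_cst.
  lra.
have [I1 E1] := trB Z _ mZ (fun r w => @ZK r w) mu u1.
have [I2 E2] := trB D _ mD (fun r w => @DK r w) mu' u1'.
rewrite -/(G1 n.+1) in I1 E1; rewrite -/(G2 n.+1) in I2 E2.
pose b2 := 2 * (K + eps * K) ^+ 2.
apply: (@le_trans _ _ (E (fun w => 4 * (b2 + G1 n.+1 w ^+ 2 + eps ^+ 2 * G2 n.+1 w ^+ 2)))).
  have Ib : L1 (fun w => b2 + G1 n.+1 w ^+ 2 + eps ^+ 2 * G2 n.+1 w ^+ 2).
    by apply: L1D; [apply: L1D => //; exact: L1_cst|exact: L1Z].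
  apply: E_le; [exact: crossing_err_L1_sqr|exact: L1Z|move=> w].
  have -> : Err w = Phi n.+1 w - Phi 0%N w - G1 n.+1 w - eps * G2 n.+1 w.
    by rewrite Phi_decomp; ring.
  have h1 := sqrB _ _ (PhiK n.+1 w); have h2 := sqrB _ _ (PhiK 0%N w).
  rewrite /b2 -[eps ^+ 2 * _]exprMn.
  move: (Phi n.+1 w) (Phi 0%N w) (G1 n.+1 w) (eps * G2 n.+1 w) (K + eps * K) h1 h2.
  move=> a b c e k h1 h2.
  (* These six squares sum to 4 (a^2 + b^2 + c^2 + e^2) - (a - b - c - e)^2. *)
  have : 0 <= (a + b) ^+ 2 + (a + c) ^+ 2 + (a + e) ^+ 2 + (b - c) ^+ 2 + (b - e) ^+ 2 + (c - e) ^+ 2.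
    by rewrite !addr_ge0 ?sqr_ge0.
  move: h1 h2; rewrite !expr2; lra.
have Ibg := L1D (L1_cst P b2) I1; have Ig2 := L1Z (eps ^+ 2) I2.
rewrite (E_Z 4 (L1D Ibg Ig2)) (E_D Ibg Ig2) (E_D (L1_cst P b2) I1) (E_Z _ I2) E_cst.
rewrite ler_pM2l // /b2; have : eps ^+ 2 * E (fun w => G2 n.+1 w ^+ 2) <= eps ^+ 2 * K ^+ 2.
  by rewrite ler_wpM2l // sqr_ge0.
lra.
Qed.

(** Replacing [Y] by [Phi] at both ends costs eps K each; of the increment of [Phi] the two
    transforms have mean 0 on [A], which leaves [Err]. *)
Lemma crossing_approx A : F s A ->
  `|E (fun w => \1_A w * Y t w) - E (fun w => \1_A w * Y s w)| <=
  2 * (eps * K) + E (fun w => `|Err w|).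
Proof.
move=> FA; have mA := filt_measurable FP s0 FA; have t0 := le_trans s0 st.
have LY r : 0 <= r -> L1 (fun w => \1_A w * Y r w).
  move=> r0; apply: L1_indic => //; apply: (L1_bounded P (wrt_measurable FP r0 (aY r0))).
  by move=> w; exact: normY.
have FA' : F (g 0%N) A by rewrite /g grid0.
have E1 := transform_mean FP mZ gmono g00 mu u1 n.+1 FA'.
have E2 := transform_mean FP mD gmono g00 mu' u1' n.+1 FA'.
have I1 := L1_indic mA (transform_L1 FP mZ gmono g00 mu u1 n.+1).
have I2 := L1_indic mA (transform_L1 FP mD gmono g00 mu' u1' n.+1).
have I3 := L1_indic mA crossing_err_L1.
have -> : E (fun w => \1_A w * Y t w) - E (fun w => \1_A w * Y s w) =
    E (fun w => \1_A w * (Y t w - Y s w - G1 n.+1 w - eps * G2 n.+1 w)).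
  transitivity (E (fun w => \1_A w * Y t w - \1_A w * Y s w -
     (\1_A w * G1 n.+1 w + eps * (\1_A w * G2 n.+1 w)))); last by apply: E_ext => w; ring.
  rewrite E_B; [|by apply: L1B; exact: LY|by apply: L1D => //; exact: L1Z].
  rewrite E_B ?LY // E_D ?E_Z //; last exact: L1Z.
  by rewrite E1 E2 mulr0 addr0 subr0.
have pw w : `|\1_A w * (Y t w - Y s w - G1 n.+1 w - eps * G2 n.+1 w)| <=
    2 * (eps * K) + `|Err w|.
  rewrite normrM; apply: (@le_trans _ _ `|Y t w - Y s w - G1 n.+1 w - eps * G2 n.+1 w|).
    by rewrite ler_piMl // norm_indic_le1.
  have -> : Y t w - Y s w - G1 n.+1 w - eps * G2 n.+1 w =
     (Y t w - Phi n.+1 w) + (Phi 0%N w - Y s w) + Err w.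
    by have := Phi_decomp w; lra.
  have h1 := PhiY n.+1 w; have h2 := PhiY 0%N w.
  rewrite /g gridn in h1; rewrite /g grid0 in h2.
  rewrite distrC in h1.
  apply: (le_trans (ler_normD _ _)); rewrite lerD2r.
  by apply: (le_trans (ler_normD _ _)); lra.
have Iint : L1 (fun w => \1_A w * (Y t w - Y s w - G1 n.+1 w - eps * G2 n.+1 w)).
  have := L1B (L1B (LY t t0) (LY s s0)) (L1D I1 (L1Z eps I2)).
  by congr (is_true (integrable _ _ _)); apply/funext => w /=; congr (_%:E); rewrite -/(G1 _) -/(G2 _); ring.
have IE := L1_norm crossing_err_L1.
apply: (le_trans (E_abs Iint)).
rewrite -[X in X + _](E_cst P) -E_D //; last exact: L1_cst.
apply: E_le => //; first exact: L1_norm.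
by apply: L1D => //; exact: L1_cst.
Qed.

End Approx.

Lemma pos_part_martingale : martingale P F Y.
Proof.
apply/(martingaleP FP); split=> // [t t0|s t A s0 st FA].
  by apply: (L1_bounded P (wrt_measurable FP t0 (aY t0))) => w; exact: normY.
apply/eqP; rewrite -subr_eq0 -normr_le0; apply/ler_addgt0Pr => e e0; rewrite add0r.
(* Fixed before the grid is refined, so that 2 eps K stays below e / 2; the error at this eps then
   takes the other half. *)
pose eps := e / (4 * (K + 1)).
have K1 : 0 < K + 1 by exact: ltr_wpDl.
have eps0 : 0 < eps by rewrite divr_gt0 // mulr_gt0.
have cE : E (fun w => `|crossing_err (M ^~ w) (D ^~ w) (Z ^~ w) s t eps n|) @[n --> \oo] --> 0.
  apply: (cvg_E_norm_L2 (f_ := fun n w => crossing_err (M ^~ w) (D ^~ w) (Z ^~ w) s t eps n)).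
  - by move=> n; apply: crossing_err_meas.
  - by move=> n; apply: crossing_err_L1.
  - by move=> n; apply: crossing_err_L1_sqr.
  - by move=> n; apply: crossing_err_L2.
  - move=> w; apply: (@crossing_err_cvg _ _ _ _ _ _ _ K) => // r r0.
    + exact: DK.
    + exact: ZMD.
    + exact: Zpos.
    + exact: MD0.
have e2 : 0 < e / 2 by lra.
move/cvgrPdist_lt: cE => /(_ _ e2)[n _ /(_ n (leqnn n))] /=; rewrite sub0r normrN => h.
apply: (le_trans (crossing_approx n s0 st eps0 FA)).
have := ler_norm (E (fun w => `|crossing_err (M ^~ w) (D ^~ w) (Z ^~ w) s t eps n|)).
have : 2 * (eps * K) <= e / 2.
  have -> : 2 * (eps * K) = e / 2 * (K / (K + 1)) by rewrite /eps; field; lra.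
  rewrite ler_piMr ?(ltW e2) // ler_pdivrMr // mul1r; lra.
lra.
Qed.

End Fixed.
End PositivePart.
(** * The semimartingale |M| *)

(* The minimum-norm argument for Hilbert spaces, for countably many seminorms:
   near-minimizers of a weighted sum of the seminorms over shrinking convex sets
   form a Cauchy sequence, by the parallelogram law. *)
Section NearMinimizers.
Context {R : realType} {V : Type}.
Variables (cls : nat -> V -> Prop) (mid : V -> V -> V).
Variables (qq : nat -> V -> R) (dq : nat -> V -> V -> R) (b eta : nat -> R) (S : nat -> V).
Hypothesis qq0 : forall n k x, cls n x -> 0 <= qq k x.
Hypothesis dq0 : forall n k x y, cls n x -> cls n y -> 0 <= dq k x y.
Hypothesis cls_nested : forall n x, cls n.+1 x -> cls n x.
Hypothesis cls_mid : forall n x y, cls n x -> cls n y -> cls n (mid x y).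
Hypothesis parallelogram : forall n k x y, cls n x -> cls n y ->
  dq k x y = 2 * qq k x + 2 * qq k y - 4 * qq k (mid x y).
Hypothesis S_cls : forall n, cls n (S n).
Hypothesis S_bound : forall n k, qq k (S n) <= b k.
Hypothesis b0 : forall k, 0 <= b k.
Hypothesis eta0 : forall k, 0 < eta k.

(** Weights that make the weighted sum at [S n] at most the sum of the 2^-k, hence at most 2 for
    every [n]. *)
Let a k : R := 2^-1 ^+ k / (1 + b k).
Let a0 k : 0 < a k.
Proof. by rewrite divr_gt0 ?exprn_gt0 ?invr_gt0 // ltr_wpDr. Qed.

Let Q n x : R := \sum_(k < n) a k * qq k x.
(** Nondecreasing in [n], because the classes shrink and [Q] gains nonnegative terms, and bounded by
    2; so [c n] approaches its supremum. *)
Let c n := inf [set Q n x | x in [set x | cls n x]].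

Let nested m n x : (m <= n)%N -> cls n x -> cls m x.
Proof.
move=> mn; rewrite -(subnK mn); elim: (n - m)%N => [//|k IH] h.
by apply: IH; apply: cls_nested.
Qed.

Let Q0 n j x : cls j x -> 0 <= Q n x.
Proof. by move=> h; apply: sumr_ge0 => k _; rewrite mulr_ge0 ?(ltW (a0 k)) //; exact: qq0 h. Qed.

Let has_infc n : has_inf [set Q n x | x in [set x | cls n x]].
Proof.
split; first by exists (Q n (S n)); exists (S n) => //=.
by exists 0 => _ [x /= h <-]; exact: Q0 h.
Qed.

Let c_le n x : cls n x -> c n <= Q n x.
Proof. by move=> h; apply: ge_inf; [exact: (has_infc n).2|exists x]. Qed.

Let Q_mono m n j x : (m <= n)%N -> cls j x -> Q m x <= Q n x.
Proof.
move=> mn h; rewrite -(subnK mn); elim: (n - m)%N => [//|k IH].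
apply: (le_trans IH); rewrite addSn /Q big_ord_recr /= lerDl mulr_ge0 ?(ltW (a0 _)) //.
exact: qq0 h.
Qed.

Let c_mono m n : (m <= n)%N -> c m <= c n.
Proof.
move=> mn; apply: lb_le_inf; first exact: (has_infc n).1.
move=> _ [x /= h <-]; apply: (le_trans (c_le (nested mn h))); exact: Q_mono h.
Qed.

Let c_le2 n : c n <= 2.
Proof.
apply: (le_trans (c_le (S_cls n))).
suff main m : \sum_(k < m) a k * qq k (S n) <= 2 - 2 * 2^-1 ^+ m.
  by apply: (le_trans (main n)); rewrite gerBl mulr_ge0 // exprn_ge0 // invr_ge0.
elim: m => [|k IH]; first by rewrite big_ord0 expr0; lra.
rewrite big_ord_recr /=.
have : a k * qq k (S n) <= 2^-1 ^+ k.
  rewrite /a mulrAC ler_pdivrMr; last by rewrite ltr_wpDr.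
  by rewrite ler_wpM2l ?exprn_ge0 ?invr_ge0 // (le_trans (S_bound _ _)) // lerDr.
by rewrite exprS; lra.
Qed.

Let sc := sup (range c).

Let has_supc : has_sup (range c).
Proof. by split; [exists (c 0%N); exists 0%N|exists 2 => _ [n _ <-]; exact: c_le2]. Qed.

Let c_sc n : c n <= sc.
Proof. by apply: (sup_upper_bound has_supc); exists n. Qed.

Let near_min n : exists x, cls n x /\ Q n x < c n + n.+1%:R^-1.
Proof.
have e0 : 0 < n.+1%:R^-1 :> R by rewrite invr_gt0.
by have [_ [x /= h <-] hx] := inf_adherent e0 (has_infc n); exists x.
Qed.

Lemma near_minimizers_cauchy : exists f : nat -> V, (forall j, cls j (f j)) /\
  forall k j j', (k <= j)%N -> (j <= j')%N -> dq k (f j) (f j') <= eta j.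
Proof.
have [g gP] := choice near_min.
(* Parallelogram law: the midpoint of [g n] and [g k] stays in class [n], so its [Q n] is at least
   [c n], while both ends are nearly minimal. *)
have DQ n k : (n <= k)%N -> \sum_(i < n) a i * dq i (g n) (g k) <=
    4 * n.+1%:R^-1 + 2 * (sc - c n).
  move=> nk; have [gn1 gn2] := gP n; have [gk1 gk2] := gP k; have gk1' := nested nk gk1.
  have -> : \sum_(i < n) a i * dq i (g n) (g k) =
      2 * Q n (g n) + 2 * Q n (g k) - 4 * Q n (mid (g n) (g k)).
    rewrite /Q !mulr_sumr -big_split /= -sumrB; apply: eq_bigr => i _.
    by rewrite (parallelogram _ gn1 gk1'); ring.
  have h1 := c_le (cls_mid gn1 gk1'); have h2 := Q_mono nk gk1; have h3 := c_sc k.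
  have h4 : k.+1%:R^-1 <= n.+1%:R^-1 :> R by rewrite lef_pV2 ?posrE ?ltr0n // ler_nat.
  by move: (n.+1%:R^-1) (k.+1%:R^-1) gn2 gk2 h4 => en ek *; lra.
(* Bounding the weighted sum by [zeta j] bounds each of the first j + 1 seminorms by [eta j], after
   division by its weight. *)
have /choice[zeta zetaP] : forall j, exists z : R, 0 < z /\
    forall k, (k <= j)%N -> z <= eta j * a k.
  move=> j.
  have : forall i, exists z : R, 0 < z /\ forall k, (k <= i)%N -> z <= eta j * a k.
    elim=> [|i [z [z0 zk]]].
      by exists (eta j * a 0%N); split=> [|k]; [exact: mulr_gt0|rewrite leqn0 => /eqP ->].
    exists (Num.min z (eta j * a i.+1)); split=> [|k]; first by rewrite lt_min z0 mulr_gt0.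
    by rewrite leq_eqVlt => /predU1P[->|/zk h]; rewrite ge_min ?lexx ?orbT ?h.
  exact.
have /choice[N NP] : forall j, exists n0, forall n, (n0 <= n)%N ->
    4 * n.+1%:R^-1 + 2 * (sc - c n) <= zeta j.
  move=> j.
  have [z0 _] := zetaP j; have z4 : 0 < zeta j / 4 by rewrite divr_gt0.
  have [_ [n1 _ <-] hn1] := sup_adherent z4 has_supc.
  exists (maxn n1 (Num.truncn (8 / zeta j))) => n; rewrite geq_max => /andP[n1n hn].
  have h1 := c_mono n1n; rewrite -/sc in hn1.
  have h2 : n.+1%:R^-1 <= zeta j / 8.
    rewrite -[zeta j / 8]invrK lef_pV2 ?posrE ?invr_gt0 ?divr_gt0 // invf_div.
    by rewrite ltW // (lt_le_trans (truncnS_gt _)) // ler_nat.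
  by move: (n.+1%:R^-1) h2 => en h2; lra.
(* Partial sums make [phi] nondecreasing and at least [N j]; the added [j.+1] puts index [j] within
   the range of [Q (phi j)]. *)
pose phi j := (\sum_(i < j.+1) N i + j.+1)%N.
have phi_mono j j' : (j <= j')%N -> (phi j <= phi j')%N.
  move=> jj; rewrite -(subnK jj); elim: (j' - j)%N => [//|k IH].
  by apply: (leq_trans IH); rewrite addSn /phi [X in (_ <= X + _)%N]big_ord_recr /= leq_add // leq_addr.
have phiN j : (N j <= phi j)%N.
  by rewrite /phi big_ord_recr /= -addnA addnCA leq_addr.
have phij j : (j < phi j)%N by rewrite /phi leq_addl.
exists (fun j => g (phi j)); split=> [j|k j j' kj jj'].
  by apply: (nested (ltnW (phij j))); exact: (gP _).1.
have h1 := le_trans (DQ _ _ (phi_mono _ _ jj')) (NP j _ (phiN j)).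
have h2 := (zetaP j).2 k kj.
have kphi : (k < phi j)%N by exact: leq_ltn_trans kj (phij j).
rewrite -(ler_pM2l (a0 k)) [leRHS]mulrC; apply: le_trans h2; apply: le_trans h1.
rewrite (bigD1 (Ordinal kphi)) //= lerDl; apply: sumr_ge0 => i _.
rewrite mulr_ge0 ?(ltW (a0 _)) //; apply: (dq0 (n := phi j)); first exact: (gP _).1.
by apply: (nested (phi_mono _ _ jj')); exact: (gP _).1.
Qed.

End NearMinimizers.

(** * Dyadic sums for |M| and their near-minimizers *)

Section NormIncrements.
Context {R : realType} {d : measure_display} {T : measurableType d}.
Variables (P : probability T R) (F : R -> set (set T)).
Hypothesis FP : usual_filtration P F.
Implicit Types (s t u c lm K : R) (f g : T -> R) (A B : set T) (X Y : R -> T -> R).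
Local Notation E := (Rintegral P [set: T]).
Local Notation L1 f := (P.-integrable [set: T] (EFin \o f)).
Local Notation cpath x := ({within [set t : R | 0 <= t], continuous (x : R -> R)}).

Variables (M m V : R -> T -> R) (tau : nat -> T -> \bar R).
Hypothesis aM : adapted F M.
Hypothesis am : adapted F m.
Hypothesis cm : forall w, cpath (m ^~ w).
Hypothesis MV : forall w s t, 0 <= s -> s <= t ->
  `|M t w - m t w - (M s w - m s w)| <= V t w - V s w.
Hypothesis tau_st : forall k, stopping_time F (tau k).
Hypothesis tau_mart : forall k, martingale P F (stopped m (tau k)).
Hypothesis tau_bnd : forall k t w, 0 <= t -> `|stopped m (tau k) t w| <= k%:R.

Definition dyad n i : R := i%:R / 2 ^+ n.

Lemma dyad_ge0 n i : 0 <= dyad n i.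
Proof. by rewrite divr_ge0 ?exprn_ge0. Qed.

Lemma dyad_mono n : {homo dyad n : i j / (i <= j)%N >-> i <= j}.
Proof. by move=> i j ij; rewrite ler_wpM2r ?invr_ge0 ?exprn_ge0 // ler_nat. Qed.

Lemma dyadS n i : dyad n.+1 i.*2 = dyad n i.
Proof.
by rewrite /dyad exprS -muln2 natrM [2 * _]mulrC -mulf_div divff ?mulr1 ?pnatr_eq0.
Qed.

(* Processes whose difference with |M| is, up to the variation V, increasing
   along the dyadic numbers of order n in [0, n]. *)
Definition approx_class n X : Prop :=
  [/\ adapted F X, forall w, cpath (X ^~ w),
      forall k, martingale P F (stopped X (tau k)),
      forall k, exists b : R, forall t w, 0 <= t -> `|stopped X (tau k) t w| <= b &
      forall w i j, (i <= j)%N -> (j <= n * 2 ^ n)%N ->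
        `|M (dyad n i) w| - X (dyad n i) w + V (dyad n i) w <=
        `|M (dyad n j) w| - X (dyad n j) w + V (dyad n j) w].

Lemma approx_class_nested n X : approx_class n.+1 X -> approx_class n X.
Proof.
move=> [aX cX mX bX hX]; split=> // w i j ij jn.
rewrite -(dyadS n i) -(dyadS n j); apply: hX; first by rewrite leq_double.
by rewrite -muln2 expnS (mulnC 2%N) mulnA leq_mul2r /= (leq_trans jn) // leq_mul2r leqnSn orbT.
Qed.

Definition midproc X Y : R -> T -> R := fun t w => 2^-1 * (X t w + Y t w).

Lemma stopped_mid X Y sigma t w :
  stopped (midproc X Y) sigma t w = 2^-1 * (stopped X sigma t w + stopped Y sigma t w).
Proof. by rewrite /stopped /midproc; case: ifP => // _; rewrite addr0 mulr0. Qed.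

Lemma approx_class_mid n X Y : approx_class n X -> approx_class n Y ->
  approx_class n (midproc X Y).
Proof.
move=> [aX cX mX bX hX] [aY cY mY bY hY]; split.
- move=> t t0; have sF := filtration_sigma FP t0.
  apply: (wrtM sF); first exact: wrt_cst.
  by apply: (wrtD sF); [exact: aX|exact: aY].
- move=> w; apply: (cpathM (x := fun=> 2^-1)); first exact: cpath_cst.
  exact: (cpathD (cX w) (cY w)).
- move=> k; apply: (mart_ext FP _ (martZ FP 2^-1 (martD FP (mX k) (mY k)))) => t w _.
  by rewrite stopped_mid.
- move=> k; have [B1 h1] := bX k; have [B2 h2] := bY k; exists (B1 + B2) => t w t0.
  rewrite stopped_mid normrM ger0_norm ?invr_ge0 //.
  have := ler_normD (stopped X (tau k) t w) (stopped Y (tau k) t w).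
  have := h1 t w t0; have := h2 t w t0.
  have := normr_ge0 (stopped X (tau k) t w); have := normr_ge0 (stopped Y (tau k) t w); lra.
- move=> w i j ij jn; have := hX w i j ij jn; have := hY w i j ij jn; rewrite /midproc; lra.
Qed.

(* Riemann sums of the stochastic integral of sg M with respect to m. *)
Definition sg_sum n : R -> T -> R := fun t w =>
  \sum_(i < n * 2 ^ n) Num.sg (M (dyad n i) w) *
    (m (Num.min t (dyad n i.+1)) w - m (Num.min t (dyad n i)) w).

(** Stopping acts only on the increments of [m], since each sign is a fixed weight; thus every term
    is an elementary integral of the bounded martingale [stopped m (tau k)]. *)
Lemma stopped_sg_sum n k t w : 0 <= t -> stopped (sg_sum n) (tau k) t w =
  \sum_(i < n * 2 ^ n) Num.sg (M (dyad n i) w) *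
    (stopped m (tau k) (Num.min t (dyad n i.+1)) w - stopped m (tau k) (Num.min t (dyad n i)) w).
Proof.
move=> t0; have tk0 := (tau_st k).1 w.
have mm p : 0 <= p -> Num.min (fine (Order.min t%:E (tau k w))) p =
    fine (Order.min (Num.min t p)%:E (tau k w)).
  move=> p0; apply: EFin_inj; rewrite EFin_min !fine_minE // ?le_min ?t0 //.
  by rewrite EFin_min minAC.
rewrite /stopped /sg_sum; case: ifP => tk; last first.
  by rewrite big1 // => i _; rewrite subrr mulr0.
by apply: eq_bigr => i _; rewrite !mm ?dyad_ge0.
Qed.

Lemma wrt_sgM n i : measurable_wrt (F (dyad n i)) (fun w => Num.sg (M (dyad n i) w)).
Proof.
apply: wrt_sg; first exact: (filtration_sigma FP (dyad_ge0 n i)).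
by apply: aM; exact: dyad_ge0.
Qed.

Lemma sg_sum_step n w j : (j < n * 2 ^ n)%N ->
  sg_sum n (dyad n j.+1) w - sg_sum n (dyad n j) w =
  Num.sg (M (dyad n j) w) * (m (dyad n j.+1) w - m (dyad n j) w).
Proof.
move=> jn; rewrite /sg_sum -sumrB (bigD1 (Ordinal jn)) //= big1 ?addr0.
  have h : dyad n j <= dyad n j.+1 by exact: dyad_mono.
  by rewrite !minxx (min_idPr h) (min_idPl h); ring.
move=> i ij; have {}ij : (i : nat) != j by [].
rewrite -mulrBr; move: ij; rewrite neq_ltn => /orP[ij|ij].
  have h1 : dyad n i.+1 <= dyad n j by exact: dyad_mono.
  have h2 : dyad n i <= dyad n j by apply: dyad_mono; exact: ltnW.
  have h3 : dyad n j <= dyad n j.+1 by exact: dyad_mono.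
  rewrite (min_idPr h1) (min_idPr h2) (min_idPr (le_trans h1 h3)) (min_idPr (le_trans h2 h3)).
  by rewrite subrr mulr0.
have h1 : dyad n j.+1 <= dyad n i by exact: dyad_mono.
have h2 : dyad n i <= dyad n i.+1 by exact: dyad_mono.
have h3 : dyad n j <= dyad n j.+1 by exact: dyad_mono.
rewrite (min_idPl h1) (min_idPl (le_trans h1 h2)) (min_idPl (le_trans h3 h1)).
by rewrite (min_idPl (le_trans h3 (le_trans h1 h2))) !subrr mulr0.
Qed.

Lemma sg_sum_class n : approx_class n (sg_sum n).
Proof.
have dS i : dyad n i <= dyad n i.+1 by exact: dyad_mono.
split.
- move=> t t0; have sF := filtration_sigma FP t0.
  apply: (wrt_sum sF (f := fun i w => Num.sg (M (dyad n i) w) *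
    (m (Num.min t (dyad n i.+1)) w - m (Num.min t (dyad n i)) w))) => i _.
  apply: (elementary_wrt FP) => //; [exact: dyad_ge0|exact: wrt_sgM].
- move=> w; apply: (cpath_sum (x := fun i t => Num.sg (M (dyad n i) w) *
    (m (Num.min t (dyad n i.+1)) w - m (Num.min t (dyad n i)) w))) => i _.
  apply: (cpathM (x := fun=> Num.sg (M (dyad n i) w))); first exact: cpath_cst.
  by apply: (cpathB (x := fun t => m (Num.min t (dyad n i.+1)) w));
    apply: (cpath_min (x := m ^~ w)) => //; exact: dyad_ge0.
- move=> k; pose X i t w := Num.sg (M (dyad n i) w) *
    (stopped m (tau k) (Num.min t (dyad n i.+1)) w - stopped m (tau k) (Num.min t (dyad n i)) w).
  apply: (mart_ext FP (X := fun t w => \sum_(i < n * 2 ^ n) X i t w)).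
    by move=> t w t0; rewrite stopped_sg_sum.
  apply: (mart_sum FP) => i _; apply: (mart_elementary FP (c := 1)) => //.
  + exact: dyad_ge0.
  + exact: wrt_sgM.
  + by move=> w; exact: norm_sg_le1.
- move=> k; exists (\sum_(i < n * 2 ^ n) (k%:R + k%:R)) => t w t0; rewrite stopped_sg_sum //.
  apply: (le_trans (ler_norm_sum _ _ _)); apply: ler_sum => i _.
  rewrite normrM -[leRHS]mul1r ler_pM ?norm_sg_le1 // (le_trans (ler_normB _ _)) //.
  by apply: lerD; apply: tau_bnd; rewrite le_min t0 dyad_ge0.
- move=> w i j; elim: j => [|j IH]; first by rewrite leqn0 => /eqP ->.
  rewrite leq_eqVlt => /predU1P[->//|ij] jn.
  apply: (le_trans (IH ij (ltnW jn))).
  have h1 := sg_sum_step w jn; have h2 := MV w (dyad_ge0 n j) (dS j).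
  (* The increment of |M| is at least that of M times the sign at its start; this splits into the
     increment of [sg_sum] and a part from M - m that is at least minus the increment of [V]
     ([h5]). *)
  have h3 : Num.sg (M (dyad n j) w) * M (dyad n j.+1) w <= `|M (dyad n j.+1) w|.
    by rewrite (le_trans (ler_norm _)) // normrM ler_piMl ?norm_sg_le1.
  have h4 := normrEsg (M (dyad n j) w).
  have h5 : - (V (dyad n j.+1) w - V (dyad n j) w) <= Num.sg (M (dyad n j) w) *
     (M (dyad n j.+1) w - m (dyad n j.+1) w - (M (dyad n j) w - m (dyad n j) w)).
    rewrite lerNl (le_trans _ h2) // -mulNr (le_trans (ler_norm _)) // normrM normrN.
    by rewrite ler_piMl ?norm_sg_le1.
  move: h1 h3 h4 h5; rewrite !mulrDr !mulrN; lra.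
Qed.

(** A bound independent of [n]: signs are weights bounded by 1, so the second moment does not exceed
    that of the stopped [m], which is bounded by [k]. *)
Lemma sg_sum_L2 n k : E (fun w => stopped (sg_sum n) (tau k) k%:R w ^+ 2) <= k%:R ^+ 2.
Proof.
pose X := stopped m (tau k); pose p i := Num.min k%:R (dyad n i).
(* Past time [k] the sign of M is no longer known at the capped grid time; it is replaced by 0,
   harmlessly, since the increments there vanish. *)
pose h i w := if dyad n i <= k%:R then Num.sg (M (dyad n i) w) else 0.
have p0 : 0 <= p 0%N by rewrite le_min ler0n dyad_ge0.
have pmono : {homo p : i j / (i <= j)%N >-> i <= j}.
  by move=> i j ij; rewrite /p le_min !ge_min lexx /= dyad_mono // orbT.
have pge0 i : 0 <= p i by rewrite le_min ler0n dyad_ge0.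
have h1 i w : `|h i w| <= 1 by rewrite /h; case: ifP; rewrite ?normr0 ?norm_sg_le1.
have mh i : measurable_wrt (F (p i)) (h i).
  rewrite /h /p; have sF := filtration_sigma FP (pge0 i).
  case: (boolP (dyad n i <= k%:R)) => hi; last exact: wrt_cst.
  by rewrite (min_idPr hi); exact: wrt_sgM.
have XK r w : 0 <= r -> `|X r w| <= k%:R by exact: tau_bnd.
have := transform_L2 FP (tau_mart k) pmono p0 mh h1 XK (n * 2 ^ n).
rewrite (_ : transform h _ _ _ = fun w => stopped (sg_sum n) (tau k) k%:R w); last first.
  apply/funext => w; rewrite stopped_sg_sum // /transform; apply: eq_bigr => i _.
  rewrite /h -/(p i) -/(p i.+1); case: (boolP (dyad n i <= k%:R)) => // hi.
  rewrite mul0r /p; move: hi; rewrite -ltNge => /ltW hi.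
  have hS : dyad n i <= dyad n i.+1 by exact: dyad_mono.
  by rewrite (min_idPl hi) (min_idPl (le_trans hi hS)) subrr mulr0.
move=> /le_trans; apply; have /(martingaleP FP)[aX IX _] := tau_mart k.
have mX r : 0 <= r -> measurable_fun [set: T] (X r).
  by move=> r0; exact: (wrt_measurable FP r0 (aX _ r0)).
have : 0 <= E (fun w => X (p 0%N) w ^+ 2) by apply: E_ge0 => w; exact: sqr_ge0.
have : E (fun w => X (p (n * 2 ^ n)%N) w ^+ 2) <= k%:R ^+ 2.
  rewrite -[leRHS](E_cst P); apply: E_le; last move=> w.
  - have := L1_mul_bounded (IX _ (pge0 (n * 2 ^ n)%N)) (mX _ (pge0 _)) (fun w => XK _ w (pge0 (n * 2 ^ n)%N)).
    by congr (is_true (integrable _ _ _)); apply/funext => w /=; rewrite expr2.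
  - exact: L1_cst.
  - by rewrite -[X _ _ ^+ 2]ger0_norm ?sqr_ge0 // normrX ler_pXn2r ?nnegrE // XK.
lra.
Qed.

(** [sqn] and [sqd] serve as the seminorms [qq] and [dq] of the near-minimizers, one for each
    localizing index. *)
Definition sqn k X : R := E (fun w => stopped X (tau k) k%:R w ^+ 2).
Definition sqd k X Y : R :=
  E (fun w => (stopped X (tau k) k%:R w - stopped Y (tau k) k%:R w) ^+ 2).

Lemma sqd_parallelogram n k X Y : approx_class n X -> approx_class n Y ->
  sqd k X Y = 2 * sqn k X + 2 * sqn k Y - 4 * sqn k (midproc X Y).
Proof.
move=> [_ _ mX bX _] [_ _ mY bY _].
have /(martingaleP FP)[aX IX _] := mX k; have /(martingaleP FP)[aY IY _] := mY k.
have [BX hX] := bX k; have [BY hY] := bY k; have k0 : 0 <= k%:R :> R by [].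
pose x := stopped X (tau k) k%:R; pose y := stopped Y (tau k) k%:R.
have mx : measurable_fun [set: T] x by exact: (wrt_measurable FP k0 (aX _ k0)).
have my : measurable_fun [set: T] y by exact: (wrt_measurable FP k0 (aY _ k0)).
have Ixx : L1 (fun w => x w * x w) := L1_mul_bounded (IX _ k0) mx (fun w => hX _ w k0).
have Iyy : L1 (fun w => y w * y w) := L1_mul_bounded (IY _ k0) my (fun w => hY _ w k0).
have Ixy : L1 (fun w => x w * y w) := L1_mul_bounded (IY _ k0) mx (fun w => hX _ w k0).
have -> : sqn k X = E (fun w => x w * x w) by apply: E_ext => w; rewrite expr2.
have -> : sqn k Y = E (fun w => y w * y w) by apply: E_ext => w; rewrite expr2.
have -> : sqn k (midproc X Y) =
    4^-1 * (E (fun w => x w * x w) + E (fun w => y w * y w) + 2 * E (fun w => x w * y w)).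
  have I2 := L1Z 2 Ixy; have I1 := L1D Ixx Iyy.
  rewrite -(E_Z 2 Ixy) -(E_D Ixx Iyy) -(E_D I1 I2) -(E_Z _ (L1D I1 I2)).
  by apply: E_ext => w; rewrite stopped_mid -/x -/y /x /y; field.
have -> : sqd k X Y = E (fun w => x w * x w) + E (fun w => y w * y w) - 2 * E (fun w => x w * y w).
  have I2 := L1Z 2 Ixy; have I1 := L1D Ixx Iyy.
  rewrite -(E_Z 2 Ixy) -(E_D Ixx Iyy) -(E_B I1 I2).
  by apply: E_ext => w; rewrite /x /y; ring.
by field.
Qed.

Lemma approx_cauchy (eta : nat -> R) : (forall k, 0 < eta k) ->
  exists f : nat -> R -> T -> R, (forall j, approx_class j (f j)) /\
  forall k j j', (k <= j)%N -> (j <= j')%N -> sqd k (f j) (f j') <= eta j.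
Proof.
move=> eta0.
apply: (@near_minimizers_cauchy _ _ approx_class midproc sqn sqd (fun k => k%:R ^+ 2) eta sg_sum) => //.
- by move=> n k X _; apply: E_ge0 => w; exact: sqr_ge0.
- by move=> n k X Y _ _; apply: E_ge0 => w; exact: sqr_ge0.
- exact: approx_class_nested.
- exact: approx_class_mid.
- exact: sqd_parallelogram.
- exact: sg_sum_class.
- by move=> n k; exact: sg_sum_L2.
Qed.

End NormIncrements.

(** * Uniform limits and variation of paths *)

Section UniformLimit.
Context {R : realType}.
Implicit Types (s t e : R).
Local Notation cpath x := ({within [set t : R | 0 <= t], continuous (x : R -> R)}).

Lemma geometric_cauchy (u : nat -> R) N :
  (forall j, (N <= j)%N -> `|u j - u j.+1| <= 2^-1 ^+ j) ->
  cvgn u /\ forall j, (N <= j)%N -> `|u j - lim (u @ \oo)| <= 2 * 2^-1 ^+ j.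
Proof.
move=> h.
(* Subtracting the tail 2 2^-(j+i) of the geometric series is what lets the induction on [i]
   close. *)
have dist j i : (N <= j)%N -> `|u j - u (j + i)%N| <= 2 * 2^-1 ^+ j - 2 * 2^-1 ^+ (j + i).
  move=> Nj; elim: i => [|i IH]; first by rewrite addn0 !subrr normr0.
  have h1 := h (j + i)%N (leq_trans Nj (leq_addr _ _)).
  rewrite addnS exprS; rewrite -(subrK (u (j + i)%N) (u j)) -addrA.
  by apply: (le_trans (ler_normD _ _)); move: (2^-1 ^+ (j + i)) IH h1 => q IH h1; lra.
have pow0 n : 0 <= 2^-1 ^+ n :> R by rewrite exprn_ge0 // invr_ge0.
have cv : cvgn u.
  apply: cauchy_cvg; apply: cauchy_exP => e e0.
  have : 2^-1 ^+ n @[n --> \oo] --> (0 : R).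
    by apply: cvg_expr; rewrite ger0_norm ?invr_ge0 // invf_lt1 // ltr1n.
  move=> /cvgrPdist_lt /(_ (e / 2)) []; first by lra.
  move=> n0 _ /(_ (maxn n0 N) (leq_maxl _ _)); rewrite sub0r normrN ger0_norm // => hp.
  exists (u (maxn n0 N)); exists (maxn n0 N) => //= i ni.
  have := dist (maxn n0 N) (i - maxn n0 N)%N (leq_maxr _ _); rewrite subnKC //.
  by have := pow0 i; move: (2^-1 ^+ i) (2^-1 ^+ maxn n0 N) hp => p q; rewrite /ball /=; lra.
split=> // j Nj.
have c : `|u j - u i| @[i --> \oo] --> `|u j - lim (u @ \oo)|.
  by apply: cvg_norm; apply: cvgB => //; exact: cvg_cst.
rewrite -(cvg_lim _ c) //; apply: limr_le; first exact: cvgP c.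
exists j => //= i ji; rewrite -(subnKC ji).
by have := dist j (i - j)%N Nj; have := pow0 (j + (i - j))%N; lra.
Qed.

Lemma uniform_limit_cpath (x : nat -> R -> R) l : (forall j, cpath (x j)) ->
  (forall t, 0 <= t -> exists N, forall j, (N <= j)%N -> forall s, 0 <= s -> s <= t ->
     `|x j s - l s| <= 2 * 2^-1 ^+ j) ->
  cpath l.
Proof.
move=> cx h; apply/cpathP => t t0 e e0.
(* Uniformity on [0, t + 1] covers a whole neighbourhood of [t]. *)
have t1 : 0 <= t + 1 by lra.
have [N hN] := h _ t1.
have : 2^-1 ^+ n @[n --> \oo] --> (0 : R).
  by apply: cvg_expr; rewrite ger0_norm ?invr_ge0 // invf_lt1 // ltr1n.
move=> /cvgrPdist_lt /(_ (e / 8)) []; first by lra.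
move=> n0 _ /(_ (maxn n0 N) (leq_maxl _ _)); rewrite sub0r normrN => hp.
have {}hp := le_lt_trans (ler_norm _) hp.
pose j := maxn n0 N; have {}hN := hN j (leq_maxr _ _).
have e4 : 0 < e / 4 by lra.
have [dl dl0 hd] := (cpathP (x j)).1 (cx j) t t0 _ e4.
exists (Num.min dl 1) => [|s s0]; first by rewrite lt_min dl0 ltr01.
rewrite lt_min => /andP[h1 h2].
have st : s <= t + 1 by have := ler_norm (s - t); rewrite distrC; lra.
have k1 := hN s s0 st; have k2 : `|x j t - l t| <= 2 * 2^-1 ^+ j by apply: hN => //; lra.
have k3 := hd s s0 h1.
move: (2^-1 ^+ j) hp k1 k2 => q hp.
move: k3; rewrite !ltr_norml !ler_norml => /andP[? ?] /andP[? ?] /andP[? ?].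
by apply/andP; split; lra.
Qed.

(** [V] need not be continuous: dyadic points are chosen inside [s, t], just after [s] and just
    before [t], so that monotonicity of [V] gives both comparisons in the right direction, and
    continuity is asked of [x] alone. *)
Lemma lower_variation (x V : R -> R) : cpath x ->
  (forall s t, 0 <= s -> s <= t -> V s <= V t) ->
  (forall n i j, (i <= j)%N -> (j <= n * 2 ^ n)%N ->
     x (dyad n i) + V (dyad n i) <= x (dyad n j) + V (dyad n j)) ->
  forall s t, 0 <= s -> s <= t -> x s + V s <= x t + V t.
Proof.
move=> /cpathP cx Vmono h s t s0; rewrite le_eqVlt => /predU1P[->//|st].
have t0 := le_trans s0 (ltW st).
apply/ler_addgt0Pr => e e0; have e2 : 0 < e / 2 by lra.
have [d1 d10 hd1] := cx s s0 _ e2; have [d2 d20 hd2] := cx t t0 _ e2.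
pose dl := Num.min (Num.min d1 d2) ((t - s) / 2).
have dl0 : 0 < dl by rewrite !lt_min d10 d20 /=; lra.
have [n [nt npow]] : exists n, t <= n%:R /\ 2^-1 ^+ n < dl.
  have : 2^-1 ^+ n @[n --> \oo] --> (0 : R).
    by apply: cvg_expr; rewrite ger0_norm ?invr_ge0 // invf_lt1 // ltr1n.
  move=> /cvgrPdist_lt /(_ dl dl0) [n0 _ hn0].
  exists (maxn n0 (Num.truncn t).+1); split.
    by apply: (le_trans (ltW (truncnS_gt t))); rewrite ler_nat leq_maxr.
  have /= := hn0 (maxn n0 (Num.truncn t).+1) (leq_maxl _ _).
  by rewrite sub0r normrN; apply: le_lt_trans; exact: ler_norm.
have p0 : 0 < 2 ^+ n :> R by rewrite exprn_gt0.
have pV : 2^-1 ^+ n = (2 ^+ n)^-1 :> R by rewrite exprVn.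
rewrite pV in npow.
pose i := (Num.truncn (s * 2 ^+ n)).+1; pose j := Num.truncn (t * 2 ^+ n).
have si : s < dyad n i by rewrite /dyad ltr_pdivlMr // truncnS_gt.
have isd : dyad n i <= s + (2 ^+ n)^-1.
  rewrite /dyad /i -natr1 mulrDl mul1r lerD2r ler_pdivrMr //.
  by rewrite truncn_le // mulr_ge0 // ltW.
have jt : dyad n j <= t by rewrite /dyad ler_pdivrMr // truncn_le // mulr_ge0 // ltW.
have tj : t < dyad n j + (2 ^+ n)^-1.
  by rewrite /dyad -[X in _ + X]mul1r -mulrDl ltr_pdivlMr // natr1 truncnS_gt.
move: npow; rewrite !lt_min => /andP[/andP[n1 n2] n3].
have ij : (i <= j)%N.
  have : dyad n i < dyad n j :> R.
    by move: (dyad n i) (dyad n j) ((2 ^+ n)^-1) isd tj n3 => a b q h1 h2 h3; lra.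
  by rewrite /dyad ltr_pM2r ?invr_gt0 // ltr_nat => /ltnW.
have jn : (j <= n * 2 ^ n)%N.
  rewrite -(ler_nat R) natrM natrX.
  have := jt; rewrite /dyad ler_pdivrMr // => /le_trans; apply.
  by rewrite ler_pM2r.
have k1 := h n i j ij jn.
have k2 : V s <= V (dyad n i) by apply: Vmono => //; exact: ltW.
have k3 : V (dyad n j) <= V t by apply: Vmono => //; exact: dyad_ge0.
have k4 : `|x s - x (dyad n i)| < e / 2.
  by apply: hd1; [exact: dyad_ge0|move: (dyad n i) ((2 ^+ n)^-1) si isd n1 => a q h1 h2 h3; rewrite ler0_norm; lra].
have k5 : `|x t - x (dyad n j)| < e / 2.
  by apply: hd2; [exact: dyad_ge0|move: (dyad n j) ((2 ^+ n)^-1) jt tj n2 => a q h1 h2 h3; rewrite ger0_norm; lra].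
have := le_lt_trans (ler_norm _) k4; have := le_lt_trans (ler_norm _) k5.
rewrite distrC in k5; have := le_lt_trans (ler_norm _) k5.
lra.
Qed.

Lemma diff_nondecreasing_bv (x V : R -> R) t : 0 <= t ->
  (forall s u, 0 <= s -> s <= u -> V s <= V u) ->
  (forall s u, 0 <= s -> s <= u -> x s + V s <= x u + V u) ->
  bounded_variation 0 t x.
Proof.
rewrite le_eqVlt => /predU1P[<-|t0] Vm xVm; first exact: bounded_variationxx.
have xE s : x s = x s + V s + - V s by rewrite addrK.
rewrite (funext xE); apply: (@bounded_variationD _ _ _ (fun s => x s + V s) (fun s => - V s)) => //; last apply: bounded_variationN.
  by apply: nondecreasing_bounded_variation => s u; rewrite !in_itv /= => /andP[s0 _] _; exact: xVm.
by apply: nondecreasing_bounded_variation => s u; rewrite !in_itv /= => /andP[s0 _] _; exact: Vm.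
Qed.

Lemma total_variation_incr (x : R -> R) s t : (forall u, 0 <= u -> bounded_variation 0 u x) ->
  0 <= s -> s <= t ->
  `|x t - x s| <= fine (total_variation 0 t x) - fine (total_variation 0 s x).
Proof.
move=> bv s0 st; have t0 := le_trans s0 st.
have f1 := (bounded_variationP x t0).1 (bv t t0).
have f2 := (bounded_variationP x s0).1 (bv s s0).
rewrite (total_variationD x s0 st).
have bst : bounded_variation s t x by exact: bounded_variationr s0 st (bv t t0).
have f3 := (bounded_variationP x st).1 bst.
rewrite fineD // [X in _ <= X - _]addrC addrK -lee_fin fineK //.
exact: total_variation_ge.
Qed.

End UniformLimit.

Section L1Limit.
Context {R : realType} {d : measure_display} {T : measurableType d}.
Variables (P : probability T R).
Local Notation E := (Rintegral P [set: T]).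
Local Notation L1 f := (P.-integrable [set: T] (EFin \o f)).

(** Fatou's lemma for |xi j - xi n| as n grows; integrability of [x] follows by subtracting xi j - x
    from [xi j]. *)
Lemma L1_limit (xi : nat -> T -> R) (x : T -> R) (j : nat) (dl : R) :
  (forall n, L1 (xi n)) -> measurable_fun [set: T] x ->
  {ae P, forall w, xi n w @[n --> \oo] --> x w} ->
  (forall n, (j <= n)%N -> E (fun w => `|xi j w - xi n w|) <= dl) ->
  L1 x /\ E (fun w => `|xi j w - x w|) <= dl.
Proof.
move=> Ixi mx cx h.
have mxi n := L1_measurable (Ixi n).
pose D n w : \bar R := (`|xi j w - xi n w|)%:E.
have mD n : measurable_fun [set: T] (D n).
  apply/measurable_EFinP; apply: measurableT_comp => //.
  by apply: measurable_funB; exact: mxi.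
have fat := @fatou _ _ _ P _ measurableT D mD (fun n w _ => normr_ge0 _).
have key : (\int[P]_w (`|xi j w - x w|)%:E <= dl%:E)%E.
  have -> : (\int[P]_w (`|xi j w - x w|)%:E = \int[P]_w limn_einf (D ^~ w))%E.
    apply: ae_eq_integral => //.
    - apply/measurable_EFinP; apply: measurableT_comp => //.
      by apply: measurable_funB.
    - apply: measurableT_comp => //; apply: measurable_fun_limn_esup => n.
      by apply: measurableT_comp => //; exact: mD.
    - apply: filterS cx => w cw _.
      have : D n w @[n --> \oo] --> (`|xi j w - x w|)%:E.
        apply: cvg_EFin; first exact: nearW.
        by apply: cvg_norm; apply: cvgB => //; exact: cvg_cst.
      by move=> /[dup] /cvgP/is_cvg_limn_einfE -> /cvg_lim ->.
  apply: (le_trans fat); rewrite limn_einf_lim; apply: lime_le.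
    exact: is_cvg_einfs.
  apply: nearW => n; rewrite /einfs /=.
  apply: (@le_trans _ _ (\int[P]_w D (maxn n j) w)%E).
    by apply: ereal_inf_lbound; exists (maxn n j) => //=; exact: leq_maxl.
  rewrite -EFin_E; last by apply: L1_norm; apply: L1B.
  by rewrite lee_fin; apply: h; exact: leq_maxr.
have Id : L1 (fun w => xi j w - x w).
  apply/integrableP; split.
    by apply/measurable_EFinP; exact: measurable_funB.
  by apply: (le_lt_trans key); exact: ltry.
have Ix : L1 x.
  have := L1B (Ixi j) Id.
  by congr (is_true (integrable _ _ _)); apply/funext => w /=; congr (_%:E); ring.
split=> //; rewrite -lee_fin EFin_E //.
exact: L1_norm.
Qed.

End L1Limit.

Lemma ler_dist_sum {R : realType} (a x y h k : R) :
  `|a - x| <= h -> `|a - y| <= k -> `|y - x| <= h + k.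
Proof. by rewrite !ler_norml => /andP[? ?] /andP[? ?]; apply/andP; split; lra. Qed.

(** * The limit process and the decomposition of |M| *)

Section NormSemimartingale.
Context {R : realType} {d : measure_display} {T : measurableType d}.
Variables (P : probability T R) (F : R -> set (set T)).
Hypothesis FP : usual_filtration P F.
Implicit Types (s t u c lm K : R) (f g : T -> R) (A B : set T) (X Y : R -> T -> R).
Local Notation E := (Rintegral P [set: T]).
Local Notation L1 f := (P.-integrable [set: T] (EFin \o f)).
Local Notation cpath x := ({within [set t : R | 0 <= t], continuous (x : R -> R)}).

Variables (M V : R -> T -> R) (tau : nat -> T -> \bar R).
Hypothesis aM : adapted F M.
Hypothesis cM : forall w, cpath (M ^~ w).
Hypothesis tau_st : forall k, stopping_time F (tau k).
Hypothesis tau_le : forall k w, (tau k w <= k%:R%:E)%E.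
Hypothesis tau_inf : {ae P, forall w, nondecreasing_seq (tau ^~ w) /\
  tau n w @[n --> \oo] --> +oo%E}.
Hypothesis Vmono : forall w s t, 0 <= s -> s <= t -> V s w <= V t w.

Local Notation h2 j := (2^-1 ^+ j : R).

Let h2gt0 j : 0 < h2 j. Proof. by rewrite exprn_gt0 // invr_gt0. Qed.

Variable f : nat -> R -> T -> R.
Hypothesis fC : forall j, approx_class P F M V tau j (f j).
(** An L^2 distance of at most 4^-j: the maximal inequality at level 2^-j then yields an event of
    probability at most 2^-j. *)
Hypothesis fd : forall k j j', (k <= j)%N -> (j <= j')%N ->
  sqd P tau k (f j) (f j') <= (h2 j * h2 j) ^+ 2.

Let D k j j' t w := stopped (f j) (tau k) t w - stopped (f j') (tau k) t w.

Let D_mart k j j' : martingale P F (D k j j').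
Proof.
have [_ _ mj _ _] := fC j; have [_ _ mj' _ _] := fC j'.
apply: (mart_ext FP _ (martD FP (mj k) (martZ FP (-1) (mj' k)))) => t w _.
by rewrite mulN1r.
Qed.

Let D_cpath k j j' w : cpath (D k j j' ^~ w).
Proof.
have [_ cj _ _ _] := fC j; have [_ cj' _ _ _] := fC j'.
apply: (cpathB (x := stopped (f j) (tau k) ^~ w)); apply: stopped_cpath => //;
  exact: (tau_st k).1.
Qed.

Let D_L1 k j j' : (k <= j)%N -> (j <= j')%N ->
  E (fun w => `|D k j j' k%:R w|) <= h2 j * h2 j.
Proof.
move=> kj jj'; pose dl := h2 j * h2 j.
have dl0 : 0 < dl by exact: mulr_gt0.
have [_ _ _ bj _] := fC j; have [_ _ _ bj' _] := fC j'.
have [b1 hb1] := bj k; have [b2 hb2] := bj' k; have k0 : 0 <= k%:R :> R by [].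
have /(martingaleP FP)[aD ID _] := D_mart k j j'.
have mD := wrt_measurable FP k0 (aD _ k0).
have DB w : `|D k j j' k%:R w| <= b1 + b2.
  by rewrite (le_trans (ler_normB _ _)) // lerD ?hb1 ?hb2.
have ID2 : L1 (fun w => D k j j' k%:R w ^+ 2).
  have := L1_mul_bounded (ID _ k0) mD DB.
  by congr (is_true (integrable _ _ _)); apply/funext => w /=; rewrite expr2.
(* AM-GM: |x| <= dl / 2 + x^2 / (2 dl) *)
have I1 := L1Z (dl^-1 / 2) ID2; have I0 := L1_cst P (dl / 2).
apply: (@le_trans _ _ (E (fun w => dl / 2 + dl^-1 / 2 * D k j j' k%:R w ^+ 2))).
  apply: E_le; [exact/L1_norm/ID|exact: L1D|move=> w].
  rewrite -[D _ _ _ _ _ ^+ 2]ger0_norm ?sqr_ge0 // normrX.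
  move: `|D _ _ _ _ _| => x; rewrite -subr_ge0.
  have -> : dl / 2 + dl^-1 / 2 * x ^+ 2 - x = dl^-1 / 2 * (dl - x) ^+ 2 by field; lra.
  by rewrite mulr_ge0 ?sqr_ge0 // divr_ge0 // invr_ge0 ltW.
rewrite (E_D I0 I1) E_cst (E_Z _ ID2).
have : dl^-1 / 2 * E (fun w => D k j j' k%:R w ^+ 2) <= dl^-1 / 2 * dl ^+ 2.
  by rewrite ler_wpM2l ?divr_ge0 ?invr_ge0 ?(ltW dl0) //; exact: fd.
have -> : dl^-1 / 2 * dl ^+ 2 = dl / 2 by field; lra.
rewrite -/dl; lra.
Qed.

(** Up to time [k] the L^1 norm of a martingale is nondecreasing; after it the stopped processes are
    constant, as [tau k] is at most [k]. *)
Let D_L1_all k j j' t : (k <= j)%N -> (j <= j')%N -> 0 <= t ->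
  E (fun w => `|D k j j' t w|) <= h2 j * h2 j.
Proof.
move=> kj jj' t0; apply: le_trans (D_L1 kj jj'); have [tk|kt] := ler_or_gtr t k%:R.
  have := mart_contract FP (D_mart k j j') t0 tk (wrtT (filtration_sigma FP t0)).
  have ET r : E (fun w => \1_[set: T] w * `|D k j j' r w|) = E (fun w => `|D k j j' r w|).
    by apply: E_ext => w; rewrite indicT mul1r.
  by rewrite !ET.
suff -> : D k j j' t = D k j j' k%:R by [].
apply/funext => w; have h := tau_le k w.
have h' : (tau k w <= t%:E)%E by rewrite (le_trans h) // lee_fin ltW.
by rewrite /D /stopped (min_idPr h) (min_idPr h').
Qed.

(** Dyadic subdivisions of [0, j]: they are nested in [N], so the events increase to [B j], and each
    is covered by the finite maximal inequality. *)
Let C j N : set T := \bigcup_(i < (2 ^ N).+1)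
  [set w | h2 j <= `|D j j j.+1 (j%:R * dyad N i) w|].
Let B j : set T := \bigcup_N C j N.

Let pt0 j N i : 0 <= j%:R * dyad N i :> R.
Proof. by rewrite mulr_ge0 // dyad_ge0. Qed.

Let mC j N : measurable (C j N).
Proof.
have /(martingaleP FP)[aD _ _] := D_mart j j j.+1.
apply: bigcup_measurable => i _; apply: (filt_measurable FP (pt0 j N i)).
have sF := filtration_sigma FP (pt0 j N i).
by apply: (wrt_le sF); [exact: wrt_cst|apply: (wrt_norm sF); exact: aD].
Qed.

Let mB j : measurable (B j). Proof. exact: bigcup_measurable. Qed.

Let PC j N : (P (C j N) <= (h2 j)%:E)%E.
Proof.
have mono : {homo (fun i => j%:R * dyad N i : R) : a b / (a <= b)%N >-> a <= b}.
  by move=> a b ab; rewrite ler_wpM2l // dyad_mono.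
have end_j : j%:R * dyad N (2 ^ N) <= j%:R :> R.
  by rewrite /dyad natrX divff ?mulr1 // expf_neq0 // pnatr_eq0.
have /(martingaleP FP)[aD ID _] := D_mart j j j.+1.
have IC : L1 (\1_(C j N) : T -> R).
  by apply: (@L1_bounded _ _ _ P _ 1) => // w; exact: norm_indic_le1.
have -> : P (C j N) = (E (\1_(C j N)))%:E.
  by rewrite EFin_E // integral_indic // setIT.
rewrite lee_fin -(ler_pM2l (h2gt0 j)).
apply: (le_trans (mart_maximal FP (D_mart j j j.+1) mono (pt0 j N 0) end_j (ltW (h2gt0 j)))).
apply: le_trans (D_L1 (leqnn j) (leqnSn j)); apply: E_le.
- by apply: L1_indic; [exact: mC|apply: L1_norm; exact: ID].
- by apply: L1_norm; exact: ID.
- by move=> w; rewrite indicE; case: (w \in _); rewrite ?mul1r // mul0r.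
Qed.

Let PB j : (P (B j) <= (h2 j)%:E)%E.
Proof.
have C_mono : nondecreasing_seq (C j).
  apply/nondecreasing_seqP => N; apply/subsetPset => w [i /= iN h].
  exists i.*2; last by rewrite /= dyadS.
  by rewrite /= expnS ltnS mul2n leq_double.
have cv := @nondecreasing_cvg_mu _ _ _ P (C j) (mC j) (mB j) C_mono.
rewrite -(cvg_lim _ cv) //; apply: lime_le; first exact: cvgP cv.
by apply: nearW => N; exact: PC.
Qed.

Let limsupB : P (lim_sup_set B) = 0%E.
Proof.
apply: lim_sup_set_cvg0 => //; apply: (@le_lt_trans _ _ 2%:E); last exact: ltry.
apply: lime_le; first by apply: is_cvg_nneseries => n _ _; exact: measure_ge0.
apply: nearW => n; apply: (@le_trans _ _ (2 - 2 * h2 n)%:E).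
  elim: n => [|n IH]; first by rewrite big_nil lee_fin expr0; lra.
  rewrite big_nat_recr //=; apply: (le_trans (leeD IH (PB n))).
  by rewrite -EFinD lee_fin exprS; lra.
by rewrite lee_fin gerBl mulr_ge0 // ltW.
Qed.

(** An excess over 2^-j at some time persists nearby by continuity, hence shows at a point of a fine
    enough dyadic subdivision. *)
Let B_bound j w t : ~ B j w -> 0 <= t -> t <= j%:R -> `|D j j j.+1 t w| <= h2 j.
Proof.
move=> nB t0 tj; rewrite leNgt; apply/negP => hlt.
have d0 : 0 < `|D j j j.+1 t w| - h2 j by rewrite subr_gt0.
have [dl dl0 hd] := (cpathP _).1 (@D_cpath j j j.+1 w) t t0 _ d0.
have [N hN] : exists N : nat, j%:R * h2 N < dl.
  have : j%:R * h2 n @[n --> \oo] --> (j%:R * 0 : R).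
    apply: cvgM; first exact: cvg_cst.
    by apply: cvg_expr; rewrite ger0_norm ?invr_ge0 // invf_lt1 // ltr1n.
  rewrite mulr0 => /cvgrPdist_lt /(_ dl dl0)[N _ /(_ N (leqnn N))] /=.
  by rewrite sub0r normrN => hN; exists N; apply: le_lt_trans hN; exact: ler_norm.
have [i] := grid_near (2 ^ N).-1 t0 tj.
have p2 : (2 ^ N).-1.+1 = (2 ^ N)%N by rewrite prednK // expn_gt0.
have -> : grid 0 j%:R (2 ^ N).-1 i = j%:R * dyad N i :> R.
  by rewrite /grid p2 subr0 add0r natrX /dyad mulrA.
rewrite p2 natrX -exprVn => iN hi.
apply: nB; exists N => //; exists i => //=.
have := hd _ (pt0 j N i) (le_lt_trans hi hN).
have := lerB_dist (D j j j.+1 t w) (D j j j.+1 (j%:R * dyad N i) w); lra.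
Qed.

(** Its complement is null, hence [Gd] lies in every [F t] by completeness; setting the limit to 0
    off [Gd] therefore preserves adaptedness. *)
Let Gd : set T := [set w | tau n w @[n --> \oo] --> +oo%E /\ ~ lim_sup_set B w].

Let ae_Gd : {ae P, forall w, Gd w}.
Proof.
have h : {ae P, forall w, ~ lim_sup_set B w}.
  exists (lim_sup_set B); split=> //; last by move=> w /= /contrapT.
  by apply: bigcap_measurable => // n _; exact: bigcup_measurable.
by apply: filterS2 tau_inf h => w [_ ?] ?; split.
Qed.

Let F_Gd t : 0 <= t -> F t Gd.
Proof.
move=> t0; rewrite -[Gd]setCK; apply: (wrtC (filtration_sigma FP t0)).
by apply: (null_filt FP t0); exact: ae_Gd.
Qed.

Let Gd_unif w : Gd w -> forall t, 0 <= t -> exists N, forall j, (N <= j)%N ->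
  forall s, 0 <= s -> s <= t -> `|f j s w - f j.+1 s w| <= h2 j.
Proof.
move=> [/cvgeyPge tw nB] t t0.
have [n0 hn0] : exists n0, forall j, (n0 <= j)%N -> ~ B j w.
  apply: contrapT => hn; apply: nB => n _; apply: contrapT => hB; apply: hn.
  by exists n => j nj Bj; apply: hB; exists j.
(* Beyond this index stopping has no effect on [0, t]; t + 1 rather than t keeps [tau j w] positive
   also when t = 0, as the indicator in [stopped] requires. *)
have [n1 _ hn1] := tw (t + 1).
exists (maxn (maxn n0 n1) (Num.truncn t).+1) => j; rewrite !geq_max => /andP[/andP[j0 j1] j2].
move=> s s0 st; have tauj : ((t + 1)%:E <= tau j w)%E by exact: hn1.
have stE X : stopped X (tau j) s w = X s w.
  have h : (s%:E <= tau j w)%E by rewrite (le_trans _ tauj) // lee_fin; lra.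
  rewrite /stopped (min_idPl h) ifT //.
  by rewrite (lt_le_trans _ tauj) // lte_fin; lra.
have := B_bound (hn0 j j0) s0; rewrite /D !stE; apply; apply: (le_trans st).
by rewrite ltW // (lt_le_trans (truncnS_gt t)) // ler_nat.
Qed.

Definition limproc t w : R := if w \in Gd then lim (f j t w @[j --> \oo]) else 0.

Let limE w t : Gd w -> limproc t w = lim (f j t w @[j --> \oo]).
Proof. by move=> h; rewrite /limproc mem_set. Qed.

Let lim_unif w : Gd w -> forall t, 0 <= t -> exists N, forall j, (N <= j)%N ->
  forall s, 0 <= s -> s <= t -> `|f j s w - limproc s w| <= 2 * h2 j.
Proof.
move=> Gw t t0; have [N hN] := Gd_unif Gw t0; exists N => j Nj s s0 st.
rewrite limE //; apply: (geometric_cauchy (u := fun j => f j s w) (N := N) _).2 => // i Ni.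
exact: hN.
Qed.

Let lim_cvg w t : Gd w -> 0 <= t -> f j t w @[j --> \oo] --> limproc t w.
Proof.
move=> Gw t0; have [N hN] := Gd_unif Gw t0; rewrite limE //.
by apply: (geometric_cauchy (u := fun j => f j t w) (N := N) _).1 => i Ni; exact: hN.
Qed.

Lemma limproc_cpath w : cpath (limproc ^~ w).
Proof.
have [Gw|nGw] := pselect (Gd w).
  apply: (@uniform_limit_cpath _ (fun j => f j ^~ w)); last exact: lim_unif.
  by move=> j; have [_ cj _ _ _] := fC j.
rewrite (_ : limproc ^~ w = (fun=> 0)); first exact: cpath_cst.
by apply/funext => t; rewrite /limproc memNset.
Qed.

Lemma limproc_adapted : adapted F limproc.
Proof.
move=> t t0; have sF := filtration_sigma FP t0.
apply: (wrt_cvg sF (f_ := fun j w => if w \in Gd then f j t w else 0)) => [j|w].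
  apply: (wrt_if sF); [exact: F_Gd| |exact: wrt_cst].
  by have [aj _ _ _ _] := fC j; exact: aj.
have [Gw|nGw] := pselect (Gd w); first by rewrite mem_set //; exact: lim_cvg.
by rewrite /limproc memNset //; exact: cvg_cst.
Qed.

Let stopped_cvg k t w : Gd w -> 0 <= t ->
  stopped (f j) (tau k) t w @[j --> \oo] --> stopped limproc (tau k) t w.
Proof.
move=> Gw t0; rewrite /stopped; case: ifP => _; last exact: cvg_cst.
by apply: lim_cvg => //; apply: fine_min_ge0 => //; exact: (tau_st k).1.
Qed.

(** For fixed [k] the stopped approximations converge in L^1 at every time, at the rate 4^-j, and
    the martingale identity is preserved by such limits. *)
Lemma limproc_stopped_mart k : martingale P F (stopped limproc (tau k)).
Proof.
have aS : adapted F (stopped limproc (tau k)).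
  move=> t t0; have sF := filtration_sigma FP t0.
  apply: (wrt_cvg sF (f_ := fun j w => if w \in Gd then stopped (f j) (tau k) t w else 0)) => [j|w].
    apply: (wrt_if sF); [exact: F_Gd| |exact: wrt_cst].
    by have [_ _ /(_ k)[aj _ _] _ _] := fC j; exact: aj.
  have [Gw|nGw] := pselect (Gd w); first by rewrite mem_set //; exact: stopped_cvg.
  rewrite memNset // /stopped /limproc memNset //.
  by case: ifP => _; exact: cvg_cst.
have mf j : martingale P F (stopped (f j) (tau k)) by have [_ _ mj _ _] := fC j; exact: mj.
have If j t : 0 <= t -> L1 (stopped (f j) (tau k) t).
  by have /(martingaleP FP)[_ Ij _] := mf j; exact: Ij.
have lim j t : (k <= j)%N -> 0 <= t -> L1 (stopped limproc (tau k) t) /\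
    E (fun w => `|stopped (f j) (tau k) t w - stopped limproc (tau k) t w|) <= h2 j * h2 j.
  move=> kj t0; apply: (L1_limit (xi := fun j => stopped (f j) (tau k) t)).
  - by move=> n; exact: If.
  - exact: (wrt_measurable FP t0 (aS _ t0)).
  - by apply: filterS ae_Gd => w Gw; exact: stopped_cvg.
  - by move=> n jn; exact: D_L1_all.
apply/(martingaleP FP); split; [exact: aS| |move=> s t A s0 st FA].
  by move=> t t0; exact: (lim k t (leqnn k) t0).1.
have t0 := le_trans s0 st; have mA := filt_measurable FP s0 FA.
have near j r : (k <= j)%N -> 0 <= r ->
    `|E (fun w => \1_A w * stopped (f j) (tau k) r w) - E (fun w => \1_A w * stopped limproc (tau k) r w)|
    <= h2 j * h2 j.
  move=> kj r0; have [IL EL] := lim j r kj r0.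
  have IB := L1B (If j r r0) IL.
  have Ij := If j r r0.
  rewrite -(E_B (L1_indic mA Ij) (L1_indic mA IL)).
  apply: (le_trans (E_abs (L1B (L1_indic mA Ij) (L1_indic mA IL)))).
  apply: le_trans EL; apply: E_le; [|exact: L1_norm|].
    by apply: L1_norm; exact: L1B (L1_indic mA Ij) (L1_indic mA IL).
  by move=> w; rewrite -mulrBr normrM ler_piMl // norm_indic_le1.
apply/eqP; rewrite -subr_eq0 -normr_le0; apply/ler_addgt0Pr => e e0; rewrite add0r.
have [j [kj hj]] : exists j, (k <= j)%N /\ h2 j < e / 2.
  have : h2 n @[n --> \oo] --> (0 : R).
    by apply: cvg_expr; rewrite ger0_norm ?invr_ge0 // invf_lt1 // ltr1n.
  move=> /cvgrPdist_lt /(_ (e / 2)) []; first by lra.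
  move=> n0 _ /(_ (maxn n0 k) (leq_maxl _ _)) /=; rewrite sub0r normrN => h.
  by exists (maxn n0 k); split; [exact: leq_maxr|apply: le_lt_trans h; exact: ler_norm].
have hh : h2 j * h2 j <= h2 j.
  by rewrite ler_piMl ?(ltW (h2gt0 j)) // exprn_ile1 // ?invr_ge0 // invf_le1 // ler1n.
have fin : h2 j * h2 j + h2 j * h2 j <= e.
  by rewrite [leRHS]splitr; apply: lerD; exact: le_trans hh (ltW hj).
have n1 := near j s kj s0; have n2 := near j t kj t0.
have /(martingaleP FP)[_ _ /(_ s t A s0 st FA) e1] := mf j; rewrite e1 in n2.
exact: le_trans (ler_dist_sum n1 n2) fin.
Qed.

Lemma norm_decomposes : exists m' v', decomposes P F (fun t w => `|M t w|) m' v'.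
Proof.
exists limproc, (fun t w => `|M t w| - limproc t w).
have cv w : cpath (fun t => `|M t w| - limproc t w).
  by apply: cpathB; [apply: (cpath_norm (x := M ^~ w)); exact: cM|exact: limproc_cpath].
split.
- split; first exact: limproc_adapted.
    by apply: aeW => w; apply: cpath_cadlag; exact: limproc_cpath.
  exists tau; split; [exact: tau_st|exact: tau_inf|exact: limproc_stopped_mart].
- split.
  + move=> t t0; have sF := filtration_sigma FP t0.
    apply: (wrtB sF); last exact: limproc_adapted.
    by apply: (wrt_norm sF); exact: aM.
  + by apply: aeW => w; apply: (cpath_cadlag (X := fun t w => `|M t w| - limproc t w)); exact: cv.
  + apply: filterS ae_Gd => w Gw t t0.
    apply: (@diff_nondecreasing_bv _ _ (V ^~ w)) => //; first by move=> s u; exact: Vmono.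
    apply: lower_variation => //; first by move=> s u; exact: Vmono.
    (* The dyadic inequality of order [n] holds for every [f k] with n <= k, because the classes are
       nested, and passes to the pointwise limit. *)
    move=> n i j ij jn.
    have c p : 0 <= p -> `|M p w| - f k p w + V p w @[k --> \oo] -->
        `|M p w| - limproc p w + V p w.
      move=> p0; apply: cvgD; last exact: cvg_cst.
      by apply: cvgB; [exact: cvg_cst|exact: lim_cvg].
    apply: ler_cvg_to (c _ (dyad_ge0 n i)) (c _ (dyad_ge0 n j)) _.
    exists n => // k /= nk.
    have : approx_class P F M V tau n (f k).
      have nest p X : approx_class P F M V tau (p + n) X -> approx_class P F M V tau n X.
        by elim: p => [//|p IH] h; apply: IH; exact: approx_class_nested.
      by apply: (nest (k - n)%N); rewrite subnK //; exact: fC.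
    by move=> [_ _ _ _]; exact.
- by apply: aeW => w t _; rewrite addrC subrK.
Qed.

End NormSemimartingale.
(** * Conclusion *)

Section Assembly.
Context {R : realType} {d : measure_display} {T : measurableType d}.
Variables (P : probability T R) (F : R -> set (set T)).
Hypothesis FP : usual_filtration P F.
Implicit Types (s t u c lm K : R) (A B G : set T) (X Y Z W D M m v : R -> T -> R).
Local Notation cpath x := ({within [set t : R | 0 <= t], continuous (x : R -> R)}).

(** One sequence bounds both processes, by hitting times of |Z| + |W|. The original localizing
    sequence of [Z] is cut further by bounded stopping, which [mart_stop] allows. *)
Lemma localize Z W : local_martingale P F Z -> adapted F W ->
  (forall w, cpath (Z ^~ w)) -> (forall w, cpath (W ^~ w)) ->
  exists tau : nat -> T -> \bar R,
    [/\ forall n, stopping_time F (tau n),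
        {ae P, forall w, nondecreasing_seq (tau ^~ w) /\ tau n w @[n --> \oo] --> +oo%E},
        forall n w, (tau n w <= n%:R%:E)%E,
        forall n, martingale P F (stopped Z (tau n)) &
        forall n t w, 0 <= t -> `|stopped Z (tau n) t w| <= n%:R /\ `|stopped W (tau n) t w| <= n%:R].
Proof.
move=> [aZ _ [rho [rho_st rho_inf rho_mart]]] aW cZ cW.
pose X t w := `|Z t w| + `|W t w|.
have aX : adapted F X.
  move=> t t0; have sF := filtration_sigma FP t0.
  by apply: (wrtD sF); apply: (wrt_norm sF); [exact: aZ|exact: aW].
have cX w : cpath (X ^~ w).
  by apply: cpathD; [apply: (cpath_norm (x := Z ^~ w))|apply: (cpath_norm (x := W ^~ w))].
have tau_st n : stopping_time F (loc rho X n) by exact: (loc_stopping FP).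
have tau_bnd n t w : 0 <= t ->
    `|stopped Z (loc rho X n) t w| <= n%:R /\ `|stopped W (loc rho X n) t w| <= n%:R.
  move=> t0; rewrite /stopped; case: ifP => l0; last by rewrite normr0.
  have := loc_bound cX t0 l0; rewrite /X ger0_norm ?addr_ge0 // => h.
  by split; apply: le_trans h; rewrite ?lerDl ?lerDr.
exists (loc rho X); split=> //.
- by apply: filterS rho_inf => w [h1 h2]; split; [exact: loc_mono|exact: loc_cvg].
- by move=> n w; exact: loc_le.
- move=> n; pose sg w := Order.min (hit (X ^~ w) n%:R) n%:R%:E.
  have sg_st : stopping_time F sg.
    by apply: (stopping_min FP); [exact: (hit_stopping FP)|exact: (stopping_cst FP)].
  have rho0 w : (0 <= rho n w)%E by exact: (rho_st n).1.
  have sg0 w : (0 <= sg w)%E by exact: sg_st.1.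
  have stst t w : 0 <= t -> stopped (stopped Z (rho n)) sg t w = stopped Z (loc rho X n) t w.
    exact: stopped_stopped.
  apply: (mart_ext FP stst); apply: (mart_stop FP) (rho_mart n) _ => //.
  + by have [] := rho_mart n.
  + by move=> w; apply: stopped_cpath.
  + by move=> t w t0; rewrite stst //; exact: (tau_bnd n t w t0).1.
Qed.

(* Both M D and |M| D satisfy the hypotheses on Z, with c = -1 and c = 1. *)
Lemma switch_sign M D Z c : adapted F M -> martingale P F D -> local_martingale P F Z ->
  (forall w, cpath (M ^~ w)) -> (forall w, cpath (D ^~ w)) -> (forall w, cpath (Z ^~ w)) ->
  `|c| = 1 ->
  (forall t w, 0 <= t -> 0 < M t w -> Z t w = M t w * D t w) ->
  (forall t w, 0 <= t -> M t w < 0 -> c * Z t w = - M t w * D t w) ->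
  (forall t w, 0 <= t -> M t w = 0 -> Z t w = 0 /\ D t w = 0) ->
  local_martingale P F (fun t w => M t w * D t w) /\
  local_martingale P F (fun t w => `|M t w| * D t w).
Proof.
move=> aM mD lZ cM cD cZ c1 Zpos Zneg Zzero; have [aD _ _] := mD.
have [tau [tau_st tau_inf _ tau_mart tau_bnd]] := localize lZ aD cZ cD.
have ZMD t w : 0 <= t -> `|Z t w| = `|M t w * D t w|.
  move=> t0; have [h|h|h] := ltgtP (M t w) 0.
  - by rewrite -[LHS]mul1r -c1 -normrM Zneg // mulNr normrN.
  - by rewrite Zpos.
  - by have [-> ->] := Zzero t w t0 h; rewrite mulr0.
pose M' n := stopped M (tau n); pose D' n := stopped D (tau n); pose Z' n := stopped Z (tau n).
have t0' n w : (0 <= tau n w)%E by exact: (tau_st n).1.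
have aM' n : adapted F (M' n) by exact: (stopped_adapted FP).
have cM' n w : cpath (M' n ^~ w) by exact: stopped_cpath.
have cD' n w : cpath (D' n ^~ w) by exact: stopped_cpath.
have mD' n : martingale P F (D' n).
  by apply: (mart_stop FP) mD _ => // t w s0; exact: (tau_bnd n t w s0).2.
have DK n t w : 0 <= t -> `|D' n t w| <= n%:R by move=> s0; exact: (tau_bnd n t w s0).2.
have ZK n t w : 0 <= t -> `|Z' n t w| <= n%:R by move=> s0; exact: (tau_bnd n t w s0).1.
have ZMD' n t w : 0 <= t -> `|Z' n t w| = `|M' n t w * D' n t w|.
  move=> s0; rewrite /Z' /M' /D' /stopped; case: ifP => _; last by rewrite mulr0.
  by apply: ZMD; exact: fine_min_ge0.
have Zpos' n t w : 0 <= t -> 0 < M' n t w -> Z' n t w = M' n t w * D' n t w.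
  move=> s0; rewrite /Z' /M' /D' /stopped; case: ifP => _; last by rewrite ltxx.
  by apply: Zpos; exact: fine_min_ge0.
have Zneg' n t w : 0 <= t -> M' n t w < 0 -> c * Z' n t w = - M' n t w * D' n t w.
  move=> s0; rewrite /Z' /M' /D' /stopped; case: ifP => _; last by rewrite ltxx.
  by apply: Zneg; exact: fine_min_ge0.
(* Where [tau n w] is 0 the stopped processes are identically 0, so the inclusion of the zero sets
   survives stopping. *)
have MD0' n t w : 0 <= t -> M' n t w = 0 -> D' n t w = 0.
  move=> s0; rewrite /M' /D' /stopped; case: ifP => // _ h.
  by apply: (Zzero _ _ _ h).2; exact: fine_min_ge0.
have pos n : martingale P F (fun t w => Num.max (M' n t w) 0 * D' n t w).
  exact: (pos_part_martingale FP (ler0n R n) (aM' n) (cM' n) (cD' n) (mD' n) (tau_mart n)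
    (@DK n) (@ZK n) (@ZMD' n) (@Zpos' n) (@MD0' n)).
(* The same statement for -M, with c Z in the role of [Z]: it equals (-M) D where -M > 0, and it is
   still a bounded martingale. *)
have neg n : martingale P F (fun t w => Num.max (- M' n t w) 0 * D' n t w).
  apply: (pos_part_martingale FP (M := fun t w => - M' n t w) (Z := fun t w => c * Z' n t w)
    (ler0n R n) _ _ (cD' n) (mD' n) (martZ FP c (tau_mart n)) (@DK n)).
  - by move=> t s0; apply: (wrtN (filtration_sigma FP s0)); exact: aM'.
  - by move=> w; apply: (cpathN (x := M' n ^~ w)).
  - by move=> t w s0; rewrite normrM c1 mul1r; exact: ZK.
  - by move=> t w s0; rewrite normrM c1 mul1r mulNr normrN; exact: ZMD'.
  - by move=> t w s0; rewrite oppr_gt0; exact: Zneg'.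
  - by move=> t w s0 /eqP; rewrite oppr_eq0 => /eqP; exact: MD0'.
have cMD w : cpath (fun t => M t w * D t w).
  by apply: (cpathM (x := M ^~ w)).
have caMD w : cpath (fun t => `|M t w| * D t w).
  by apply: (cpathM (x := fun t => `|M t w|)) => //; apply: (cpath_norm (x := M ^~ w)).
split; split.
- by move=> t s0; apply: (wrtM (filtration_sigma FP s0)); [exact: aM|exact: aD].
- by apply: aeW => w; apply: (cpath_cadlag (X := fun t w => M t w * D t w)).
- exists tau; split; [exact: tau_st|exact: tau_inf|move=> n].
  apply: (mart_ext FP _ (martD FP (pos n) (martZ FP (-1) (neg n)))) => t w s0.
  transitivity (M' n t w * D' n t w); last first.
    by rewrite /M' /D' /stopped; case: ifP => // _; rewrite mulr0.
  rewrite mulN1r -mulrBl; congr (_ * _).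
  have [h|h] := ler_or_gtr (M' n t w) 0.
    by rewrite (max_idPr h) max_l ?oppr_ge0 // sub0r opprK.
  by rewrite (max_idPl (ltW h)) max_r ?oppr_le0 ?(ltW h) // subr0.
- move=> t s0; have sF := filtration_sigma FP s0.
  by apply: (wrtM sF); [apply: (wrt_norm sF); exact: aM|exact: aD].
- by apply: aeW => w; apply: (cpath_cadlag (X := fun t w => `|M t w| * D t w)).
- exists tau; split; [exact: tau_st|exact: tau_inf|move=> n].
  apply: (mart_ext FP _ (martD FP (pos n) (neg n))) => t w s0.
  transitivity (`|M' n t w| * D' n t w); last first.
    by rewrite /M' /D' /stopped; case: ifP => // _; rewrite mulr0.
  rewrite -mulrDl; congr (_ * _).
  have [h|h] := ler_or_gtr (M' n t w) 0.
    by rewrite (max_idPr h) max_l ?oppr_ge0 // add0r ler0_norm.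
  by rewrite (max_idPl (ltW h)) max_r ?oppr_le0 ?(ltW h) // addr0 gtr0_norm.
Qed.

(** [V] controls the increments of the finite variation part M - m. Only [m] has to be localized,
    hence its double role in [localize]. *)
Lemma norm_semimartingale M m V : adapted F M -> local_martingale P F m ->
  (forall w, cpath (M ^~ w)) -> (forall w, cpath (m ^~ w)) ->
  (forall w s t, 0 <= s -> s <= t ->
    `|M t w - m t w - (M s w - m s w)| <= V t w - V s w) ->
  exists m' v', decomposes P F (fun t w => `|M t w|) m' v'.
Proof.
move=> aM lm cM cm MV; have [am _ _] := lm.
have [tau [tau_st tau_inf tau_le tau_mart tau_bnd]] := localize lm am cm cm.
have e0 j : 0 < (2^-1 ^+ j * 2^-1 ^+ j) ^+ 2 :> R.
  by rewrite exprn_gt0 // mulr_gt0 // exprn_gt0 // invr_gt0.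
have bnd k t w : 0 <= t -> `|stopped m (tau k) t w| <= k%:R.
  by move=> t0; exact: (tau_bnd k t w t0).1.
have [f [fC fd]] := approx_cauchy FP aM am cm MV tau_st tau_mart bnd e0.
apply: (norm_decomposes FP aM cM tau_st tau_le tau_inf _ fC fd).
by move=> w s t s0 st; rewrite -subr_ge0 (le_trans _ (MV w s t s0 st)).
Qed.

Lemma density_martingale (Q : set T -> \bar R) D : density_process P F Q D -> martingale P F D.
Proof.
move=> [aD ID QD]; split=> // s t s0 st; split; [exact: aD|exact: ID|move=> A FA].
rewrite -QD // -QD //; [exact: le_trans st|exact: (filtration_mono FP s0 st)].
Qed.

(* As the filtration is complete, processes may be killed on a null set, after
   which their path properties hold for all w. *)
Definition restr G X : R -> T -> R := fun t w => if w \in G then X t w else 0.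

Lemma restr_ae G X : {ae P, forall w, G w} ->
  {ae P, forall w, forall t, 0 <= t -> X t w = restr G X t w}.
Proof. by apply: filterS => w Gw t _; rewrite /restr mem_set. Qed.

Lemma restr_cpath G X w : (G w -> cpath (X ^~ w)) -> cpath (restr G X ^~ w).
Proof.
move=> cX; have [Gw|nGw] := pselect (G w).
  rewrite (_ : restr G X ^~ w = X ^~ w); first exact: cX.
  by apply/funext => t; rewrite /restr mem_set.
rewrite (_ : restr G X ^~ w = (fun=> 0)); first exact: cpath_cst.
by apply/funext => t; rewrite /restr memNset.
Qed.

End Assembly.

Theorem theorem2 (R : realType) (d : measure_display) (T : measurableType d)
    (P : probability T R) (Q : {charge set T -> \bar R})
    (F : R -> set (set T)) (D : R -> T -> R) (Dinf : {RV P >-> R})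
    (M m v : R -> T -> R)
    (F_usual : usual_filtration P F)
    (Q_abs_cont : Q `<< P)
    (D_density : density_process P F Q D)
    (D_cont : continuous_process P D)
    (D_lim : {ae P, forall w, D t w @[t --> +oo] --> Dinf w})
    (Dinf_neq0 : P [set w | Dinf w = 0] = 0%E)
    (M_semi : continuous_semimartingale P F M m v)
    (M_zeros : {ae P, forall w, zero_set M w `<=` zero_set D w}) :
  QP_local_martingale P F D M <->
  QP_local_martingale P F D (fun t w => `|M t w|).
Proof.
have FP := F_usual; have mD := density_martingale FP D_density.
have [aM M_cont [lm [av v_cadlag v_bv] MmvE] m_cont v_cont] := M_semi.
have aD : adapted F D by have [] := mD.
(* All almost sure path properties at once; the restricted processes then satisfy those used below
   for every [w]. *)
pose G := [set w | ({within [set t | 0 <= t], continuous (M ^~ w)} /\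
    {within [set t | 0 <= t], continuous (D ^~ w)} /\
    {within [set t | 0 <= t], continuous (m ^~ w)}) /\
  (forall t : R, 0 <= t -> bounded_variation 0 t (v ^~ w)) /\
  (forall t : R, 0 <= t -> M t w = m t w + v t w) /\
  zero_set M w `<=` zero_set D w].
have aeG : {ae P, forall w, G w}.
  apply: filterS2 (filterI M_cont (filterI D_cont m_cont))
    (filterI v_bv (filterI MmvE M_zeros)).
  by move=> w [? [? ?]] [? [? ?]].
have ae X := restr_ae X aeG.
pose M' := restr G M; pose D' := restr G D; pose m' := restr G m.
have aM' : adapted F M' := adapted_ae FP (ae M) aM.
have aD' : adapted F D' := adapted_ae FP (ae D) aD.
have cM' w : {within [set t : R | 0 <= t], continuous (M' ^~ w : R -> R)}.
  by apply: restr_cpath => -[[]].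
have cD' w : {within [set t : R | 0 <= t], continuous (D' ^~ w : R -> R)}.
  by apply: restr_cpath => -[[_ []]].
have cm' w : {within [set t : R | 0 <= t], continuous (m' ^~ w : R -> R)}.
  by apply: restr_cpath => -[[_ []]].
have mD' : martingale P F D'.
  by apply: (mart_ae FP) mD => t t0; apply: filterS (ae D) => w; exact.
(* On [G] this is the inclusion of the zero sets; off [G] the restricted [D] is 0 anyway. *)
have zero' t w : 0 <= t -> M' t w = 0 -> D' t w = 0.
  rewrite /M' /D' /restr => t0; case: ifP => //; rewrite inE => -[_ [_ [_ Gz]]] Mt.
  by have [] := Gz t (conj t0 Mt).
have aeMD : {ae P, forall w, forall t : R, 0 <= t -> M t w * D t w = M' t w * D' t w}.
  by apply: filterS2 (ae M) (ae D) => w hM hD t t0; rewrite hM // hD.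
have aeMDr : {ae P, forall w, forall t : R, 0 <= t -> M' t w * D' t w = M t w * D t w}.
  by apply: filterS aeMD => w h t t0; rewrite h.
have aeaMD : {ae P, forall w, forall t : R, 0 <= t -> `|M t w| * D t w = `|M' t w| * D' t w}.
  by apply: filterS2 (ae M) (ae D) => w hM hD t t0; rewrite hM // hD.
have aeaMDr : {ae P, forall w, forall t : R, 0 <= t -> `|M' t w| * D' t w = `|M t w| * D t w}.
  by apply: filterS aeaMD => w h t t0; rewrite h.
have M_cadlag : cadlag_process P M by apply: filterS M_cont => w; exact: cpath_cadlag.
split=> -[_ _ lZ].
- have lZ' := local_martingale_ae FP aeMD lZ.
  have cZ w : {within [set t : R | 0 <= t], continuous (fun t => M' t w * D' t w)}.
    exact: (cpathM (x := M' ^~ w)).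
  have [_ laMD] : local_martingale P F (fun t w => M' t w * D' t w) /\
      local_martingale P F (fun t w => `|M' t w| * D' t w).
    apply: (switch_sign FP (c := -1) aM' mD' lZ' cM' cD' cZ) => //.
    + by rewrite normrN1.
    + by move=> t w _ _; rewrite mulN1r mulNr.
    + by move=> t w t0 h; rewrite (zero' t w t0 h) mulr0.
  have a_norm : adapted F (fun t w => `|M t w|).
    by move=> t t0; apply: (wrt_norm (filtration_sigma FP t0)); exact: aM.
  split; [exact: a_norm| |exact: (local_martingale_ae FP aeaMDr laMD)].
  split; [exact: a_norm| |].
    apply: filterS M_cont => w cMw.
    by apply: (cpath_cadlag (X := fun t w => `|M t w|)); exact: (cpath_norm (x := M ^~ w)).
  (* The total variation of [v] dominates the increments of [v], which is M - m on [G]; off [G] all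
     processes involved are 0. *)
  pose V t w := if w \in G then fine (total_variation 0 t (v ^~ w)) else 0.
  have MV w s t : 0 <= s -> s <= t ->
      `|M' t w - m' t w - (M' s w - m' s w)| <= V t w - V s w.
    move=> s0 st; rewrite /M' /m' /V /restr; case: ifP => wG; last by rewrite !subrr normr0.
    move: wG; rewrite inE => -[_ [bv [Mmv _]]].
    have dv r : 0 <= r -> M r w - m r w = v r w by move=> r0; rewrite Mmv // addrAC subrr add0r.
    rewrite !dv ?(le_trans s0) //.
    exact: total_variation_incr.
  have lm' := local_martingale_ae FP (ae m) lm.
  have [m1 [v1 [lm1 fv1 e1]]] := norm_semimartingale FP aM' lm' cM' cm' MV.
  exists m1, v1; split=> //.
  by apply: filterS2 (ae M) e1 => w hM h t t0; rewrite hM // h.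
- have lZ' := local_martingale_ae FP aeaMD lZ.
  have cZ w : {within [set t : R | 0 <= t], continuous (fun t => `|M' t w| * D' t w)}.
    by apply: (cpathM (x := fun t => `|M' t w|)) => //; exact: (cpath_norm (x := M' ^~ w)).
  have [lMD _] : local_martingale P F (fun t w => M' t w * D' t w) /\
      local_martingale P F (fun t w => `|M' t w| * D' t w).
    apply: (switch_sign FP (c := 1) aM' mD' lZ' cM' cD' cZ) => //.
    + by rewrite normr1.
    + by move=> t w _ h; rewrite gtr0_norm.
    + by move=> t w _ h; rewrite mul1r ltr0_norm.
    + by move=> t w t0 h; rewrite (zero' t w t0 h) mulr0.
  split; [exact: aM| |exact: (local_martingale_ae FP aeMDr lMD)].
  by split; [exact: aM|exact: M_cadlag|exists m, v; split].
Qed.
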